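(* Let $\ell$ be a prime number. Consider the random group $$Z_n:=\tilde{\mathcal G}_n\big/[a_1,\dots,a_n,\phi(a_1),\dots,\phi(a_n)]$$ where $\phi$ is a random automorphism of $\tilde{\mathcal G}_n$ that preserves and acts trivially on $\ker\pi_n$, and $[\,\cdots]$ denotes the closed normal subgroup generated by the listed elements. Then for any finite $\ell$-group $H$, $$\lim_{n\to\infty}\mathbb E\big(\#\mathrm{Sur}(Z_n,H)\big)=|[H,H]|\cdot|H_2(H,\mathbb Z)|.$$
   Context: $\mathcal G_n$ is the pro-$\ell$ Demuškin group with abelianization $\mathbb Z_\ell^{2n}$ given by the pro-$\ell$ presentation $\langle a_1,\dots,a_n,b_1,\dots,b_n\mid[a_1,b_1]\cdots[a_n,b_n]\rangle$. Let $F$ be the free pro-$\ell$ group on $a_1,\dots,a_n,b_1,\dots,b_n$ and $R$ the closed normal subgroup generated by $[a_1,b_1]\cdots[a_n,b_n]$. The Schur covering of $\mathcal G_n$ is $1\to\mathbb Z_\ell\to\tilde{\mathcal G}_n\xrightarrow{\pi_n}\mathcal G_n\to1$ with $\tilde{\mathcal G}_n=F/[R,F]$ and $\ker\pi_n=R/[R,F]$; $a_i$ also denotes its image in $\tilde{\mathcal G}_n$. The automorphism $\phi$ is chosen with respect to Haar measure on the profinite group of continuous automorphisms of $\tilde{\mathcal G}_n$ that preserve and act trivially on $\ker\pi_n$. $\mathrm{Sur}$ denotes continuous surjective homomorphisms. *)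

(* Defs.v *)
From HB Require Import structures.
From mathcomp Require Import all_boot all_order all_algebra all_fingroup pgroup.
From mathcomp Require Import all_classical all_reals all_analysis.

Set Implicit Arguments.
Unset Strict Implicit.
Unset Printing Implicit Defensive.

Import Order.TTheory GRing.Theory Num.Theory.

Local Open Scope classical_set_scope.
Local Open Scope group_scope.

#[short(type="preTopGroupType")]
HB.structure Definition PreTopGroup := {G of Topological G & monoid.Group G}.

HB.mixin Record PreTopGroup_isTopGroup G & PreTopGroup G := {
  mulg_continuous : continuous (fun x : G * G => x.1 * x.2) ;
  invg_continuous : continuous (fun x : G => x^-1)
}.

#[short(type="topGroupType")]
HB.structure Definition TopGroup :=
  {G of PreTopGroup G & PreTopGroup_isTopGroup G}.

Definition normal_subgroup (G : groupType) (N : set G) : Prop :=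
  [/\ N 1,
      forall x y, N x -> N y -> N (x * y),
      forall x, N x -> N x^-1 &
      forall x g, N x -> N (x ^ g)].

Definition closed_normal_closure (G : preTopGroupType) (S : set G) : set G :=
  \bigcap_(N in [set N | [/\ closed N, normal_subgroup N & S `<=` N]]) N.

Lemma closed_normal_closure_closed (G : preTopGroupType) (S : set G) :
  closed (closed_normal_closure S).
Proof. by apply: (@closed_bigI G) => N []. Qed.

Lemma closed_normal_closure_normal (G : preTopGroupType) (S : set G) :
  normal_subgroup (closed_normal_closure S).
Proof.
split=> [|x y Nx Ny|x Nx|x g Nx] N NP; have [_ [N1 NM NV NJ] _] := NP.
- exact: N1.
- exact: NM (Nx N NP) (Ny N NP).
- exact: NV (Nx N NP).
- exact: NJ (Nx N NP).
Qed.

Lemma sub_closed_normal_closure (G : preTopGroupType) (S : set G) :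
  S `<=` closed_normal_closure S.
Proof. by move=> x Sx N [_ _]; apply. Qed.

Section Quotient.
Variables (G : topGroupType) (S : set G).
Local Notation N := (closed_normal_closure S).

Definition coset_rel : rel G := fun x y => `[< N (x^-1 * y) >].

Let N1 : N 1. Proof. by case: (closed_normal_closure_normal S). Qed.
Let NM x y : N x -> N y -> N (x * y).
Proof. by case: (closed_normal_closure_normal S) => _ + _ _; exact. Qed.
Let NV x : N x -> N x^-1.
Proof. by case: (closed_normal_closure_normal S) => _ _ + _; exact. Qed.
Let NJ x g : N x -> N (x ^ g).
Proof. by case: (closed_normal_closure_normal S) => _ _ _; exact. Qed.

Lemma coset_rel_refl : reflexive coset_rel.
Proof. by move=> x; apply/asboolP; rewrite mulVg. Qed.

Lemma coset_rel_sym : symmetric coset_rel.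
Proof.
by move=> x y; apply/asboolP/asboolP => /NV; rewrite invgM invgK.
Qed.

Lemma coset_rel_trans : transitive coset_rel.
Proof.
move=> y x z /asboolP xy /asboolP yz; apply/asboolP.
by have := NM xy yz; rewrite mulgA mulgK.
Qed.

Canonical coset_equiv :=
  EquivRel coset_rel coset_rel_refl coset_rel_sym coset_rel_trans.

Local Open Scope quotient_scope.
Local Notation repr := generic_quotient.repr.

(* The quotient of G by the closed normal subgroup generated by S, with the
   quotient topology. *)
Definition tquotient : Type := quotient_topology {eq_quot coset_equiv}.

HB.instance Definition _ := Topological.on tquotient.
HB.instance Definition _ := Quotient.on tquotient.

Definition tquot (x : G) : tquotient := \pi_tquotient x.

Lemma tquotP x y : tquot x = tquot y <-> N (x^-1 * y).
Proof.
split=> [/(@eqmodP _ coset_equiv)/asboolP //|xy].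
by apply/(@eqmodP _ coset_equiv)/asboolP.
Qed.

Lemma tquotK (q : tquotient) : tquot (repr q) = q.
Proof. exact: reprK. Qed.

Let repr_tquot x : N (x^-1 * repr (tquot x)).
Proof. by apply/tquotP; rewrite tquotK. Qed.

Definition tquot_mul (p q : tquotient) := tquot (repr p * repr q).
Definition tquot_inv (p : tquotient) := tquot (repr p)^-1.
Definition tquot_one := tquot 1.

Lemma tquot_mulE x y : tquot_mul (tquot x) (tquot y) = tquot (x * y).
Proof.
apply/esym/tquotP.
have -> : (x * y)^-1 * (repr (tquot x) * repr (tquot y)) =
  (x^-1 * repr (tquot x)) ^ y * (y^-1 * repr (tquot y)).
  by rewrite conjgE invgM !mulgA mulgK.
by apply: NM; [apply: NJ|]; exact: repr_tquot.
Qed.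

Lemma tquot_invE x : tquot_inv (tquot x) = tquot x^-1.
Proof.
apply/esym/tquotP; rewrite invgK.
have -> : x * (repr (tquot x))^-1 = ((x^-1 * repr (tquot x)) ^ x^-1)^-1.
  by rewrite conjgE invgK !mulgA mulgV mul1g invgM invgK.
exact: NV (NJ _ (repr_tquot x)).
Qed.

Let mulA : associative tquot_mul.
Proof.
move=> p q r; rewrite -(tquotK p) -(tquotK q) -(tquotK r).
by rewrite !tquot_mulE mulgA.
Qed.
Let mul1 : left_id tquot_one tquot_mul.
Proof. by move=> p; rewrite -(tquotK p) tquot_mulE mul1g. Qed.
Let mulr1 : right_id tquot_one tquot_mul.
Proof. by move=> p; rewrite -(tquotK p) tquot_mulE mulg1. Qed.
Let mulV : left_inverse tquot_one tquot_inv tquot_mul.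
Proof. by move=> p; rewrite -(tquotK p) tquot_invE tquot_mulE mulVg. Qed.
Let mulrV : right_inverse tquot_one tquot_inv tquot_mul.
Proof. by move=> p; rewrite -(tquotK p) tquot_invE tquot_mulE mulgV. Qed.

HB.instance Definition _ :=
  isGroup.Build tquotient mulA mul1 mulr1 mulV mulrV.

Lemma tquotM x y : tquot (x * y) = tquot x * tquot y.
Proof. by rewrite -tquot_mulE. Qed.
Lemma tquotV x : tquot x^-1 = (tquot x)^-1.
Proof. by rewrite -tquot_invE. Qed.
Lemma tquot_eq1 x : tquot x = 1 <-> N x.
Proof.
rewrite -[1]/(tquot 1); split=> [/esym/tquotP|Nx]; first by rewrite invg1 mul1g.
by apply/esym/tquotP; rewrite invg1 mul1g.
Qed.

Lemma tquot_continuous : continuous tquot.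
Proof. exact: pi_continuous. Qed.

Lemma tquot_open (U : set G) : open U -> open (tquot @` U).
Proof.
move=> oU.
change (open (tquot @^-1` (tquot @` U))).
have -> : tquot @^-1` (tquot @` U) =
    \bigcup_(n in N) ((fun x : G => x * n^-1) @^-1` U).
  apply/seteqP; split=> x /=.
    move=> [u Uu /tquotP Nux]; exists (u^-1 * x) => //=.
    by rewrite invgM invgK mulgA mulgV mul1g.
  move=> [n Nn /= Uxn]; exists (x * n^-1) => //; apply/tquotP.
  by rewrite invgM invgK mulgVK.
apply: bigcup_open => n _; apply: open_comp; last exact: oU.
move=> x _.
apply: (@continuous_comp _ _ _ (fun x : G => (x, n^-1)) (fun x => x.1 * x.2)).
  by apply: cvg_pair => //=; exact: cvg_cst.
exact: mulg_continuous.
Qed.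

Let mul_cont : continuous (fun x : tquotient * tquotient => x.1 * x.2).
Proof.
move=> [p q] U /=; rewrite -(tquotK p) -(tquotK q) -tquotM => nU.
have /= := @mulg_continuous G (repr p, repr q) _ (tquot_continuous nU).
case=> -[A B] /= [+ +] AB.
rewrite (nbhsE (repr p)) (nbhsE (repr q)) /=.
move=> [A' [oA' A'p] A'A] [B' [oB' B'q] B'B].
suff : filter_prod (nbhs (tquot (repr p))) (nbhs (tquot (repr q)))
    [set z | U (z.1 * z.2)] by [].
exists (tquot @` A', tquot @` B') => /=.
  split; apply: open_nbhs_nbhs; split; try exact: tquot_open.
  - by exists (repr p).
  - by exists (repr q).
move=> [_ _] /= [[x A'x <-] [y B'y <-]] /=; rewrite -tquotM.
by apply: (AB (x, y)); split; [exact: A'A | exact: B'B].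
Qed.

Let inv_cont : continuous (fun x : tquotient => x^-1).
Proof.
apply/(quotient_continuous (fun x : tquotient => x^-1)) => x.
apply: (@cvg_trans _ ((tquot \o (fun x : G => x^-1)) @ x)).
  by apply: near_eq_cvg; near=> y; rewrite /= -tquotV.
rewrite /= -[\pi x]/(tquot x) -tquotV.
apply: continuous_comp; [exact: invg_continuous|exact: tquot_continuous].
Unshelve. all: by end_near. Qed.

HB.instance Definition _ := PreTopGroup_isTopGroup.Build tquotient
  mul_cont inv_cont.

End Quotient.

(* An inverse limit of finite l-groups: compact, Hausdorff, with a
   neighbourhood basis of 1 made of open normal subgroups of l-power index. *)
Definition pro_group (l : nat) (G : topGroupType) : Prop :=
  [/\ compact [set: G], hausdorff_space G &
      forall U : set G, nbhs 1 U -> exists N : set G,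
        [/\ open N, normal_subgroup N, N `<=` U &
            exists k : nat,
              ([set [set x * y | y in N] | x in [set: G]] #= `I_(l ^ k)%N)%card]].

Definition free_pro_group (l : nat) (I : finType) (F : topGroupType)
    (x : I -> F) : Prop :=
  pro_group l F /\
  forall (P : topGroupType) (y : I -> P), pro_group l P ->
    exists! f : F -> P,
      [/\ continuous f, {morph f : u v / u * v} & forall i, f (x i) = y i].

Section SchurCovering.
Variables (F : topGroupType) (n : nat) (a b : 'I_n -> F).

Definition generators (i : 'I_n + 'I_n) : F :=
  match i with inl j => a j | inr j => b j end.

(* [~ x, y] is x^-1 * y^-1 * x * y; the other convention for commutators is
   obtained by replacing each generator by its inverse, which changes none of
   the closed normal subgroups below up to this automorphism of F. *)
Definition surface_relation : F := \prod_(i < n) [~ a i, b i].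

Definition demuskin : Type := tquotient [set surface_relation].
HB.instance Definition _ := TopGroup.on demuskin.

Definition relations : set F := closed_normal_closure [set surface_relation].

(* The commutators [r, f] already generate a normal subgroup topologically, so
   this is F / [R, F] with [R, F] the closed commutator subgroup. *)
Definition schur_covering : Type :=
  tquotient [set [~ r, f] | r in relations & f in [set: F]].
HB.instance Definition _ := TopGroup.on schur_covering.

Definition schur_gen (i : 'I_n) : schur_covering := tquot _ (a i).

Definition schur_proj (x : schur_covering) : demuskin :=
  tquot _ (generic_quotient.repr x).

Definition schur_ker : set schur_covering := schur_proj @^-1` [set 1].

Lemma schur_projE (x : F) : schur_proj (tquot _ x) = tquot _ x.
Proof.
have [_ _ RV RJ] := closed_normal_closure_normal [set surface_relation].
have [_ RM _ _] := closed_normal_closure_normal [set surface_relation].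
apply/esym/tquotP.
have /tquotP : tquot [set [~ r, f] | r in relations & f in [set: F]] x =
  tquot _ (generic_quotient.repr (tquot _ x : schur_covering)).
  by rewrite tquotK.
apply; split; first exact: closed_normal_closure_closed.
  exact: closed_normal_closure_normal.
move=> _ [r Rr [f _ <-]]; rewrite commgEl.
by apply: RM; [exact: RV | exact: RJ].
Qed.

Lemma schur_kerE : schur_ker = (fun x => tquot _ x : schur_covering) @` relations.
Proof.
apply/seteqP; split=> [q|_ [x Rx <-]]; rewrite /schur_ker /=.
  rewrite -(tquotK q) schur_projE => /tquot_eq1 Rq.
  by exists (generic_quotient.repr q).
by rewrite schur_projE; apply/tquot_eq1.
Qed.

End SchurCovering.

Arguments schur_gen {F n} a b i.
Arguments schur_ker {F n} a b _.

Section KernelAutomorphisms.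
Variables (G : preTopGroupType) (K : set G).

(* For compact Hausdorff G the continuity of the inverse is automatic, and the
   compact-open topology is the usual topology of the profinite group Aut(G) when G
   is profinite. *)
Definition is_ker_aut : set {compact-open, G -> G} :=
  [set phi | [/\ {morph phi : x y / x * y},
                 continuous (phi : G -> G),
                 exists psi : G -> G,
                   [/\ continuous psi, cancel phi psi & cancel psi phi] &
                 forall x, K x -> phi x = x]].

Definition ker_aut : Type := set_type is_ker_aut.
HB.instance Definition _ := Topological.on ker_aut.

Definition ker_aut_fun (phi : ker_aut) : G -> G := set_val phi.
Coercion ker_aut_fun : ker_aut >-> Funclass.

Let autP (phi : ker_aut) : is_ker_aut phi.
Proof. exact: (set_mem (valP phi)). Qed.

Lemma ker_aut_ext (phi psi : ker_aut) : phi =1 psi -> phi = psi.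
Proof. by move=> e; apply/val_inj/funext. Qed.

Let mk (f : G -> G) (h : is_ker_aut f) : ker_aut := exist _ f (mem_set h).

Let one_subproof : is_ker_aut (id : G -> G).
Proof.
by split=> //; [move=> ?; exact: cvg_id | exists id; split=> // ?; exact: cvg_id].
Qed.
Definition ker_aut_one : ker_aut := mk one_subproof.

Let mul_subproof (phi psi : ker_aut) : is_ker_aut (phi \o psi).
Proof.
have [m1 c1 [i1 [ci1 k1 k1']] f1] := autP phi.
have [m2 c2 [i2 [ci2 k2 k2']] f2] := autP psi.
split.
- by move=> x y /=; rewrite [X in phi X]m2 [LHS]m1.
- by move=> x; apply: continuous_comp; [exact: c2 | exact: c1].
- exists (i2 \o i1); split; [|exact: can_comp|exact: can_comp].
  by move=> x; apply: continuous_comp; [exact: ci1 | exact: ci2].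
- by move=> x Kx /=; rewrite [X in phi X]f2// [LHS]f1.
Qed.
Definition ker_aut_mul (phi psi : ker_aut) : ker_aut := mk (mul_subproof phi psi).

Let inv_ex (phi : ker_aut) : {psi : G -> G | is_ker_aut psi /\
  cancel phi psi /\ cancel psi phi}.
Proof.
apply: cid; have [m c [i [ci k k']] f] := autP phi.
exists i; split=> //; split=> //.
- by move=> x y; apply: (can_inj k); rewrite [RHS]m !k'.
- by exists phi.
- by move=> x Kx; rewrite -{1}[x]f// [LHS]k.
Qed.
Definition ker_aut_inv (phi : ker_aut) : ker_aut :=
  mk (proj1 (svalP (inv_ex phi))).

Let mulA : associative ker_aut_mul.
Proof. by move=> ? ? ?; exact: ker_aut_ext. Qed.
Let mul1 : left_id ker_aut_one ker_aut_mul.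
Proof. by move=> ?; exact: ker_aut_ext. Qed.
Let mulr1 : right_id ker_aut_one ker_aut_mul.
Proof. by move=> ?; exact: ker_aut_ext. Qed.
Let mulV : left_inverse ker_aut_one ker_aut_inv ker_aut_mul.
Proof.
by move=> p; apply: ker_aut_ext => x; case: (svalP (inv_ex p)) => _ [k _]; exact: k.
Qed.
Let mulrV : right_inverse ker_aut_one ker_aut_inv ker_aut_mul.
Proof.
by move=> p; apply: ker_aut_ext => x; case: (svalP (inv_ex p)) => _ [_ k]; exact: k.
Qed.

HB.instance Definition _ := isGroup.Build ker_aut mulA mul1 mulr1 mulV mulrV.

End KernelAutomorphisms.

(* measurableType extends pointedType, hence the base point 1. *)
Definition pointed_group (G : preTopGroupType) : Type := G.
HB.instance Definition _ (G : preTopGroupType) := Choice.on (pointed_group G).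
HB.instance Definition _ (G : preTopGroupType) :=
  isPointed.Build (pointed_group G) (1 : G).

Definition borel (G : preTopGroupType) : Type :=
  g_sigma_algebraType (@open G : set (set (pointed_group G))).
HB.instance Definition _ (G : preTopGroupType) := Measurable.on (borel G).

(* On a compact group a left-invariant probability is also right-invariant. *)
Definition haar_probability (R : realType) (G : preTopGroupType)
    (mu : probability (borel G) R) : Prop :=
  forall (g : G) (A : set (borel G)), measurable A ->
    mu ((fun x : G => g * x) @^-1` A) = mu A.

Definition Sur (G : preTopGroupType) (H : finGroupType) : set (G -> H) :=
  [set f | [/\ {morph f : x y / x * y},
               continuous (f : G -> discrete_topology H) &
               range f = [set: H]]].
Arguments Sur : clear implicits.

Definition Zgroup (F : topGroupType) (n : nat) (a b : 'I_n -> F)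
    (phi : ker_aut (schur_ker a b)) : topGroupType :=
  tquotient (range (schur_gen a b) `|` range (phi \o schur_gen a b)).

Section SecondHomology.
Variable H : finGroupType.
Local Open Scope ring_scope.

(* The inhomogeneous bar complex with coefficients in the trivial module Z:
   in degree k it is free abelian on H^k, and
     d2 [g|h]   = [h] - [gh] + [g],
     d3 [g|h|k] = [h|k] - [gh|k] + [g|hk] - [g|h]. *)
Definition chain (T : finType) : zmodType := {ffun T -> int}.

Definition simplex (T : finType) (x : T) : chain T := [ffun y => (y == x)%:R].

Definition bar_d2 (c : chain (H * H)%type) : chain H :=
  \sum_(p : H * H) let: (g, h) := p in
    (simplex h - simplex (g * h)%g + simplex g) *~ c p.

Definition bar_d3 (c : chain (H * H * H)%type) : chain (H * H)%type :=
  \sum_(p : H * H * H) let: (g, h, k) := p in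
    (simplex (h, k) - simplex ((g * h)%g, k)
     + simplex (g, (h * k)%g) - simplex (g, h)) *~ c p.

(* H_2(H, Z) = ker d2 / im d3, as the set of cosets of im d3 in ker d2. *)
Definition H2 : set (set (chain (H * H)%type)) :=
  [set [set z + w | w in range bar_d3] | z in [set z | bar_d2 z = 0]].

End SecondHomology.

Arguments H2 : clear implicits.

(* Main.v *)
From HB Require Import structures.
From mathcomp Require Import all_boot all_order all_algebra all_fingroup.
From mathcomp Require Import pgroup commutator center nilpotent sylow maximal.

Set Implicit Arguments.
Unset Strict Implicit.
Unset Printing Implicit Defensive.

(** Fix H. A homomorphism from the free group F to H is the same as a tuple w of
n pairs in H, and it factors through the Schur covering exactly when it kills
the surface relation r = [a_1, b_1]...[a_n, b_n]; such a tuple is called closed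
below. The automorphisms phi of the covering act on closed tuples by
precomposition. A surjection from Z_n to H amounts to a handlebody tuple w,
that is, one which is trivial on the a_i and whose values on the b_i generate
H, such that phi carries w to another handlebody tuple ([counting_Sur]). For n
large all handlebody tuples lie in a single orbit O ([move_generating]).
Invariance of the Haar measure makes phi carry w to w' with probability 1/|O|
for any two points of O ([transporter_measure]), so the expected number of
surjections is g^2 / |O|, where g is the number of generating n-tuples of H
([expected_surjections]), and g is asymptotic to |H|^n.

It remains to compute |O|. Let E be the central extension of H by 2-chains
modulo boundaries and modulo |H|, with the tautological cocycle. Multiplication
by |H| is null-homotopic on the bar complex ([cone_homotopy]), so no homology is
lost in this finite quotient: the order of [E, E] is |[H, H]| |H_2(H, Z)|
([card_schur_der], [counting_H2]). The commutator of two elements of H has a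
well defined lift to [E, E], and a tuple is null when the product of its lifted
commutators is trivial. Nullity is invariant, because a null tuple lifts to a
homomorphism from the covering to E and phi fixes the class of r
([null_tuple_act]). Handlebody tuples are null, so O consists of null tuples.
Conversely O contains every null tuple whose values on the b_i generate H
([surface_move_handlebody]). Products of n random commutators equidistribute
in [E, E] ([walk_cvg]), and all but an exponentially small proportion of tuples
generate H, so |O| is asymptotic to |H|^(2n) / |[E, E]| and the limit is
|[E, E]| ([orbit_limit]).

The heart of the proof is [surface_move_handlebody]: for a null tuple w with
generating second components an automorphism of F that fixes r has to carry the
handlebody tuple (1, w_2) to w. It is enough to find generators of F with the
prescribed images in H and with the same surface word as the given ones
([free_pro_automorphism], [automorphism_descends]), and by compactness it is
enough to find them in each finite quotient of F ([profinite_solve]). In a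
finite l-group each a_i, trivial in H, is multiplied by an element x_i over the
prescribed image, taken in the group generated by the b_i. Nullity makes the
surface word of (x, b) trivial up to commutators with the kernel
([schur_universal]), and x can be improved until it is trivial up to commutators
of higher weight ([surface_kill]). What remains of the change of the surface word
is undone by successive corrections from the derived subgroup, which keep the
tuple generating since they lie in the Frattini subgroup ([surface_adjust],
[handlebody_lift]). *)

(** * Surface words in finite l-groups *)

Section SurfaceWord.
Local Open Scope group_scope.

Definition surface (G : groupType) n (a b : 'I_n -> G) : G :=
  \prod_(i < n) [~ a i, b i].

Definition tuple_gen (gT : finGroupType) n (a b : 'I_n -> gT) : {set gT} :=
  <<a @: 'I_n :|: b @: 'I_n>>.

Lemma morph_surface (gT hT : finGroupType) (D : {group gT})
    (f : {morphism D >-> hT}) n (a b : 'I_n -> gT) :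
    (forall i, a i \in D) -> (forall i, b i \in D) ->
  f (surface a b) = surface (f \o a) (f \o b).
Proof.
move=> aD bD; rewrite /surface morph_prod => [|i _]; last by rewrite groupR.
by apply: eq_bigr => i _; rewrite morphR.
Qed.

Lemma surface_group (gT : finGroupType) (D : {group gT}) n (a b : 'I_n -> gT) :
    (forall i, a i \in D) -> (forall i, b i \in D) ->
  surface a b \in D.
Proof. by move=> aD bD; apply: group_prod => i _; rewrite groupR. Qed.

Lemma prodgM_central (gT : finGroupType) (Q : {group gT}) (I : Type)
    (r : seq I) (x z : I -> gT) :
    (forall i, x i \in Q) -> (forall i, z i \in 'Z(Q)) ->
  \prod_(i <- r) (x i * z i) = \prod_(i <- r) x i * \prod_(i <- r) z i.
Proof.
move=> xQ zZ; elim: r => [|i r IH]; first by rewrite !big_nil mulg1.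
rewrite !big_cons IH !mulgA; congr (_ * _); rewrite -!mulgA; congr (_ * _).
have /centerP[_ /(_ (\prod_(j <- r) x j))] := zZ i.
by apply; apply: group_prod.
Qed.

Section Central.
Variables (gT : finGroupType) (Q D : {group gT}).
Hypotheses (nDQ : normal D Q) (DQZ : [~: D, Q] \subset 'Z(Q)).

Let DQ x : x \in D -> x \in Q.
Proof. exact: (subsetP (normal_sub nDQ)). Qed.

Let commZ u x : u \in D -> x \in Q -> [~ u, x] \in 'Z(Q).
Proof. by move=> uD xQ; apply: (subsetP DQZ); rewrite mem_commg. Qed.

Let conjZ z x : z \in 'Z(Q) -> x \in Q -> z ^ x = z.
Proof. by case/centerP=> _ zZ xQ; rewrite conjgE zZ // mulKg. Qed.

Lemma commMl_central u v x : u \in D -> v \in D -> x \in Q ->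
  [~ u * v, x] = [~ u, x] * [~ v, x].
Proof. by move=> uD vD xQ; rewrite commMgJ conjZ //; [exact: commZ | exact: DQ]. Qed.

Lemma commMr_central u x y : u \in D -> x \in Q -> y \in Q ->
  [~ u, x * y] = [~ u, x] * [~ u, y].
Proof.
move=> uD xQ yQ; rewrite commgMJ conjZ ?commZ //.
by have /centerP[_ ->] := commZ uD xQ => //; apply: groupR => //; exact: DQ.
Qed.

Lemma commVl_central u x : u \in D -> x \in Q -> [~ u^-1, x] = [~ u, x]^-1.
Proof.
move=> uD xQ; apply: (mulgI [~ u, x]).
rewrite mulgV -commMl_central ?groupV //.
by rewrite mulgV comm1g.
Qed.

(** Modulo commutators of weight three the pairing (u, x) |-> [u, x] is
bilinear, so generators of Q suffice on the right. *)
Lemma span_central (J : finType) (g : J -> gT) s :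
    Q :=: <<g @: J>> -> s \in [~: D, Q] ->
  exists2 u : J -> gT, forall j, u j \in D & s = \prod_j [~ u j, g j].
Proof.
move=> defQ sDQ.
have gQ j : g j \in Q by rewrite defQ mem_gen // imset_f.
pose P := [set \prod_j [~ (u : {ffun J -> gT}) j, g j] | u in ffun_on D].
have grP : group_set P.
  apply/group_setP; split=> [|_ _ /imsetP[u /ffun_onP uD ->] /imsetP[v /ffun_onP vD ->]].
    apply/imsetP; exists [ffun=> 1]; first by apply/ffun_onP=> j; rewrite ffunE.
    by rewrite big1 // => j _; rewrite ffunE comm1g.
  apply/imsetP; exists [ffun j => u j * v j].
    by apply/ffun_onP=> j; rewrite ffunE groupM.
  rewrite -(@prodgM_central _ Q) => [|j|j].
  - by apply: eq_bigr => j _; rewrite ffunE commMl_central.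
  - by apply: groupR => //; exact: DQ.
  - exact: commZ.
suff sub : [~: D, Q] \subset P.
  have /imsetP[u /ffun_onP uD ->] := subsetP sub s sDQ.
  by exists u.
rewrite -[P]/(gval (Group grP)) gen_subG.
apply/subsetP=> _ /imset2P[u x uD xQ ->].
have grC : group_set [set y in Q | [~ u, y] \in P].
  apply/group_setP; split=> [|y z]; first by rewrite inE group1 commg1 (group1 (Group grP)).
  rewrite !inE => /andP[yQ Py] /andP[zQ Pz].
  by rewrite groupM //= commMr_central // (@groupM _ (Group grP)).
suff: Q \subset Group grC by move/subsetP/(_ x xQ); rewrite inE => /andP[].
rewrite [in X in X \subset _]defQ gen_subG; apply/subsetP=> _ /imsetP[j _ ->].
rewrite inE gQ; apply/imsetP; exists [ffun k => if k == j then u else 1].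
  by apply/ffun_onP=> k; rewrite ffunE; case: ifP.
rewrite (big_only1 j) //= => [|k kj _]; first by rewrite ffunE eqxx.
by rewrite ffunE (negPf kj) comm1g.
Qed.

End Central.
End SurfaceWord.

Section Approximation.
Local Open Scope group_scope.

Lemma tuple_gen_sum (gT : finGroupType) n (a b : 'I_n -> gT) :
  tuple_gen a b =
  <<(fun j : 'I_n + 'I_n => match j with inl i => a i | inr i => b i end) @: predT>>.
Proof.
rewrite /tuple_gen; congr <<_>>; apply/setP=> x; rewrite inE.
apply/orP/imsetP=> [[] /imsetP[i _ ->]|[[i|i] _ ->]].
- by exists (inl i).
- by exists (inr i).
- by left; apply: imset_f.
- by right; apply: imset_f.
Qed.

Lemma mem_tuple_gen (gT : finGroupType) n (a b : 'I_n -> gT) i :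
  a i \in tuple_gen a b /\ b i \in tuple_gen a b.
Proof. by split; rewrite mem_gen // inE imset_f // orbT. Qed.

Lemma quotient_tuple_gen (gT : finGroupType) (K : {group gT}) n
    (a b : 'I_n -> gT) :
    (forall i, a i \in 'N(K)) -> (forall i, b i \in 'N(K)) ->
  tuple_gen a b / K = tuple_gen (coset K \o a) (coset K \o b).
Proof.
move=> aN bN.
have quo (c : 'I_n -> gT) : (forall i, c i \in 'N(K)) ->
    (c @: 'I_n) / K = (coset K \o c) @: 'I_n.
  move=> cN; apply/setP=> x; apply/morphimP/imsetP.
    by case=> _ _ /imsetP[i _ ->] ->; exists i.
  by case=> i _ ->; exists (c i) => //; apply: imset_f.
rewrite /tuple_gen quotient_gen; first by rewrite quotientU !quo.
by rewrite subUset; apply/andP; split; apply/subsetP=> _ /imsetP[i _ ->].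
Qed.

(** The three subgroup lemma: if [M, T, T] = 1 then M centralises T'. *)
Lemma centralises_der1 (gT : finGroupType) (T M : {group gT}) w t :
  [~: M, T] \subset 'Z(T) -> w \in M -> t \in T^`(1) -> commute w t.
Proof.
move=> MTZ wM tT'.
have c1 : [~: M, T, T] = 1.
  by apply/commG1P; rewrite (subset_trans MTZ) // subsetIr.
have : [~: T, T, M] = 1 by apply: three_subgroup; rewrite // (commGC T M).
by rewrite commGC => /commG1P/centsP/(_ w wM t tT').
Qed.

Section ApproxCentral.
Variables (gT : finGroupType) (Q D : {group gT}) (n : nat) (a b : 'I_n -> gT).
Hypotheses (nDQ : D <| Q) (DQZ : [~: D, Q] \subset 'Z(Q)).
Hypotheses (sDQ' : D \subset Q^`(1)) (defQ : Q :=: tuple_gen a b).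

(** D centralises Q' by the three subgroup lemma, hence centralises itself:
a handle [a, b] changes by a product of central commutators that is linear in
the two correction terms. *)
Lemma comm_shift_central x y u v :
    x \in Q -> y \in Q -> u \in D -> v \in D ->
  [~ x * u, y * v] = [~ x, y] * ([~ v, x]^-1 * [~ u, y]).
Proof.
move=> xQ yQ uD vD; have DQ := subsetP (normal_sub nDQ).
have cD w t : w \in D -> t \in Q^`(1) -> commute w t.
  exact: centralises_der1.
have cz w z : w \in D -> z \in Q -> [~ w, z] \in 'Z(Q).
  by move=> wD zQ; apply: (subsetP DQZ); rewrite mem_commg.
have zJ z t : z \in 'Z(Q) -> t \in Q -> z ^ t = z.
  by case/centerP=> _ zZ tQ; rewrite conjgE zZ // mulKg.
have uQ := DQ _ uD; have vQ := DQ _ vD.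
rewrite commgMJ !commMgJ.
have -> : [~ u, v] = 1 by apply/eqP/commgP; apply: cD => //; apply: (subsetP sDQ').
rewrite mulg1 -[[~ x, v]]invgK invg_comm zJ ?groupV ?cz //.
have -> : [~ x, y] ^ u = [~ x, y].
  by apply/conjg_fixP/commgP/commute_sym/cD => //; apply: mem_commg.
rewrite conjMg [[~ u, y] ^ v]zJ ?cz //.
have -> : [~ x, y] ^ v = [~ x, y].
  by apply/conjg_fixP/commgP/commute_sym/cD => //; apply: mem_commg.
have /centerP[_ zC] : [~ v, x]^-1 \in 'Z(Q) by rewrite groupV cz.
by rewrite [LHS]mulgA (zC [~ x, y]) ?groupR // -mulgA.
Qed.

(** By [span_central] the defect is a product of commutators with the
generators, and the two kinds of terms in [comm_shift_central] realise it. *)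
Lemma surface_adjust_central s : s \in [~: D, Q] ->
  exists u v : 'I_n -> gT, [/\ forall i, u i \in D, forall i, v i \in D &
    surface (fun i => a i * u i) (fun i => b i * v i) = surface a b * s].
Proof.
move=> sDQ; have DQ := subsetP (normal_sub nDQ).
have abQ i : a i \in Q /\ b i \in Q by rewrite defQ; apply: mem_tuple_gen.
have [u uD ->] := span_central nDQ DQZ (etrans defQ (tuple_gen_sum a b)) sDQ.
exists (fun i => u (inr i)), (fun i => (u (inl i))^-1); split=> [//|i|].
  by rewrite groupV.
have cz w z : w \in D -> z \in Q -> [~ w, z] \in 'Z(Q).
  by move=> wD zQ; apply: (subsetP DQZ); rewrite mem_commg.
have aQ i : a i \in Q by case: (abQ i).
have bQ i : b i \in Q by case: (abQ i).
rewrite big_sumType /= -(@prodgM_central _ Q) => [|i|i]; last 2 first.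
- by apply: groupR => //; apply: DQ.
- exact: cz.
rewrite /surface -(@prodgM_central _ Q) => [|i|i]; last 2 first.
- exact: groupR.
- by rewrite groupM ?cz.
apply: eq_bigr => i _; rewrite comm_shift_central ?groupV //.
by rewrite (commVl_central nDQ DQZ) // invgK.
Qed.

End ApproxCentral.

(** In a p-group the derived subgroup consists of non-generators. *)
Lemma tuple_gen_shift (gT : finGroupType) (Q : {group gT}) (l n : nat)
    (a b u v : 'I_n -> gT) :
    l.-group Q -> Q :=: tuple_gen a b ->
    (forall i, u i \in Q^`(1)) -> (forall i, v i \in Q^`(1)) ->
  Q :=: tuple_gen (fun i => a i * u i) (fun i => b i * v i).
Proof.
move=> pQ defQ uQ' vQ'; rewrite [in RHS]/tuple_gen; set X := _ :|: _.
have sQ'P : Q^`(1) \subset 'Phi(Q) by rewrite (Phi_joing pQ) joing_subl.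
have uP i : u i \in 'Phi(Q) by apply: (subsetP sQ'P).
have vP i : v i \in 'Phi(Q) by apply: (subsetP sQ'P).
have uQ i : u i \in Q by apply: (subsetP (Phi_sub Q)).
have vQ i : v i \in Q by apply: (subsetP (Phi_sub Q)).
have aQ i : a i \in Q by rewrite defQ; case: (mem_tuple_gen a b i).
have bQ i : b i \in Q by rewrite defQ; case: (mem_tuple_gen a b i).
symmetry; apply: Phi_nongen; apply/eqP; rewrite eqEsubset join_subG Phi_sub /=.
apply/andP; split.
  rewrite subUset; apply/andP; split; apply/subsetP=> _ /imsetP[i _ ->].
    by rewrite groupM.
  by rewrite groupM.
set Y := ('Phi(Q) <*> X)%G; suff: Q \subset Y by [].
rewrite [in W in W \subset _]defQ gen_subG subUset.
have PY : {subset 'Phi(Q) <= Y} by apply/subsetP; apply: joing_subl.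
have uY i : u i \in Y by apply: PY.
have vY i : v i \in Y by apply: PY.
have XY x : x \in X -> x \in Y by move=> Xx; rewrite mem_gen // inE Xx orbT.
apply/andP; split; apply/subsetP=> _ /imsetP[i _ ->].
  rewrite -(mulgK (u i) (a i)) groupM ?groupV //.
  by apply: XY; apply/setUP; left; apply/imsetP; exists i.
rewrite -(mulgK (v i) (b i)) groupM ?groupV //.
by apply: XY; apply/setUP; right; apply/imsetP; exists i.
Qed.

Lemma lift_coset_family (gT : finGroupType) (K D : {group gT}) (I : finType)
    (w' : I -> coset_of K) : (forall i, w' i \in D / K) ->
  exists2 w : I -> gT, forall i, w i \in D & forall i, w' i = coset K (w i).
Proof.
move=> w'D; have w_ i : exists w, (w \in D) && (w' i == coset K w).
  have /morphimP[w _ wD ->] := w'D i; exists w; apply/andP; split=> //.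
exists (fun i => xchoose (w_ i)) => i.
  by have /andP[] := xchooseP (w_ i).
by have /andP[_ /eqP] := xchooseP (w_ i).
Qed.

(** Newton iteration along D > [D, Q] > [[D, Q], Q] > ...: the equation is
linear modulo the next term, and corrections in Q' keep a generating tuple
generating. *)
Lemma surface_adjust (gT : finGroupType) (Q D : {group gT}) (l n : nat)
    (a b : 'I_n -> gT) s :
    l.-group Q -> D <| Q -> D \subset Q^`(1) -> Q :=: tuple_gen a b ->
    s \in [~: D, Q] ->
  exists u v : 'I_n -> gT, [/\ forall i, u i \in D, forall i, v i \in D &
    surface (fun i => a i * u i) (fun i => b i * v i) = surface a b * s].
Proof.
move=> pQ; have [m] := ubnP #|D|.
elim: m => // m IH in D a b s *; rewrite ltnS => leDm nDQ sDQ' defQ sDQ.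
have aQ i : a i \in Q by rewrite defQ; case: (mem_tuple_gen a b i).
have bQ i : b i \in Q by rewrite defQ; case: (mem_tuple_gen a b i).
have [/eqP D1|ntD] := eqVneq (gval D) 1.
  exists (fun=> 1), (fun=> 1); split=> //.
  have -> : s = 1 by apply/set1P; move: sDQ; rewrite (eqP D1) comm1G.
  by rewrite mulg1; apply: eq_bigr => i _; rewrite !mulg1.
have sDQs := normal_sub nDQ; have nDQn := normal_norm nDQ.
have sD1D : [~: D, Q] \subset D by rewrite commg_subl.
have nD1 : [~: D, Q] <| Q by rewrite /normal normsR // (subset_trans sD1D).
pose K := [~: [~: D, Q], Q]%G.
have nKQ : Q \subset 'N(K) by rewrite normsR // normal_norm.
have sKD1 : K \subset [~: D, Q] by rewrite commg_subl normal_norm.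
have nK := subsetP nKQ.
have [] := @surface_adjust_central _ (Q / K)%G (D / K)%G n
  (coset K \o a) (coset K \o b) _ _ _ _ (coset K s).
- exact: quotient_normal.
- rewrite /= -quotientR //; last exact: subset_trans nKQ.
  rewrite subsetI quotientS; last by rewrite (subset_trans sD1D).
  by rewrite quotient_cents2r.
- by rewrite derg1 -quotientR // quotientS.
- by rewrite -quotient_tuple_gen => [|i|i]; [rewrite -defQ | exact: nK | exact: nK].
- by rewrite /= -quotientR ?mem_quotient //; apply: subset_trans nKQ.
move=> u' [v' [u'D v'D Esurf]].
have [u uD uE] := lift_coset_family u'D; have [v vD vE] := lift_coset_family v'D.
have DQ := subsetP sDQs.
pose a1 i := a i * u i; pose b1 i := b i * v i.
have uQ i : u i \in Q by apply: DQ.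
have vQ i : v i \in Q by apply: DQ.
have a1Q i : a1 i \in Q by rewrite groupM.
have b1Q i : b1 i \in Q by rewrite groupM.
have sQ : s \in Q by apply: DQ; apply: (subsetP sD1D).
have sfQ : surface a b \in Q by apply: surface_group.
have sf1Q : surface a1 b1 \in Q by apply: surface_group.
pose k := (surface a1 b1)^-1 * (surface a b * s).
have kK : k \in K.
  rewrite coset_idr // ?nK ?groupM ?groupV //.
  rewrite !morphM ?morphV ?groupV ?groupM ?nK //=.
  rewrite !morph_surface => [|i|i|i|i]; try exact: nK.
  apply/eqP; rewrite -eq_mulVg1; apply/eqP; apply: (etrans _ Esurf).
  apply: eq_bigr => i _ /=.
  by rewrite !morphM ?nK //= -uE -vE.
have [] := IH [~: D, Q]%G a1 b1 k.
- apply: leq_trans leDm; apply: proper_card.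
  by apply: (nil_comm_properl (pgroup_nil pQ)) => //; rewrite subsetI subxx.
- exact: nD1.
- exact: subset_trans sD1D sDQ'.
- by apply: (tuple_gen_shift pQ) => // i; apply: (subsetP sDQ').
- exact: kK.
move=> u2 [v2 [u2D v2D E2]].
exists (fun i => u i * u2 i), (fun i => v i * v2 i).
split=> [i|i|]; try by rewrite groupM // (subsetP sD1D).
rewrite -[RHS](mulKVg (surface a1 b1)) -E2.
by apply: eq_bigr => i _; rewrite !mulgA.
Qed.

End Approximation.

Section HandlebodyLift.
Local Open Scope group_scope.

(** Elements of M commute with T', so that x_i |-> x_i u_i multiplies the
surface word by the product of the central commutators [u_i, y_i]. *)
Lemma surface_kill_central (gT : finGroupType) (T M : {group gT}) n
    (x y : 'I_n -> gT) :
    M <| T -> [~: M, T] \subset 'Z(T) -> T :=: <<y @: 'I_n>> ->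
    (forall i, x i \in T) -> surface x y \in [~: M, T] ->
  exists2 u : 'I_n -> gT, forall i, u i \in M &
    surface (fun i => x i * u i) y = 1.
Proof.
move=> nMT MTZ defT xT sMT; have MT := subsetP (normal_sub nMT).
have yT i : y i \in T by rewrite defT mem_gen // imset_f.
have sV : (surface x y)^-1 \in [~: M, T] by rewrite groupV.
have [u uM Eu] := span_central nMT MTZ defT sV.
exists u => //; rewrite -(mulgV (surface x y)) Eu.
have uT i : u i \in T by apply: MT.
rewrite /surface -(@prodgM_central _ T) => [|i|i]; last 2 first.
- exact: groupR.
- by apply: (subsetP MTZ); rewrite mem_commg.
apply: eq_bigr => i _; rewrite commMgJ; congr (_ * _).
apply/conjg_fixP/commgP/commute_sym/(centralises_der1 MTZ) => //.
exact: mem_commg.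
Qed.

Lemma surface_kill (gT : finGroupType) (T M : {group gT}) n
    (x y : 'I_n -> gT) :
    M <| T -> T :=: <<y @: 'I_n>> ->
    (forall i, x i \in T) -> surface x y \in [~: M, T] ->
  exists2 u : 'I_n -> gT, forall i, u i \in M &
    surface (fun i => x i * u i) y \in [~: M, T, T].
Proof.
move=> nMT defT xT sMT.
have sMTM : [~: M, T] \subset M by rewrite commg_subl normal_norm.
have nM1 : [~: M, T] <| T.
  by rewrite /normal normsR ?normal_norm // (subset_trans sMTM) ?normal_sub.
pose K := [~: [~: M, T], T]%G.
have nKT : T \subset 'N(K) by rewrite normsR // normal_norm.
have nK := subsetP nKT.
have sMN : M \subset 'N(K) by apply: subset_trans nKT; apply: normal_sub.
have yT i : y i \in T by rewrite defT mem_gen // imset_f.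
have [] := @surface_kill_central _ (T / K)%G (M / K)%G n
  (coset K \o x) (coset K \o y).
- exact: quotient_normal.
- rewrite /= -quotientR // subsetI quotient_cents2r // andbT.
  by rewrite quotientS // (subset_trans sMTM) ?normal_sub.
- suff E : <<y @: 'I_n>> / K = <<(coset K \o y) @: 'I_n>> by rewrite /= -E -defT.
  rewrite quotient_gen; last by apply/subsetP=> _ /imsetP[i _ ->]; apply: nK.
  congr <<_>>; apply/setP=> z; apply/morphimP/imsetP.
    by case=> _ _ /imsetP[i _ ->] ->; exists i.
  by case=> i _ ->; exists (y i); [apply: nK | apply: imset_f |].
- by move=> i; apply: mem_quotient.
- rewrite /= -quotientR // -morph_surface => [|i|i]; try exact: nK.
  by rewrite mem_quotient.
move=> u' u'M Esurf; have [u uM uE] := lift_coset_family u'M.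
exists u => //.
have uT i : u i \in T by apply: (subsetP (normal_sub nMT)).
have suT : surface (fun i => x i * u i) y \in T.
  by apply: surface_group => i //; rewrite groupM.
rewrite -[[~: M, T, T]]/(gval K) coset_idr ?nK //.
rewrite morph_surface => [|i|i]; try by rewrite nK ?groupM.
rewrite -[RHS]Esurf; apply: eq_bigr => i _ /=.
by rewrite morphM ?nK //= -uE.
Qed.

(** Let f : Q -> H kill the a_i and let T = <b_i>, so that Q = ker f . T and
L = [ker f, T] is normal. Multiplying a_i by x_i in T keeps a generating tuple
and, modulo [L, Q], multiplies the surface word by the word of (x, b). The
latter is killed inside T; the remaining error lies in [L, Q] with L inside Q',
and is removed by corrections from L, which f does not see. *)
Lemma handlebody_lift (gT hT : finGroupType) (Q : {group gT})
    (f : {morphism Q >-> hT}) (l n : nat) (a b x : 'I_n -> gT) :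
    let T := [group of <<b @: 'I_n>>] in
    l.-group Q -> Q :=: tuple_gen a b -> (forall i, f (a i) = 1) ->
    f @* T = f @* Q -> (forall i, x i \in T) ->
    surface x b \in [~: 'ker_T f, T] ->
  exists a' b' : 'I_n -> gT, [/\ Q :=: tuple_gen a' b',
    forall i, f (a' i) = f (x i), forall i, f (b' i) = f (b i) &
    surface a' b' = surface a b].
Proof.
move=> T pQ defQ fa fTQ xT sxb.
have aQ i : a i \in Q by rewrite defQ; case: (mem_tuple_gen a b i).
have bQ i : b i \in Q by rewrite defQ; case: (mem_tuple_gen a b i).
have bT i : b i \in T by rewrite mem_gen // imset_f.
have sTQ : T \subset Q by rewrite gen_subG; apply/subsetP=> _ /imsetP[i _ ->].
have TQ := subsetP sTQ.
have nMT : 'ker_T f <| T by rewrite -(ker_restrm sTQ) ker_normal.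
have [u uM suT] := surface_kill nMT (erefl (gval T)) xT sxb.
have uT i : u i \in T by have := uM i; rewrite inE => /andP[].
have uK i : u i \in 'ker f by have := uM i; rewrite inE => /andP[].
pose N := 'ker f; pose L := [~: N, T]%G.
have nNQ : N <| Q by apply: ker_normal.
have sNQ := normal_sub nNQ.
have defNT : N <*> T = Q.
  rewrite norm_joinEr; last by rewrite (subset_trans sTQ) ?normal_norm.
  apply/eqP; rewrite eqEsubset mul_subG //=.
  by rewrite -morphimSK // fTQ.
have nLQ : L <| Q.
  rewrite /normal comm_subG //= -[in X in X \subset _]defNT join_subG.
  by rewrite commg_norml commg_normr.
have sLN : L \subset N by rewrite commg_subl (subset_trans sTQ) ?normal_norm.
have sLQ' : L \subset Q^`(1) by rewrite commgSS.
pose K := [~: L, Q]%G.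
have nKQ : Q \subset 'N(K) by rewrite normsR // normal_norm.
have nK := subsetP nKQ.
pose x1 i := x i * u i; pose a1 i := a i * x1 i.
have x1T i : x1 i \in T by rewrite groupM.
have x1Q i : x1 i \in Q by apply: TQ.
have a1Q i : a1 i \in Q by rewrite groupM.
have defQ1 : Q :=: tuple_gen a1 b.
  have bG i : b i \in tuple_gen a1 b by case: (mem_tuple_gen a1 b i).
  have x1G i : x1 i \in tuple_gen a1 b.
    suff: T \subset tuple_gen a1 b by move/subsetP; apply.
    by rewrite gen_subG; apply/subsetP=> _ /imsetP[j _ ->].
  apply/eqP; rewrite eqEsubset; apply/andP; split.
    rewrite [in W in W \subset _]defQ gen_subG subUset.
    apply/andP; split; apply/subsetP=> _ /imsetP[i _ ->] //.
    rewrite -(mulgK (x1 i) (a i)) groupM ?groupV //.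
    by case: (mem_tuple_gen a1 b i).
  rewrite gen_subG subUset.
  by apply/andP; split; apply/subsetP=> _ /imsetP[i _ ->].
have sx1K : surface x1 b \in K.
  apply: subsetP suT; apply: commgSS => //.
  by apply: commSg; rewrite subsetIr.
have sabQ : surface a b \in Q by apply: surface_group.
have sa1bQ : surface a1 b \in Q by apply: surface_group.
have sx1bQ : surface x1 b \in Q by apply: surface_group.
have EK : coset K (surface a1 b) = coset K (surface a b).
  have -> : coset K (surface a b) = coset K (surface x1 b) * coset K (surface a b).
    by rewrite [coset K (surface x1 b)]coset_id // mul1g.
  have abL i : [~ a i, b i] \in L.
    by rewrite mem_commg //; apply/kerP => //; apply: fa.
  have LZ z : z \in L -> coset K z \in 'Z(Q / K).
    move=> zL; apply: subsetP (mem_quotient K zL).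
    by rewrite subsetI quotient_cents2r // quotientS ?normal_sub.
  rewrite !morph_surface => [|i|i|i|i|i|i]; try exact: nK.
  rewrite /surface -(@prodgM_central _ (Q / K)%G) => [|i|i]; last 2 first.
  - by rewrite /= -morphR ?nK // mem_quotient ?groupR.
  - by rewrite /= -morphR ?nK // LZ.
  apply: eq_bigr => i _ /=.
  rewrite -!morphR ?nK // commMgJ morphM ?morphJ ?nK ?groupJ ?groupR //.
  have /centerP[_ zC] := LZ _ (abL i).
  have xQ : coset K (x1 i) \in Q / K by apply: mem_quotient.
  rewrite conjgE zC // mulKg zC //.
  by apply: mem_quotient; rewrite groupR.
have [] := @surface_adjust _ Q L l n a1 b ((surface a1 b)^-1 * surface a b) pQ nLQ sLQ' defQ1.
  rewrite coset_idr ?nK ?groupM ?groupV // morphM ?morphV ?nK ?groupV //=.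
  by rewrite EK mulVg.
move=> v [w [vL wL E]].
have vN i : v i \in 'ker f by apply: (subsetP sLN).
have wN i : w i \in 'ker f by apply: (subsetP sLN).
have vQ i : v i \in Q by apply: (subsetP sNQ).
have wQ i : w i \in Q by apply: (subsetP sNQ).
exists (fun i => a1 i * v i), (fun i => b i * w i); split.
- by apply: (tuple_gen_shift pQ) => // i; apply: (subsetP sLQ').
- move=> i; have xQ := TQ _ (xT i); have uQ := TQ _ (uT i).
  rewrite morphM // (mker (vN i)) mulg1 /a1 morphM // fa mul1g /x1 morphM //.
  by rewrite (mker (uK i)) mulg1.
- by move=> i; rewrite morphM // (mker (wN i)) mulg1.
- by rewrite E mulKVg.
Qed.

End HandlebodyLift.

From mathcomp Require Import cyclic abelian lra zify finmap.
From mathcomp Require Import all_classical all_reals all_analysis.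
From mathcomp Require Import fintype finset.
Require Import Defs.

Import Order.TTheory GRing.Theory Num.Theory.

(** * The bar complex *)

Section LinearExtension.
Local Open Scope ring_scope.

Definition linext (T : finType) (A : zmodType) (f : T -> A) (c : chain T) : A :=
  \sum_t f t *~ c t.

Section Lin.
Variables (T : finType) (A : zmodType) (f : T -> A).

Lemma linext_is_zmod_morphism : zmod_morphism (linext f).
Proof.
move=> c d; rewrite /linext -sumrB; apply: eq_bigr => t _.
by rewrite !ffunE mulrzBr.
Qed.
HB.instance Definition _ :=
  GRing.isZmodMorphism.Build (chain T) A (linext f) linext_is_zmod_morphism.

Lemma linext_simplex x : linext f (simplex x) = f x.
Proof.
rewrite /linext (bigD1 x) //= big1 ?addr0 => [|y yx].
  by rewrite ffunE eqxx.
by rewrite ffunE (negPf yx).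
Qed.

End Lin.

Lemma chain_sum (T : finType) (c : chain T) : c = linext (@simplex T) c.
Proof.
apply/ffunP=> x; rewrite /linext sum_ffunE (bigD1 x) //= big1 ?addr0 => [|y yx].
  by rewrite ffunMzE ffunE eqxx intz.
by rewrite ffunMzE ffunE eq_sym (negPf yx) mul0rz.
Qed.

Lemma linext_comp (T : finType) (A B : zmodType) (h : {additive A -> B})
    (f : T -> A) c : h (linext f c) = linext (h \o f) c.
Proof. by rewrite raddf_sum; apply: eq_bigr => t _; rewrite raddfMz. Qed.

Lemma eq_linext (T : finType) (A : zmodType) (f g : T -> A) : f =1 g ->
  linext f =1 linext g.
Proof. by move=> fg c; apply: eq_bigr => t _; rewrite fg. Qed.

Lemma linext0 (T : finType) (A : zmodType) (c : chain T) :
  linext (fun=> 0 : A) c = 0.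
Proof. by rewrite /linext big1 // => t _; rewrite mul0rz. Qed.

Lemma linextMn (T : finType) (A : zmodType) (f : T -> A) n c :
  linext (fun t => f t *+ n) c = linext f c *+ n.
Proof.
rewrite /linext -sumrMnl; apply: eq_bigr => t _.
by rewrite !pmulrn mulrzAC.
Qed.

Lemma linextD (T : finType) (A : zmodType) (f g : T -> A) c :
  linext (fun t => f t + g t) c = linext f c + linext g c.
Proof.
by rewrite /linext -big_split; apply: eq_bigr => t _; rewrite mulrzDl.
Qed.

End LinearExtension.

Section BarComplex.
Variable H : finGroupType.
Local Open Scope ring_scope.
Implicit Types g h k : H.

Definition face2 (p : H * H) : chain H :=
  simplex p.2 - simplex (p.1 * p.2)%g + simplex p.1.

Definition face3 (p : H * H * H) : chain (H * H)%type :=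
  simplex (p.1.2, p.2) - simplex ((p.1.1 * p.1.2)%g, p.2)
  + simplex (p.1.1, (p.1.2 * p.2)%g) - simplex (p.1.1, p.1.2).

Lemma bar_d2E c : bar_d2 c = linext face2 c.
Proof. by apply: eq_bigr => -[g h] _. Qed.

Lemma bar_d3E c : bar_d3 c = linext face3 c.
Proof. by apply: eq_bigr => -[[g h] k] _. Qed.

Lemma bar_d2_simplex g h :
  bar_d2 (simplex (g, h)) = simplex h - simplex (g * h)%g + simplex g.
Proof. by rewrite bar_d2E linext_simplex. Qed.

Lemma bar_d3_simplex g h k : bar_d3 (simplex (g, h, k)) =
  simplex (h, k) - simplex ((g * h)%g, k) + simplex (g, (h * k)%g) - simplex (g, h).
Proof. by rewrite bar_d3E linext_simplex. Qed.

Lemma bar_d2_zmod_morphism : zmod_morphism (@bar_d2 H).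
Proof. by move=> c d; rewrite !bar_d2E raddfB. Qed.
HB.instance Definition _ := GRing.isZmodMorphism.Build (chain (H * H)%type)
  (chain H) (@bar_d2 H) bar_d2_zmod_morphism.

Lemma bar_d3_zmod_morphism : zmod_morphism (@bar_d3 H).
Proof. by move=> c d; rewrite !bar_d3E raddfB. Qed.
HB.instance Definition _ := GRing.isZmodMorphism.Build
  (chain (H * H * H)%type) (chain (H * H)%type) (@bar_d3 H) bar_d3_zmod_morphism.

Lemma bar_d23 (c : chain (H * H * H)%type) : bar_d2 (bar_d3 c) = 0.
Proof.
rewrite bar_d3E linext_comp -[RHS](linext0 _ c); apply: eq_linext => -[[g h] k] /=.
rewrite /face3 /= !(raddfB, raddfD) /= !bar_d2_simplex mulgA.
by apply/ffunP=> x; rewrite !ffunE; lra.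
Qed.

(** Prefixing a simplex with k is a contracting homotopy of the homogeneous bar
complex; the sums over k make it equivariant. *)
Definition cone1 : chain H -> chain (H * H)%type :=
  linext (fun g => \sum_k simplex (k, g)).
Definition cone2 : chain (H * H)%type -> chain (H * H * H)%type :=
  linext (fun p => \sum_k simplex (k, p.1, p.2)).

(** Summing the cone homotopies over all vertices k: multiplication by |H| is
null-homotopic in positive degrees. *)
Lemma cone_homotopy (c : chain (H * H)%type) : bar_d3 (cone2 c) + cone1 (bar_d2 c) = c *+ #|H|.
Proof.
rewrite bar_d2E /cone1 /cone2 [in X in X + _]linext_comp.
rewrite [in X in _ + X]linext_comp -linextD [in RHS](chain_sum c) -linextMn.
apply: eq_linext => -[g h] /=; rewrite raddf_sum /= /face2 /=.
rewrite raddfD raddfB /= !linext_simplex.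
under eq_bigr do rewrite bar_d3_simplex.
rewrite !sumrB big_split sumrB /= sumr_const.
have -> : \sum_k simplex ((k * g)%g, h) = \sum_k simplex (k, h) :> chain (H * H)%type.
  by rewrite [RHS](reindex_inj (mulIg g)).
by apply/ffunP=> x; rewrite !ffunE; lra.
Qed.
End BarComplex.

(** * Surface words in central extensions *)

Section AbelianZmodule.
Variables (gT : finGroupType) (A : {group gT}).
Local Open Scope ring_scope.

(** Written additively, an abelian subgroup can be the target of [linext]. *)
Definition zmod_of (abA : abelian A) : Type := subg_of A.

Variable abA : abelian A.
Local Notation Z := (zmod_of abA).

HB.instance Definition _ := Choice.on Z.

Let zadd (x y : Z) : Z := ((x : subg_of A) * (y : subg_of A))%g.
Let zopp (x : Z) : Z := ((x : subg_of A)^-1)%g.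
Let zaddA : associative zadd. Proof. by move=> x y z; apply: mulgA. Qed.
Let zaddC : commutative zadd.
Proof.
by move=> x y; apply: val_inj; apply: (centsP abA); apply: valP.
Qed.
Let zadd0 : left_id (1%g : subg_of A) zadd. Proof. by move=> x; apply: mul1g. Qed.
Let zaddN : left_inverse (1%g : subg_of A) zopp zadd.
Proof. by move=> x; apply: mulVg. Qed.
HB.instance Definition _ := GRing.isZmodule.Build Z zaddA zaddC zadd0 zaddN.

Definition zval (x : Z) : gT := sgval x.
Definition zsub (x : gT) : Z := subg A x.

Lemma zvalP x : zval x \in A. Proof. exact: subgP. Qed.
Lemma zval_inj : injective zval. Proof. exact: val_inj. Qed.
Lemma zsubK x : x \in A -> zval (zsub x) = x. Proof. exact: subgK. Qed.
Lemma zvalD x y : zval (x + y) = (zval x * zval y)%g. Proof. by []. Qed.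
Lemma zval0 : zval 0 = 1%g. Proof. by []. Qed.
Lemma zvalN x : zval (- x) = ((zval x)^-1)%g. Proof. by []. Qed.

End AbelianZmodule.
Arguments zval : simpl never.

Section FormalWords.
Variable H : finGroupType.
Local Open Scope group_scope.
Implicit Types g h k : H.

Local Notation C2 := (chain (H * H)%type).

(** A formal word (c, g) stands for t_g times the value of c, where t is a section
of a central extension of H and a 2-simplex (g, h) has the value
t_g t_h t_(gh)^-1. These are the group operations before any relation between
chains is imposed. *)
Definition fmul (u v : C2 * H) : C2 * H :=
  ((u.1 + v.1 + simplex (u.2, v.2))%R, u.2 * v.2).
Definition fone : C2 * H := ((- simplex (1%g : H, 1%g : H))%R, 1).
Definition finv (u : C2 * H) : C2 * H :=
  ((- u.1 - simplex ((u.2^-1)%g, u.2) - simplex (1%g : H, 1%g : H))%R, u.2^-1).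
Definition fcomm (u v : C2 * H) := fmul (finv u) (fmul (finv v) (fmul u v)).
Definition fsurf n (x y : 'I_n -> H) : C2 * H :=
  \big[fmul/fone]_(i < n) fcomm (0%R, x i) (0%R, y i).

(** The image of a formal word in the abelianisation of the free group on the
symbols t_g. *)
Definition fboundary (u : C2 * H) : chain H := (simplex u.2 + bar_d2 u.1)%R.

Lemma fboundaryM u v : fboundary (fmul u v) = (fboundary u + fboundary v)%R.
Proof.
rewrite /fboundary /= !raddfD /= bar_d2_simplex.
by apply/ffunP=> x; rewrite !ffunE; lra.
Qed.

Lemma fboundary1 : fboundary fone = 0%R.
Proof.
rewrite /fboundary /= raddfN /= bar_d2_simplex mulg1.
by apply/ffunP=> x; rewrite !ffunE; lra.
Qed.

Lemma fboundaryV u : fboundary (finv u) = (- fboundary u)%R.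
Proof.
rewrite /fboundary /= !(raddfB, raddfN) /= !bar_d2_simplex mulg1 mulVg.
by apply/ffunP=> x; rewrite !ffunE; lra.
Qed.

Lemma fboundary_comm u v : fboundary (fcomm u v) = 0%R.
Proof.
rewrite !fboundaryM !fboundaryV.
by apply/ffunP=> x; rewrite !ffunE; lra.
Qed.

Lemma fboundary_surf n (x y : 'I_n -> H) : fboundary (fsurf x y) = 0%R.
Proof.
apply: (big_ind (fun u => fboundary u = 0%R)); first exact: fboundary1.
  by move=> u v; rewrite fboundaryM => -> ->; rewrite addr0.
by move=> i _; apply: fboundary_comm.
Qed.

Lemma fmulVu u : fmul (finv u) u = fone.
Proof.
rewrite /fmul /finv /fone /= mulVg; congr pair.
by apply/ffunP=> x; rewrite !ffunE; lra.
Qed.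

Definition evaluation (gT : finGroupType) (ev : C2 * H -> gT) : Prop :=
  [/\ forall u v, ev (fmul u v) = ev u * ev v, ev fone = 1 &
      forall u, ev (finv u) = (ev u)^-1].

Lemma evaluation_comm (gT : finGroupType) (ev : C2 * H -> gT) u v :
  evaluation ev -> ev (fcomm u v) = [~ ev u, ev v].
Proof. by case=> evM _ evV; rewrite !evM !evV. Qed.

Lemma evaluation_surf (gT : finGroupType) (ev : C2 * H -> gT) n
    (x y : 'I_n -> H) : evaluation ev ->
  ev (fsurf x y) = surface (fun i => ev (0%R, x i)) (fun i => ev (0%R, y i)).
Proof.
move=> evP; have [evM ev1 _] := evP.
rewrite /fsurf (big_morph ev evM ev1).
by apply: eq_bigr => i _; apply: evaluation_comm.
Qed.

End FormalWords.

Lemma comm_central_mul (gT : finGroupType) (T : {group gT}) (k m s r : gT) :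
    (k \in 'Z(T) -> m \in 'Z(T) -> s \in T -> r \in T ->
  [~ k * s, m * r] = [~ s, r])%g.
Proof.
move=> /centerP[kT kC] /centerP[mT mC] sT rT.
have -> : ([~ k * s, m * r] = [~ s, m * r])%g.
  rewrite commMgJ; have /commgP/eqP-> := kC _ (groupM mT rT).
  by rewrite conj1g mul1g.
rewrite commgMJ; have /commute_sym/commgP/eqP-> := mC _ sT.
by rewrite conj1g mulg1.
Qed.

Section CentralExtension.
Local Open Scope group_scope.
Variables (gT H : finGroupType) (T : {group gT}) (pi : {morphism T >-> H}).
Hypotheses (piT : pi @* T = [set: H]) (kerZ : 'ker pi \subset 'Z(T)).
Implicit Types g h k : H.

Let abK : abelian ('ker pi).
Proof. exact: abelianS kerZ (center_abelian T). Qed.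

Let section_ex g : exists t, (t \in T) && (pi t == g).
Proof.
have: g \in pi @* T by rewrite piT inE.
by case/morphimP=> t _ tT ->; exists t; rewrite tT eqxx.
Qed.
Let t g := xchoose (section_ex g).
Let tT g : t g \in T. Proof. by case/andP: (xchooseP (section_ex g)). Qed.
Let pit g : pi (t g) = g. Proof. by case/andP: (xchooseP (section_ex g)) => _ /eqP. Qed.

Let kappa (p : H * H) : zmod_of abK :=
  zsub abK (t p.1 * t p.2 * (t (p.1 * p.2))^-1).
Let kappaE g h : zval (kappa (g, h)) * t (g * h) = t g * t h.
Proof.
rewrite /kappa zsubK ?mulgKV //=; apply/kerP; first by rewrite !groupM ?groupV.
by rewrite !morphM ?morphV ?groupM ?groupV // !pit mulgV.
Qed.

Let zC (z : zmod_of abK) x : x \in T -> x * zval z = zval z * x.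
Proof.
move=> xT; have /(subsetP kerZ)/centerP[_ zC] := zvalP z.
by rewrite zC.
Qed.

Let gamma := linext kappa.

Let gamma_d3 (w : chain (H * H * H)%type) : gamma (bar_d3 w) = 0%R.
Proof.
rewrite bar_d3E /gamma linext_comp -[RHS](linext0 _ w); apply: eq_linext => -[[g h] k] /=.
rewrite /face3 /= !(raddfB, raddfD) /= !linext_simplex.
apply/eqP; rewrite subr_eq0 addrAC subr_eq; apply/eqP/zval_inj.
rewrite !zvalD; apply: (mulIg (t (g * h * k))).
rewrite -[RHS]mulgA kappaE [RHS]mulgA kappaE -[RHS]mulgA -kappaE.
have -> : g * h * k = g * (h * k) by rewrite mulgA.
rewrite -[LHS]mulgA (kappaE g (h * k)).
by rewrite [LHS]mulgA -(zC _ (tT g)) -[LHS]mulgA.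
Qed.

Let ev (u : chain (H * H)%type * H) : gT := zval (gamma u.1) * t u.2.

Let evP : evaluation ev.
Proof.
have evM u v : ev (fmul u v) = ev u * ev v.
  rewrite /ev /gamma /= raddfD raddfD /= linext_simplex !zvalD -!mulgA kappaE.
  by congr (_ * _); rewrite [LHS]mulgA -(zC _ (tT u.2)) -[LHS]mulgA.
have ev1 : ev (fone H) = 1.
  rewrite /ev /gamma /= raddfN /= linext_simplex zvalN.
  have E := kappaE 1 1; rewrite mulg1 in E.
  by rewrite (mulIg _ _ _ E) mulVg.
split=> // u; apply: (mulIg (ev u)).
by rewrite -evM fmulVu ev1 mulVg.
Qed.

(** By the cocycle identity boundaries evaluate to 1 in the kernel, and changing
the lifts x' and y' by central elements does not affect commutators. *)
Lemma surface_trivial n (x y : 'I_n -> H) (x' y' : 'I_n -> gT) w :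
    fsurf x y = ((bar_d3 w - simplex (1%g : H, 1%g : H))%R, 1) ->
    (forall i, x' i \in T) -> (forall i, y' i \in T) ->
    (forall i, pi (x' i) = x i) -> (forall i, pi (y' i) = y i) ->
  surface x' y' = 1.
Proof.
move=> E x'T y'T pix piy; have [_ ev1 _] := evP.
have lift s z : s \in T -> pi s = z -> exists2 k, k \in 'ker pi & s = k * ev (0%R, z).
  move=> sT piz; exists (s * (t z)^-1); last by rewrite /ev /gamma /= raddf0 zval0 mul1g mulgKV.
  apply/kerP; first by rewrite groupM ?groupV.
  by rewrite morphM ?morphV ?groupV // pit piz mulgV.
have -> : surface x' y' = surface (fun i => ev (0%R, x i)) (fun i => ev (0%R, y i)).
  apply: eq_bigr => i _.
  have [k kK ->] := lift _ _ (x'T i) (pix i).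
  have [m mK ->] := lift _ _ (y'T i) (piy i).
  have evT z : ev (0%R, z) \in T.
    by rewrite /ev /gamma /= raddf0 zval0 mul1g.
  by apply: comm_central_mul => //; apply: (subsetP kerZ).
rewrite -(evaluation_surf _ _ evP) E.
have -> : ev ((bar_d3 w - simplex (1%g : H, 1%g : H))%R, 1) = ev (fone H).
  by rewrite /ev /= [gamma _]raddfB /= [X in (X - _)%R]gamma_d3 sub0r -raddfN.
exact: ev1.
Qed.

End CentralExtension.

(** * A finite Schur cover *)

Section SchurCover.
Variable H : finGroupType.
Local Open Scope ring_scope.
Implicit Types g h k : H.

Local Notation C2 := (chain (H * H)%type).
Local Notation bar11 := (simplex (1%g : H, 1%g : H)).

(** Boundaries together with multiples of |H|: a subgroup of finite index in
the 2-chains that meets the cycles in the boundaries only. *)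
Definition near_boundary : {pred C2} :=
  fun c => `[< exists w v, c = bar_d3 w + v *+ #|H| >].

Lemma near_boundaryP c :
  reflect (exists w v, c = bar_d3 w + v *+ #|H|) (c \in near_boundary).
Proof. exact: asboolP. Qed.

Lemma near_boundary_zmod_closed : zmod_closed near_boundary.
Proof.
split=> [|_ _ /near_boundaryP[w [v ->]] /near_boundaryP[w' [v' ->]]].
  by apply/near_boundaryP; exists 0, 0; rewrite raddf0 mul0rn addr0.
apply/near_boundaryP; exists (w - w'), (v - v').
by rewrite raddfB mulrnBl opprD addrACA.
Qed.
HB.instance Definition _ :=
  GRing.isZmodClosed.Build C2 near_boundary near_boundary_zmod_closed.

(** The 2-chains modulo near boundaries: a finite group into which H_2(H, Z)
embeds. *)
Definition schur_base : Type := Quotient.quot near_boundary.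
HB.instance Definition _ := GRing.Zmodule.on schur_base.

Definition schur_class (c : C2) : schur_base :=
  \pi_(Quotient.quot near_boundary)%qT c.

Lemma schur_class_zmod_morphism : zmod_morphism schur_class.
Proof. by move=> c d; rewrite /schur_class !piE. Qed.
HB.instance Definition _ := GRing.isZmodMorphism.Build C2 schur_base
  schur_class schur_class_zmod_morphism.

Lemma schur_class_eq0 c : (schur_class c == 0) = (c \in near_boundary).
Proof.
rewrite -[X in X \in _]subr0 Quotient.idealrBE -(raddf0 schur_class).
by [].
Qed.

Lemma schur_class_surj (b : schur_base) : exists c, schur_class c = b.
Proof. by exists (generic_quotient.repr b); apply: reprK. Qed.

(* Coefficients modulo |H| form a finite set that parametrises the classes. *)
Let schur_res (b : schur_base) : {ffun H * H -> 'I_#|H|.-1.+1} :=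
  [ffun p => inord `|((generic_quotient.repr b : C2) p %% #|H|)%Z|%N].
Let schur_unres (f : {ffun H * H -> 'I_#|H|.-1.+1}) : schur_base :=
  schur_class [ffun p => (f p : nat)%:Z].

Let schur_resK : cancel schur_res schur_unres.
Proof.
move=> b; rewrite -[RHS]reprK; set c := generic_quotient.repr b.
apply/eqP; rewrite -subr_eq0 -[X in _ - X]/(schur_class c) -raddfB schur_class_eq0.
apply/near_boundaryP; exists 0, [ffun p => - (c p %/ #|H|)%Z].
rewrite raddf0 add0r; apply/ffunP=> p; rewrite !ffunE ffunMnE !ffunE.
have Hgt0 : (0 < #|H|)%N by apply/card_gt0P; exists 1%g.
have H0 : (#|H|%:Z != 0) by rewrite -lt0n.
rewrite inordK; last first.
  by rewrite prednK // -ltz_nat gez0_abs ?modz_ge0 // ltz_pmod.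
rewrite gez0_abs ?modz_ge0 // {2}(divz_eq (c p) #|H|).
by rewrite opprD addrC addrNK mulNrn -mulr_natr natz.
Qed.

HB.instance Definition _ : isCountable schur_base := CanIsCountable schur_resK.
HB.instance Definition _ : isFinite schur_base := CanIsFinite schur_resK.

Lemma schur_base_exp (b : schur_base) : b *+ #|H| = 0.
Proof.
have [c <-] := schur_class_surj b.
apply/eqP; rewrite -raddfMn schur_class_eq0; apply/near_boundaryP.
by exists 0, c; rewrite raddf0 add0r.
Qed.

(** If a cycle is bar_d3 w + |H| v then v is a cycle too, and |H| v is a boundary
by [cone_homotopy]. *)
Lemma schur_class_cycle c :
  bar_d2 c = 0 -> schur_class c = 0 -> exists w, c = bar_d3 w.
Proof.
move=> dc /eqP; rewrite schur_class_eq0 => /near_boundaryP[w [v Ec]].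
have dv : bar_d2 v = 0.
  have : bar_d2 v *+ #|H| = 0.
    by rewrite -raddfMn -[RHS]dc Ec raddfD /= bar_d23 add0r.
  move=> /ffunP dv0; apply/ffunP=> g; have := dv0 g.
  rewrite ffunMnE ffunE => /eqP; rewrite mulrn_eq0 => /orP[|/eqP//].
  by rewrite -leqn0 leqNgt; case/negP; apply/card_gt0P; exists 1%g.
exists (w + cone2 v); rewrite raddfD Ec; congr (_ + _).
by have := cone_homotopy v; rewrite dv /cone1 raddf0 addr0.
Qed.

Lemma schur_class_d3 w : schur_class (bar_d3 w) = 0.
Proof.
apply/eqP; rewrite schur_class_eq0; apply/near_boundaryP.
by exists w, 0; rewrite mul0rn addr0.
Qed.

Lemma schur_cocycle g h k :
  schur_class (simplex (g, h)) + schur_class (simplex ((g * h)%g, k)) =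
  schur_class (simplex (h, k)) + schur_class (simplex (g, (h * k)%g)).
Proof.
have := schur_class_d3 (simplex (g, h, k)).
rewrite bar_d3_simplex !(raddfB, raddfD) /= => /eqP.
by rewrite subr_eq0 addrAC subr_eq => /eqP ->.
Qed.

(** The central extension of H by [schur_base H] with the tautological cocycle
(g, h) |-> class of the simplex (g, h), which is a cocycle because boundaries
are killed. *)
Definition schur_cover : Type := (schur_base * H)%type.
HB.instance Definition _ := Finite.on schur_cover.

Let smul (u v : schur_cover) : schur_cover :=
  (u.1 + v.1 + schur_class (simplex (u.2, v.2)), (u.2 * v.2)%g).
Let sone : schur_cover := (- schur_class bar11, 1%g).
Let sinv (u : schur_cover) : schur_cover :=
  (- u.1 - schur_class (simplex ((u.2^-1)%g, u.2)) - schur_class bar11, (u.2^-1)%g).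

Let smulA : associative smul.
Proof.
move=> [b g] [c h] [d k]; rewrite /smul /= mulgA; congr pair.
rewrite -!addrA; congr (_ + (_ + _)); rewrite [RHS]addrCA.
by rewrite schur_cocycle.
Qed.

Let smul1 : left_id sone smul.
Proof.
move=> [b g]; rewrite /smul /= mul1g; congr pair.
have := schur_cocycle 1 1 g; rewrite !mul1g => /addIr ->.
by rewrite addrAC addNr add0r.
Qed.

Let smulV : left_inverse sone sinv smul.
Proof.
move=> [b g]; rewrite /smul /sinv /sone /= mulVg; congr pair.
by rewrite [X in X + _ = _]addrAC [X in X + b]addrC addrNK addrAC addNr add0r.
Qed.
HB.instance Definition _ := Finite_isGroup.Build schur_cover smulA smul1 smulV.

Definition schur_eval (u : C2 * H) : schur_cover := (schur_class u.1, u.2).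

Lemma schur_evalP : evaluation schur_eval.
Proof.
split=> [u v||u].
- by rewrite /schur_eval /= !raddfD.
- by rewrite /schur_eval /= raddfN.
- by rewrite /schur_eval /= !raddfB raddfN.
Qed.

End SchurCover.

Section SchurCoverDerived.
Variable H : finGroupType.
Local Open Scope group_scope.
Implicit Types g h k : H.

Local Notation C2 := (chain (H * H)%type).
Local Notation E := (schur_cover H).
Local Notation bar11 := (simplex (1%g : H, 1%g : H)).

Lemma schur_proj_morphM : {in [set: E] &, {morph (snd : E -> H) : x y / x * y}}.
Proof. by move=> x y _ _. Qed.
Definition schur_proj : {morphism [set: E] >-> H} := Morphism schur_proj_morphM.

Lemma schur_projT : schur_proj @* [set: E] = [set: H].
Proof.
apply/setP=> g; rewrite inE; apply/morphimP.
by exists ((0%R, g) : E); rewrite ?inE.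
Qed.

Lemma schur_proj_ker (e : E) : (e \in 'ker schur_proj) = (e.2 == 1).
Proof. by rewrite !inE. Qed.

Lemma schur_class1l h : schur_class (simplex (1%g : H, h)) = schur_class bar11.
Proof. by have /= := schur_cocycle 1 1 h; rewrite !mul1g => /addIr. Qed.

Lemma schur_class1r h : schur_class (simplex (h, 1%g : H)) = schur_class bar11.
Proof. by have /= := schur_cocycle h 1 1; rewrite !mulg1 => /addIr. Qed.

Lemma schur_proj_central : 'ker schur_proj \subset 'Z([set: E]).
Proof.
apply/subsetP=> -[b g]; rewrite schur_proj_ker /= => /eqP->.
apply/centerP; split; rewrite ?inE // => -[c h] _.
rewrite /commute; congr pair; last by rewrite mulg1 mul1g.
by rewrite /= schur_class1l schur_class1r [X in (X + _)%R]addrC.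
Qed.

Lemma schur_expgn (b : schur_base H) m :
  (((b - schur_class bar11)%R, 1) : E) ^+ m = ((b *+ m - schur_class bar11)%R, 1).
Proof.
elim: m => [|m IH]; first by rewrite mulr0n sub0r.
rewrite expgS IH; congr pair; last by rewrite mul1g.
by rewrite /= mulrS [X in (X + _)%R]addrA subrK addrAC.
Qed.

Lemma schur_cover_pgroup (l : nat) : l.-group [set: H] -> l.-group [set: E].
Proof.
move=> pH; rewrite -pnat_exponent.
apply: (@pnat_dvd _ (#|H| * #|H|)%N); last first.
  by rewrite pnatM -cardsT [_.-nat _]pH.
apply/exponentP=> -[b g] _; rewrite expgM.
have /eqP : (((b, g) : E) ^+ #|H|).2 == 1.
  have -> : (((b, g) : E) ^+ #|H|).2 = g ^+ #|H|.
    by elim: #|H| => // m IH; rewrite !expgS -IH.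
  by rewrite -cardsT -order_dvdn order_dvdG ?inE.
case: (_ ^+ _) => c h /= ->.
by rewrite -[c](addrK (schur_class bar11)) schur_expgn schur_base_exp sub0r.
Qed.

Lemma schur_eval_surj (e : E) : exists u, schur_eval u = e.
Proof.
case: e => b g; have [c <-] := schur_class_surj b.
by exists (c, g).
Qed.

Let Eder := [~: [set: E], [set: E]]%G.
Let abA : abelian ([set: E] / Eder)%G.
Proof. by have := der_abelian 0 [set: E]; rewrite derg0 derg1. Qed.
Local Notation A := (zmod_of abA).

Let ET (e : E) : e \in 'N(Eder).
Proof. by rewrite (subsetP (der_norm 1 [set: E])) ?inE. Qed.

Let coz (e : E) : A := zsub abA (coset Eder e).
Let cozE e : zval (coz e) = coset Eder e.
Proof. by rewrite /coz zsubK // mem_quotient ?inE. Qed.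
Let cozM e f : coz (e * f) = (coz e + coz f)%R.
Proof. by apply: zval_inj; rewrite zvalD !cozE morphM. Qed.

Let theta (g : H) : A := coz (schur_eval (0%R, g)).
Let delta (c : C2) : A := coz (schur_eval ((c - bar11)%R, 1)).

Let deltaE c g : coz (schur_eval (c, g)) = (delta c + theta g)%R.
Proof.
rewrite -cozM; congr coz; congr pair; last by rewrite mul1g.
by rewrite /= raddf0 addr0 raddfB /= schur_class1l subrK.
Qed.

Let delta_zmod_morphism : zmod_morphism delta.
Proof.
move=> c d; apply/eqP; rewrite eq_sym subr_eq -cozM; apply/eqP; congr coz.
congr pair; last by rewrite mul1g.
by rewrite /= !raddfB /= [X in _ = (X + _)%R]addrA subrK [RHS]addrAC subrK.
Qed.
HB.instance Definition _ :=
  GRing.isZmodMorphism.Build C2 A delta delta_zmod_morphism.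

Let delta_simplex g h :
  delta (simplex (g, h)) = (theta h - theta (g * h) + theta g)%R.
Proof.
apply/eqP; rewrite addrAC eq_sym subr_eq -deltaE addrC -cozM; apply/eqP.
by congr coz; congr pair; rewrite /= raddf0 !add0r.
Qed.

Let deltaE2 c : delta c = linext theta (bar_d2 c).
Proof.
rewrite bar_d2E linext_comp [in LHS](chain_sum c) linext_comp.
apply: eq_linext => -[g h] /=; rewrite delta_simplex /face2 /=.
by rewrite raddfD raddfB /= !linext_simplex.
Qed.

Let coset_eval u : coset Eder (schur_eval u) = zval (linext theta (fboundary u)).
Proof.
case: u => c g; rewrite -cozE deltaE deltaE2 /fboundary /=; congr zval.
by rewrite raddfD /= linext_simplex addrC.
Qed.

(** In the abelianisation of the cover the simplex (g, h) has the value
theta h - theta (g h) + theta g, so that the value of a formal word there depends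
on its boundary only; and commutators of formal words have no boundary. *)
Lemma schur_derP (e : E) : reflect (exists2 u, fboundary u = 0%R & schur_eval u = e)
  (e \in [~: [set: E], [set: E]]).
Proof.
have [evM ev1 evV] := schur_evalP H.
apply: (iffP idP) => [|[u du <-]]; last first.
  by rewrite -[[~: _, _]]/(gval Eder) coset_idr ?ET // coset_eval du raddf0 zval0.
pose X := [set x : E | `[< exists2 u, fboundary u = 0%R & schur_eval u = x >]].
have XP x : reflect (exists2 u, fboundary u = 0%R & schur_eval u = x) (x \in X).
  by rewrite inE; apply: asboolP.
have grX : group_set X.
  apply/group_setP; split=> [|x y /XP[u du <-] /XP[v dv <-]]; apply/XP.
    by exists (fone H); [apply: fboundary1 | apply: ev1].
  by exists (fmul u v); [rewrite fboundaryM du dv addr0 | apply: evM].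
move=> eder; apply/XP; apply: subsetP eder.
rewrite -[X]/(gval (Group grX)) gen_subG; apply/subsetP=> _ /imset2P[x y _ _ ->].
have [u <-] := schur_eval_surj x; have [v <-] := schur_eval_surj y.
apply/XP; exists (fcomm u v); first exact: fboundary_comm.
exact: evaluation_comm (schur_evalP H).
Qed.

End SchurCoverDerived.

(** * The order of the second homology *)

Lemma counting_image (R : realType) (T : finType) (U : choiceType)
    (A : {set T}) (f : T -> U) : {in A &, injective f} ->
  counting (classical_sets.image [set` A]%classic f) = (#|A|%:R%R : R)%:E.
Proof.
move=> f_inj; pose X := [fset x in map f (enum A)]%fset.
have -> : classical_sets.image [set` A]%classic f = [set` X]%classic.
  apply/seteqP; split=> [_ [x Ax <-]|y] /=; rewrite in_fset.
    by apply: map_f; rewrite mem_enum.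
  by case/mapP=> x; rewrite mem_enum => Ax ->; exists x.
rewrite /counting ifT; last by apply/asboolP; exact: finite_fset.
rewrite set_fsetK card_fseq undup_id ?size_map -?cardE //.
by rewrite map_inj_in_uniq ?enum_uniq // => x y; rewrite !mem_enum; apply: f_inj.
Qed.

Section SecondHomologyOrder.
Variable H : finGroupType.
Local Open Scope group_scope.

Local Notation C2 := (chain (H * H)%type).
Local Notation E := (schur_cover H).
Local Notation bar11 := (simplex (1%g : H, 1%g : H)).

(** The copy of H_2(H, Z) inside [schur_base H]. *)
Definition schur_cycles : {set schur_base H} :=
  [set b | `[< exists2 z : C2, bar_d2 z = 0%R & schur_class z = b >]].

Lemma schur_cyclesP b :
  reflect (exists2 z : C2, bar_d2 z = 0%R & schur_class z = b) (b \in schur_cycles).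
Proof. by rewrite inE; apply: asboolP. Qed.

(** The derived subgroup of the cover maps onto that of H, and by [schur_derP] the
kernel consists of the classes of cycles. *)
Lemma card_schur_der : #|[~: [set: E], [set: E]]| =
  (#|[~: [set: H], [set: H]]| * #|schur_cycles|)%N.
Proof.
rewrite -(LagrangeI [~: [set: E], [set: E]]%G ('ker (schur_proj H))%G) mulnC.
congr (_ * _)%N.
  have := card_morphim (schur_proj H) [~: [set: E], [set: E]]%G.
  by rewrite setTI /= morphimR ?subsetT // schur_projT.
pose f (b : schur_base H) : E := ((b - schur_class bar11)%R, 1).
have f_inj : injective f by move=> b c [] /addIr.
rewrite -(card_imset _ f_inj); congr #|pred_of_set _|; apply/setP=> e.
rewrite inE schur_proj_ker; apply/andP/imsetP.
  case: e => b g [/schur_derP[[c h] dc ec]] /= /eqP g1.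
  have [bE hE] : schur_class c = b /\ h = g by case: ec.
  subst b h g.
  exists (schur_class (c + bar11)).
    apply/schur_cyclesP; exists (c + bar11)%R => //.
    rewrite raddfD /= bar_d2_simplex mulg1 subrr add0r.
    by move: dc; rewrite /fboundary /= addrC.
  by rewrite /f raddfD /= addrK.
move=> [_ /schur_cyclesP[z dz <-] ->]; split=> //.
apply/schur_derP; exists ((z - bar11)%R, 1).
  rewrite /fboundary /= raddfB /= bar_d2_simplex mulg1 subrr add0r dz.
  by rewrite sub0r subrr.
by rewrite /schur_eval /f /= raddfB.
Qed.

Lemma counting_H2 (R : realType) :
  counting (H2 H) = (#|schur_cycles|%:R : R)%:E.
Proof.
pose F (b : schur_base H) : set C2 := fun z => bar_d2 z = 0%R /\ schur_class z = b.
have FE (z : C2) : bar_d2 z = 0%R ->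
    F (schur_class z) = classical_sets.image (range (@bar_d3 H)) (fun w => (z + w)%R).
  move=> dz; apply/seteqP; split=> [c [dc Ec]|_ [_ [w _ <-] <-]].
    have [||w Ew] := @schur_class_cycle _ (c - z)%R.
    - by rewrite raddfB /= dz dc subrr.
    - by rewrite raddfB /= Ec subrr.
    by exists (bar_d3 w); [exists w | rewrite -Ew addrC subrK].
  by split; rewrite raddfD /= ?dz ?bar_d23 ?schur_class_d3 addr0.
have H2E : H2 H = classical_sets.image [set` schur_cycles]%classic F.
  apply/seteqP; split=> [_ [z /= dz <-]|_ [_ /schur_cyclesP[z dz <-] <-]].
    by exists (schur_class z); [apply/schur_cyclesP; exists z | rewrite FE].
  by exists z => //; rewrite FE.
have F_inj : {in schur_cycles &, injective F}.
  move=> b c /schur_cyclesP[z dz <-] _ /(congr1 (fun X => X z)) Fz.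
  have : F (schur_class z) z by split.
  by rewrite Fz => -[].
by rewrite H2E counting_image.
Qed.

(** Being trivial in the cover, the surface word is formally a boundary, and
T / [ker f, T] is a central extension of H, so that [surface_trivial] applies. *)
Lemma schur_universal n (x y : 'I_n -> H) (gT : finGroupType) (T : {group gT})
    (f : {morphism T >-> H}) (x' y' : 'I_n -> gT) :
    surface (fun i => (0%R, x i) : E) (fun i => (0%R, y i) : E) = 1 ->
    f @* T = [set: H] ->
    (forall i, x' i \in T) -> (forall i, y' i \in T) ->
    (forall i, f (x' i) = x i) -> (forall i, f (y' i) = y i) ->
  surface x' y' \in [~: 'ker f, T].
Proof.
move=> E1 fT x'T y'T fx fy.
have Esurf : schur_eval (fsurf x y) = 1.
  rewrite (evaluation_surf _ _ (schur_evalP H)) -[RHS]E1.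
  by apply: eq_bigr => i _; rewrite /schur_eval /= raddf0.
have Ec : schur_class ((fsurf x y).1 + bar11)%R = 0%R.
  rewrite raddfD /=; have /= -> := congr1 fst Esurf.
  by rewrite addNr.
have E2 : (fsurf x y).2 = 1 by have := congr1 snd Esurf.
have [|w Ew] := schur_class_cycle _ Ec.
  have := fboundary_surf x y; rewrite /fboundary E2 addrC raddfD /= => <-.
  by rewrite bar_d2_simplex mulg1 subrr add0r.
have Ef : fsurf x y = ((bar_d3 w - bar11)%R, 1).
  by rewrite -Ew addrK -E2; case: (fsurf x y).
have sKf : [~: 'ker f, T] \subset 'ker f by rewrite commg_subl ker_norm.
pose K := [~: 'ker f, T]%G.
have nKT : T \subset 'N(K) by rewrite normsR ?ker_norm.
have nK := subsetP nKT.
have sKK : 'ker (coset K) \subset 'ker f by rewrite ker_coset.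
pose g := factm_morphism sKK nKT.
rewrite -[[~: _, _]]/(gval K) coset_idr ?nK ?surface_group //.
rewrite morph_surface => [|i|i]; try exact: nK.
apply: (@surface_trivial _ _ (T / K)%G g _ _ _ x y _ _ w) => //.
- by rewrite /= morphim_factm.
- rewrite /= ker_factm.
  rewrite subsetI (subset_trans (morphimS _ (subsetIl _ _))) //=.
  by rewrite quotient_cents2r.
- by move=> i; apply: mem_quotient.
- by move=> i; apply: mem_quotient.
- by move=> i; rewrite /= factmE.
- by move=> i; rewrite /= factmE.
Qed.

End SecondHomologyOrder.

(** * Equidistribution of products of commutators *)

Import numFieldNormedType.Exports.

Section RandomWalk.
Variables (R : realType) (gT : finGroupType) (D : {group gT}) (S : finType)
  (s : S -> gT) (j0 : S).
Hypotheses (sD : (<< s @: S >> = D)%g) (s1 : s j0 = 1%g).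
Local Open Scope ring_scope.

(** The law of the product of n independent uniform elements of the family s. *)
Fixpoint walk (n : nat) : gT -> R :=
  if n is m.+1 then fun d => #|S|%:R^-1 * \sum_j walk m ((s j)^-1 * d)%g
  else fun d => (d == 1%g)%:R.

Let S_gt0 : 0 < #|S|%:R :> R.
Proof. by rewrite ltr0n; apply/card_gt0P; exists j0. Qed.

Let sjD j : s j \in D.
Proof. by rewrite -sD mem_gen // imset_f. Qed.

Lemma walk_ge0 n d : 0 <= walk n d.
Proof.
elim: n d => [|n IH] d /=; first exact: ler0n.
by rewrite mulr_ge0 ?invr_ge0 ?ler0n ?sumr_ge0.
Qed.

Lemma walk_sum n : \sum_d walk n d = 1.
Proof.
elim: n => [|n IH] /=.
  by rewrite (bigD1 1%g) //= eqxx big1 ?addr0 // => d /negPf->.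
rewrite -mulr_sumr exchange_big /=.
under eq_bigr => j _.
  rewrite (reindex_inj (mulgI (s j))) /=; under eq_bigr do rewrite mulKg.
  rewrite IH; over.
by rewrite sumr_const -[X in _ * X]/(#|S|%:R) mulVf ?gt_eqF.
Qed.

Lemma walk_supp n d : d \notin D -> walk n d = 0.
Proof.
elim: n d => [|n IH] d dD /=.
  by case: eqP dD => // ->; rewrite group1.
by rewrite big1 ?mulr0 // => j _; apply: IH; rewrite groupMl ?groupV.
Qed.

Lemma walk_sumD n : \sum_(d in D) walk n d = 1.
Proof.
rewrite -(walk_sum n) [RHS](bigID (mem D)) /= [X in _ + X]big1 ?addr0 // => d.
exact: walk_supp.
Qed.

(** The Markov property. *)
Lemma walkD m n d :
  walk (m + n) d = \sum_e walk m e * walk n (e^-1 * d)%g.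
Proof.
elim: m d => [|m IH] d /=.
  rewrite (bigD1 1%g) //= eqxx invg1 mul1g mul1r big1 ?addr0 // => e /negPf->.
  by rewrite mul0r.
under eq_bigr do rewrite IH.
rewrite exchange_big /= mulr_sumr.
under [RHS]eq_bigr do rewrite -mulrA mulr_suml mulr_sumr.
rewrite exchange_big [RHS]exchange_big /=; under eq_bigr do rewrite mulr_sumr.
rewrite exchange_big [RHS]exchange_big /=; apply: eq_bigr => j _.
rewrite [RHS](reindex_inj (mulgI (s j))) /=; apply: eq_bigr => e _.
by rewrite mulKg invgM mulgA.
Qed.

Lemma walk_step n d j : 0 < walk n d -> 0 < walk n.+1 (s j * d)%g.
Proof.
move=> pd /=; rewrite mulr_gt0 ?invr_gt0 //.
rewrite (bigD1 j) //= mulKg ltr_pwDl // sumr_ge0 // => i _; exact: walk_ge0.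
Qed.

Lemma walk_mono m n d : (m <= n)%N -> 0 < walk m d -> 0 < walk n d.
Proof.
move=> /subnKC <-; elim: (n - m)%N d => [|k IH] d pd; first by rewrite addn0.
by rewrite addnS -[d]mul1g -s1; apply/walk_step/IH.
Qed.

Lemma walk_reach : exists2 k, (0 < k)%N & forall d, d \in D -> 0 < walk k d.
Proof.
pose U := [set d | `[< exists k, 0 < walk k d >]].
have UP d : reflect (exists k, 0 < walk k d) (d \in U).
  by rewrite inE; apply: asboolP.
have grU : group_set U.
  apply/group_setP; split=> [|d e /UP[k pd] /UP[m pe]]; apply/UP.
    by exists 0%N; rewrite /= eqxx.
  exists (k + m)%N; rewrite walkD (bigD1 d) //= mulKg ltr_pwDl ?mulr_gt0 //.
  by rewrite sumr_ge0 // => f _; rewrite mulr_ge0 ?walk_ge0.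
have sDU : D \subset Group grU.
  rewrite -sD gen_subG; apply/subsetP=> _ /imsetP[j _ ->]; apply/UP.
  by exists 1%N; rewrite -[s j]mulg1; apply: walk_step; rewrite /= eqxx.
have k_ d : exists k, d \in D -> 0 < walk k d.
  have [dD|] := boolP (d \in D); last by exists 0%N.
  by have /UP[k pk] := subsetP sDU d dD; exists k.
pose k d := xget 0%N [set k | d \in D -> 0 < walk k d]%classic.
have kP d : d \in D -> 0 < walk (k d) d.
  rewrite /k; case: xgetP => [m _ //|nk].
  by have [m /nk] := k_ d.
exists (\max_d k d).+1 => // d dD.
by apply: walk_mono (kP d dD); apply: leqW; apply: leq_bigmax.
Qed.

(** Doeblin: after k steps every point of D has mass at least eps, so the
oscillation of the law over D contracts by the factor 1 - eps |D|. *)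
Lemma walk_osc : exists2 k, (0 < k)%N & exists2 r : R, 0 <= r < 1 &
  forall n d d', d \in D -> d' \in D -> walk n d - walk n d' <= r ^+ (n %/ k).
Proof.
have [k k_gt0 pk] := walk_reach; exists k => //.
have [e0 e0D e0min] : exists2 e0, e0 \in D & forall e, e \in D -> walk k e0 <= walk k e.
  case: (arg_minP (walk k) (group1 D)) => e0 e0D e0min.
  by exists e0.
set eps := walk k e0; have eps_gt0 : 0 < eps by apply: pk.
have epsD : eps * #|D|%:R <= 1.
  rewrite -[X in _ <= X](walk_sumD k) mulr_natr -sumr_const; apply: ler_sum => e eD.
  exact: e0min.
exists (1 - eps * #|D|%:R).
  by rewrite subr_ge0 epsD gtrBl mulr_gt0 // ltr0n cardG_gt0.
set r := 1 - _; have r_ge0 : 0 <= r by rewrite subr_ge0.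
have diff m n d d' : d \in D -> d' \in D -> walk (m + n) d - walk (m + n) d' =
    \sum_(e in D) walk m e * (walk n (e^-1 * d)%g - walk n (e^-1 * d')%g).
  move=> dD d'D; rewrite !walkD -sumrB (bigID (mem D)) /= [X in _ + X]big1 ?addr0.
    by apply: eq_bigr => e _; rewrite mulrBr.
  by move=> e eD; rewrite walk_supp // !mul0r subrr.
have sumD n d : d \in D -> \sum_(e in D) walk n (e^-1 * d)%g = 1.
  move=> dD; rewrite -(walk_sumD n).
  rewrite [RHS](reindex_inj (h := fun e => (e^-1 * d)%g)); last first.
    by move=> x y /mulIg /invg_inj.
  by apply: eq_bigl => e; rewrite groupMr // groupV.
have contract c n : (forall d d', d \in D -> d' \in D -> walk n d - walk n d' <= c) ->
    forall d d', d \in D -> d' \in D -> walk (k + n) d - walk (k + n) d' <= r * c.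
  move=> osc d d' dD d'D; rewrite diff //.
  have -> : \sum_(e in D) walk k e * (walk n (e^-1 * d)%g - walk n (e^-1 * d')%g) =
      \sum_(e in D) (walk k e - eps) * (walk n (e^-1 * d)%g - walk n (e^-1 * d')%g).
    rewrite -[RHS]addr0 -[X in _ = _ + X](mulr0 eps) -[X in eps * X](subrr 1).
    rewrite -{1}(sumD n d dD) -(sumD n d' d'D) -sumrB mulr_sumr -big_split /=.
    by apply: eq_bigr => e _; rewrite -mulrDl subrK.
  have -> : r = \sum_(e in D) (walk k e - eps).
    by rewrite /r mulr_natr sumrB walk_sumD sumr_const.
  rewrite mulr_suml; apply: ler_sum => e eD.
  by rewrite ler_wpM2l ?subr_ge0 ?e0min // osc // groupM ?groupV.
have stay c m n : (forall d d', d \in D -> d' \in D -> walk n d - walk n d' <= c) ->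
    forall d d', d \in D -> d' \in D -> walk (m + n) d - walk (m + n) d' <= c.
  move=> osc d d' dD d'D; rewrite diff // -[c]mul1r -(walk_sumD m) mulr_suml.
  apply: ler_sum => e eD.
  by rewrite ler_wpM2l ?walk_ge0 // osc // groupM ?groupV.
have base d d' : d \in D -> d' \in D -> walk 0 d - walk 0 d' <= 1.
  move=> _ _ /=; apply: (@le_trans _ _ (d == 1%g)%:R); first by rewrite gerBl ler0n.
  by rewrite lern1 leq_b1.
move=> n; have -> : walk n = walk (n %% k + n %/ k * k)%N by rewrite addnC -divn_eq.
apply: stay; elim: (n %/ k)%N => [|m IH]; first by rewrite mul0n expr0.
by rewrite mulSn exprS; apply: contract.
Qed.

Lemma cvg_divn k : (0 < k)%N -> ((fun n => n %/ k)%N @ \oo --> \oo)%classic.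
Proof.
move=> k_gt0 A [N _ NA]; exists (N * k)%N => // n /= Nkn.
by apply: NA; rewrite /= leq_divRL.
Qed.

Lemma walk_cvg : ((fun n => walk n 1%g) @ \oo --> (#|D|%:R^-1 : R))%classic.
Proof.
have [k k_gt0 [r /andP[r_ge0 r_lt1] osc]] := walk_osc.
have D_gt0 : 0 < #|D|%:R :> R by rewrite ltr0n cardG_gt0.
have bound n : `|walk n 1%g - #|D|%:R^-1| <= r ^+ (n %/ k).
  have E : walk n 1%g - #|D|%:R^-1 = #|D|%:R^-1 * \sum_(d in D) (walk n 1%g - walk n d).
    rewrite sumrB sumr_const walk_sumD mulrBr mulr1; congr (_ - _).
    by rewrite -[X in _ * X]mulr_natl mulKf ?gt_eqF.
  rewrite E normrM gtr0_norm ?invr_gt0 // ler_pdivrMl //.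
  apply: le_trans (ler_norm_sum _ _ _) _.
  rewrite mulr_natl -sumr_const; apply: ler_sum => d dD.
  by rewrite ler_norml lerNl opprB !osc.
have rcvg : ((fun n => r ^+ (n %/ k)) @ \oo --> (0 : R))%classic.
  apply: (@cvg_comp _ _ _ (fun n => n %/ k)%N (fun m => r ^+ m)) (cvg_divn k_gt0) _.
  by apply: cvg_expr; rewrite ger0_norm.
apply/cvgrPdist_le => e e_gt0; move/cvgrPdist_le: rcvg => /(_ e e_gt0).
apply: filterS => n; rewrite sub0r normrN ger0_norm ?exprn_ge0 // => re.
by rewrite distrC; apply: le_trans re.
Qed.

Lemma walk_count n d : walk n d =
  #|[set w : {ffun 'I_n -> S} | (\prod_i s (w i))%g == d]|%:R / #|S|%:R ^+ n.
Proof.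
rewrite -sum1_card natr_sum; elim: n d => [|n IH] d /=.
  rewrite expr0 divr1 big_mkcond /= (big_pred1 [ffun i : 'I_0 => j0]) => [|w].
    by rewrite inE big_ord0 eq_sym; case: eqP.
  by apply/esym/eqP/ffunP=> -[].
pose cons (p : S * {ffun 'I_n -> S}) : {ffun 'I_n.+1 -> S} :=
  [ffun i => oapp p.2 p.1 (unlift ord0 i)].
have cons_bij : bijective cons.
  exists (fun w : {ffun 'I_n.+1 -> S} =>
    (w ord0, [ffun i : 'I_n => w (lift ord0 i)])) => [[j w]|w].
    congr pair; first by rewrite ffunE unlift_none.
    by apply/ffunP=> i; rewrite !ffunE liftK.
  apply/ffunP=> i; rewrite ffunE; case: unliftP => [k|] -> //=.
  by rewrite ffunE.
rewrite [in RHS](reindex cons) /=; last exact: onW_bij.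
under [in RHS]eq_bigl => p.
  rewrite inE big_ord_recl ffunE unlift_none /=.
  under eq_bigr do rewrite ffunE liftK /=.
  rewrite (can2_eq (mulKg _) (mulKVg _)).
  over.
rewrite -(pair_big_dep predT
  (fun j (w : {ffun 'I_n -> S}) => (\prod_i s (w i))%g == ((s j)^-1 * d)%g)
  (fun=> fun=> 1)) /= exprS invfM mulrCA mulr_suml; congr (_ * _).
apply: eq_bigr => j _; rewrite IH; congr (_ / _).
by apply: eq_bigl => w; rewrite inE.
Qed.

End RandomWalk.

Section Generation.
Variable H : finGroupType.

Definition generates n (y : 'I_n -> H) : bool := (<<y @: 'I_n>> == [set: H])%g.

(** Union bound over the proper subgroups, each of index at least two. *)
Lemma nongenerating_bound (S : finType) (v : S -> H) n :
    (forall M : {group H}, M != [set: H]%g :> {set H} ->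
       #|[set j | v j \in M]| * 2 <= #|S|)%N ->
  (#|[set w : {ffun 'I_n -> S} | ~~ generates (v \o w)]| * 2 ^ n <=
     #|{group H}| * #|S| ^ n)%N.
Proof.
move=> half.
pose B (M : {group H}) := [set w : {ffun 'I_n -> S} |
  (M != [set: H]%g :> {set H}) && [forall i, v (w i) \in M]].
have cardB M : (#|B M| * 2 ^ n <= #|S| ^ n)%N.
  have [M1|nM] := eqVneq (gval M) [set: H]%g.
    by rewrite /B M1 eqxx /= -[[set _ | _]]/(finset _) cards0.
  have -> : #|B M| = (#|[set j | v j \in M]| ^ n)%N.
    rewrite -[n in RHS]card_ord -card_ffun_on; apply: eq_card => w.
    rewrite !inE nM; apply/forallP/ffun_onP => /= wM i; last by have := wM i; rewrite inE.
    by rewrite inE.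
  rewrite -expnMn; have := half M nM.
  by case: (n) => // m; rewrite leq_exp2r.
have sub : [set w : {ffun 'I_n -> S} | ~~ generates (v \o w)] \subset
    \bigcup_(M : {group H}) B M.
  apply/subsetP=> w; rewrite inE => ngen.
  apply/bigcupP; exists [group of <<(v \o w) @: 'I_n>>]%g => //.
  rewrite inE ngen /=; apply/forallP => i.
  by rewrite mem_gen //; apply/imsetP; exists i.
apply: (@leq_trans ((\sum_(M : {group H}) #|B M|) * 2 ^ n)%N).
  rewrite leq_mul2r; apply/orP; right.
  apply: leq_trans (subset_leq_card sub) _.
  apply: (big_rec2 (fun (A : {set {ffun 'I_n -> S}}) m => (#|A| <= m)%N)).
    by rewrite cards0.
  move=> M m A _ leAm; apply: leq_trans (leq_card_setU _ _) _.
  by rewrite leq_add2l.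
rewrite big_distrl /= -sum_nat_const; apply: leq_sum => M _; exact: cardB.
Qed.

Lemma proper_half (M : {group H}) : M != [set: H]%g :> {set H} -> (#|M| * 2 <= #|H|)%N.
Proof.
move=> nM; rewrite -[#|H|]cardsT -(Lagrange (subsetT M)) leq_mul2l.
by rewrite indexg_gt1 subTset nM orbT.
Qed.

Lemma nongenerating_id n :
  (#|[set w : {ffun 'I_n -> H} | ~~ generates w]| * 2 ^ n <=
     #|{group H}| * #|H| ^ n)%N.
Proof.
apply: (nongenerating_bound (v := id)) => M /proper_half; apply: leq_trans.
by rewrite leq_mul2r; apply/orP; right; apply: subset_leq_card; apply/subsetP=> x; rewrite inE.
Qed.

Lemma nongenerating_snd n :
  (#|[set w : {ffun 'I_n -> H * H} | ~~ generates (fun i => (w i).2)]| * 2 ^ n <=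
     #|{group H}| * #|{: H * H}| ^ n)%N.
Proof.
apply: (nongenerating_bound (v := snd)) => M /proper_half hM.
have -> : [set j : H * H | j.2 \in M] = setX [set: H]%g M.
  by apply/setP=> -[g h]; rewrite !inE.
by rewrite cardsX cardsT card_prod -mulnA leq_mul2l hM orbT.
Qed.

End Generation.

Section Limit.
Variable R : realType.
Local Open Scope ring_scope.

Lemma cvg_half_pow (C : R) : ((fun n => C * 2^-1 ^+ n) @ \oo --> (0 : R))%classic.
Proof.
rewrite -(mulr0 C); apply: cvgM; first exact: cvg_cst.
by apply: cvg_expr; rewrite ger0_norm ?invr_ge0 // invf_lt1 // ltr1n.
Qed.

Lemma generating_fraction (H : finGroupType) :
  ((fun n => #|[set w : {ffun 'I_n -> H} | generates w]%SET|%:R / #|H|%:R ^+ n)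
     @ \oo --> (1 : R))%classic.
Proof.
have Hgt0 : 0 < #|H|%:R :> R by rewrite ltr0n; apply/card_gt0P; exists 1%g.
apply: (@squeeze_cvgr _ _ _ _ (fun n => 1 - #|{group H}|%:R * 2^-1 ^+ n) (fun=> 1)).
- apply: nearW => n /=.
  have E : #|[set w : {ffun 'I_n -> H} | generates w]|%:R =
      #|H|%:R ^+ n - #|[set w : {ffun 'I_n -> H} | ~~ generates w]|%:R :> R.
    rewrite -natrX -[X in (_ ^ X)%N]card_ord -card_ffun.
    rewrite -(cardsC [set w : {ffun 'I_n -> H} | generates w]) natrD.
    rewrite -[LHS]addr0 -addrA; congr (_ + _).
    rewrite (_ : ~: _ = [set w : {ffun 'I_n -> H} | ~~ generates w]).
      by rewrite subrr.
    by apply/setP=> w; rewrite !inE.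
  rewrite E mulrBl divff ?expf_neq0 ?gt_eqF //.
  apply/andP; split; last by rewrite gerBl divr_ge0 ?exprn_ge0 ?ler0n.
  rewrite lerD2l lerN2 ler_pdivrMr ?exprn_gt0 // mulrAC exprVn.
  rewrite ler_pdivlMr ?exprn_gt0 //.
  by have := nongenerating_id H n; rewrite -(ler_nat R) !natrM !natrX.
- have := cvgB (cvg_cst (1 : R)) (cvg_half_pow #|{group H}|%:R).
  by rewrite subr0; apply.
- exact: cvg_cst.
Qed.

End Limit.

Section NullTuples.
Variable H : finGroupType.
Local Open Scope group_scope.

Local Notation E := (schur_cover H).

(** The lift to the cover of the commutator of two elements of H; it does not
depend on the lifts of the two elements. *)
Definition handle_comm (p : H * H) : E := [~ (0%R, p.1) : E, (0%R, p.2) : E].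

(** The surface word of the tuple is trivial already in the cover: the induced map
on H_2 from the surface to H vanishes. *)
Definition null_tuple n (w : 'I_n -> H * H) : bool :=
  \prod_(i < n) handle_comm (w i) == 1.

Lemma schur_comm (e f : E) : [~ e, f] = handle_comm (e.2, f.2).
Proof.
have kZ (x : E) : exists2 k, k \in 'Z([set: E]) & x = k * ((0%R, x.2) : E).
  exists (x * ((0%R, x.2) : E)^-1); last by rewrite mulgKV.
  by apply: (subsetP (schur_proj_central H)); rewrite schur_proj_ker /= mulgV.
have [k kC ke] := kZ e; have [m mC mf] := kZ f.
by rewrite [in LHS]ke [in LHS]mf (comm_central_mul kC mC) ?inE.
Qed.

Lemma handle_comm_gen :
  << [set handle_comm p | p : H * H] >> = [~: [set: E], [set: E]].
Proof.
apply/eqP; rewrite eqEsubset !gen_subG; apply/andP; split.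
  apply/subsetP=> _ /imsetP[p _ ->]; rewrite mem_gen //.
  by rewrite /handle_comm; apply: imset2_f; rewrite inE.
apply/subsetP=> _ /imset2P[e f _ _ ->]; rewrite schur_comm mem_gen //.
exact: imset_f.
Qed.

Lemma handle_comm1 : handle_comm (1, 1) = 1.
Proof. by apply/eqP/commgP. Qed.

End NullTuples.

Section OrbitLimit.
Variables (R : realType) (H : finGroupType).
Local Open Scope ring_scope.

Local Notation D := [~: [set: schur_cover H]%SET, [set: schur_cover H]%SET]%G.

(** Generating tuples have density one, and null tuples have density 1/|D| by
equidistribution of products of commutators in D; requiring in addition that the
second components generate H does not change the latter. *)
Lemma orbit_limit (O : nat -> nat) (n0 : nat) :
    (forall n, n0 <= n ->
       #|[set w : {ffun 'I_n -> H * H} | generates (fun i => (w i).2) && null_tuple w]%SET|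
         <= O n <= #|[set w : {ffun 'I_n -> H * H} | null_tuple w]%SET|)%N ->
  ((fun n => #|[set w : {ffun 'I_n -> H} | generates w]%SET|%:R ^+ 2 / (O n)%:R)
     @ \oo --> (#|D|%:R : R))%classic.
Proof.
move=> Obound.
have Hgt0 : 0 < #|H|%:R :> R by rewrite ltr0n; apply/card_gt0P; exists 1%g.
have gD : (<< [set handle_comm p | p : H * H]%SET >> = D)%g := handle_comm_gen H.
have wcvg := @walk_cvg R _ D _ (@handle_comm H) (1%g, 1%g) gD (handle_comm1 H).
have D_gt0 : 0 < #|D|%:R :> R by rewrite ltr0n cardG_gt0.
have Ocvg : ((fun n => (O n)%:R / #|H|%:R ^+ (2 * n)) @ \oo --> (#|D|%:R^-1 : R))%classic.
  have low : ((fun n => walk R (@handle_comm H) n 1%g - #|{group H}|%:R * 2^-1 ^+ n)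
      @ \oo --> (#|D|%:R^-1 : R))%classic.
    by rewrite -[#|D|%:R^-1]subr0; apply: cvgB wcvg (cvg_half_pow _).
  apply: (squeeze_cvgr _ low wcvg); exists n0 => // n n0n /=.
  have /andP[lo hi] := Obound n n0n.
  have EH : #|H|%:R ^+ (2 * n) = #|{: H * H}|%:R ^+ n :> R.
    by rewrite card_prod natrM -expr2 exprM.
  have HH_gt0 : 0 < #|{: H * H}|%:R :> R by rewrite card_prod natrM mulr_gt0.
  rewrite EH (walk_count R (@handle_comm H) (1%g, 1%g)); apply/andP; split; last first.
    by rewrite ler_pM2r ?invr_gt0 ?exprn_gt0 // ler_nat.
  rewrite lerBlDr ler_pdivrMr ?exprn_gt0 // mulrDl divfK ?expf_neq0 ?gt_eqF //.
  apply: (@le_trans _ _ ((O n)%:R +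
      #|[set w : {ffun 'I_n -> H * H} | ~~ generates (fun i => (w i).2)]%SET|%:R)).
    rewrite -natrD ler_nat; apply: (@leq_trans _ _ _ _ (leq_add lo (leqnn _))).
    apply: leq_trans (leq_card_setU _ _); apply: subset_leq_card.
    by apply/subsetP=> w; rewrite !inE /null_tuple => ->; rewrite andbT orbN.
  rewrite lerD2l exprVn mulrAC ler_pdivlMr ?exprn_gt0 //.
  by have := nongenerating_snd H n; rewrite -(ler_nat R) !natrM !natrX.
have gcvg := @generating_fraction R H.
set g := (X in (X n @[n --> _] --> _)%classic) in gcvg.
have : ((fun n => g n * g n * ((O n)%:R / #|H|%:R ^+ (2 * n))^-1) @ \oo -->
    (#|D|%:R : R))%classic.
  have -> : #|D|%:R = 1 * 1 * (#|D|%:R^-1)^-1 :> R by rewrite invrK !mul1r.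
  apply: (cvgM (cvgM gcvg gcvg)).
  by apply: (cvgV _ Ocvg); rewrite invr_eq0 gt_eqF.
apply: cvg_trans; apply: near_eq_cvg; apply: nearW => n /=.
rewrite /g mulf_div -expr2 -expr2 -exprM invfM invrK [(n * 2)%N]mulnC.
by rewrite mulrCA divfK ?expf_neq0 ?gt_eqF // mulrC.
Qed.

End OrbitLimit.

(** * Finite quotients of pro-l groups *)

Local Open Scope classical_set_scope.
Local Open Scope group_scope.

Section DiscreteGroups.
Variable P : finGroupType.

(** A finite group as a topological group, which is what the universal property
of F takes as a target. *)
Definition discrete_group : Type := discrete_topology P.
HB.instance Definition _ := Choice.on discrete_group.
HB.instance Definition _ := Topological.on discrete_group.
HB.instance Definition _ := monoid.Group.copy discrete_group P.

Let mul_cont : continuous (fun x : discrete_group * discrete_group => x.1 * x.2).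
Proof.
move=> [x y] U Uxy; exists ([set x], [set y]) => /=.
  split; [exact: (@discrete_set1 (discrete_topology P) x) |
    exact: (@discrete_set1 (discrete_topology P) y)].
move=> [u v] [/= ux vy]; have /= := nbhs_singleton Uxy.
by rewrite ux vy.
Qed.
Let inv_cont : continuous (fun x : discrete_group => x^-1).
Proof.
move=> x; apply/(@discrete_cvg (discrete_topology P)).
by apply: (@filterS _ (nbhs (x : discrete_topology P)) _ [set x]) (discrete_set1 x) => _ ->.
Qed.
HB.instance Definition _ := PreTopGroup_isTopGroup.Build discrete_group
  mul_cont inv_cont.

Lemma discrete_pro_group (l : nat) : l.-group [set: P]%SET -> pro_group l discrete_group.
Proof.
move=> lP; split.
- by apply: finite_compact; apply: (@finite_finset P).
- exact: (@discrete_hausdorff (discrete_topology P)).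
move=> U U1; exists [set 1]; split.
- exact: (@discrete_open (discrete_topology P)).
- split=> //; first by move=> x y -> ->; rewrite mulg1.
  + by move=> x ->; rewrite invg1.
  + by move=> x g ->; rewrite conj1g.
- by move=> _ ->; have := nbhs_singleton U1.
have [k kP] := p_natP lP.
exists k; rewrite -kP cardsT.
have -> : [set [set x * y | y in [set 1]] | x in [set: discrete_group]] =
    (fun x : discrete_group => [set x]) @` [set: discrete_group].
  by apply/seteqP; split=> _ [x _ <-]; exists x => //; rewrite image_set1 mulg1.
apply: card_eq_trans (inj_card_eq _) _.
  by move=> x y _ _ /seteqP[/(_ x erefl)].
apply: card_eq_trans (card_esym (inj_card_eq (f := @enum_rank P) _)) _.
  by move=> x y _ _; apply: enum_rank_inj.
have -> : @enum_rank P @` [set: P] = [set: 'I_#|P|].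
  by apply/seteqP; split=> // i _; exists (enum_val i) => //; rewrite enum_valK.
exact: card_esym card_II.
Qed.

End DiscreteGroups.

Section FiniteHom.
Variable F : topGroupType.

Definition finite_hom (P : finGroupType) (f : F -> P) : Prop :=
  continuous (f : F -> discrete_topology P) /\ {morph f : x y / x * y}.

Lemma continuous_locally_constant (P : choiceType) (f : F -> P) :
  (forall x, nbhs x [set y | f y = f x]) -> continuous (f : F -> discrete_topology P).
Proof.
move=> fx x; apply/(@discrete_cvg (discrete_topology P) (fmap f (nbhs x))).
exact: fx.
Qed.

Lemma lmulg_continuous (x : F) : continuous (fun y => x * y).
Proof.
move=> y; apply: (@continuous_comp _ _ _ (fun y : F => (x, y)) (fun z => z.1 * z.2)).
  by apply: cvg_pair => //=; exact: cvg_cst.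
exact: mulg_continuous.
Qed.

Section Theory.
Variables (P : finGroupType) (f : F -> P) (fP : finite_hom f).

Lemma finite_homM x y : f (x * y) = f x * f y. Proof. by case: fP => _ ->. Qed.
Lemma finite_hom1 : f 1 = 1.
Proof. by apply: (mulgI (f 1)); rewrite -finite_homM !mulg1. Qed.
Lemma finite_homV x : f x^-1 = (f x)^-1.
Proof. by apply: (mulgI (f x)); rewrite -finite_homM !mulgV finite_hom1. Qed.
Lemma finite_homR x y : f [~ x, y] = [~ f x, f y].
Proof. by rewrite !commgEl !conjgE !finite_homM !finite_homV. Qed.
Lemma finite_hom_surface n (a b : 'I_n -> F) :
  f (surface a b) = surface (f \o a) (f \o b).
Proof.
rewrite /surface (big_morph f finite_homM finite_hom1).
by apply: eq_bigr => i _; apply: finite_homR.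
Qed.

Lemma finite_hom_open (A : set P) : open (f @^-1` A).
Proof.
have [fc _] := fP; apply: (@open_comp _ (discrete_topology P) f A).
  by move=> x _; apply: fc.
exact: (@discrete_open (discrete_topology P)).
Qed.

Lemma finite_hom_closed (A : set P) : closed (f @^-1` A).
Proof. by rewrite -[A]classical_sets.setCK -preimage_setC closedC; apply: finite_hom_open. Qed.

End Theory.

Lemma finite_hom_pair (P Q : finGroupType) (f : F -> P) (g : F -> Q) :
  finite_hom f -> finite_hom g -> finite_hom (fun x => (f x, g x)).
Proof.
move=> fP gP; split=> [|x y]; last by rewrite (finite_homM fP) (finite_homM gP).
apply: continuous_locally_constant => x.
have nf : nbhs x (f @^-1` [set f x]).
  by apply: open_nbhs_nbhs; split=> //; apply: finite_hom_open.
have ng : nbhs x (g @^-1` [set g x]).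
  by apply: open_nbhs_nbhs; split=> //; apply: finite_hom_open.
by apply: filterS (filterI nf ng) => y [/= -> ->].
Qed.

Lemma finite_hom_comp (P Q : finGroupType) (f : F -> P) (g : P -> Q) :
  finite_hom f -> {morph g : x y / x * y} -> finite_hom (g \o f).
Proof.
move=> fP gM; split=> [|x y /=]; last by rewrite (finite_homM fP) gM.
apply: continuous_locally_constant => x.
have nf : nbhs x (f @^-1` [set f x]).
  by apply: open_nbhs_nbhs; split=> //; apply: finite_hom_open.
by apply: filterS nf => y /= ->.
Qed.

(** An open normal subgroup N of finite index m acts on the m cosets; the image
of F in the symmetric group is a finite quotient F/N, realised as a finite
group of order m. *)
Section OpenQuotient.
Variables (l k : nat) (N : set F).
Hypotheses (l_prime : prime l) (N_open : open N) (N_normal : normal_subgroup N).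
Hypothesis N_index :
  ([set [set x * y | y in N] | x in [set: F]] #= `I_(l ^ k)%N)%card.

Local Notation m := (l ^ k)%N.
Local Notation coset x := [set x * y | y in N].

Let cosetP x y : coset x = coset y <-> N (x^-1 * y).
Proof.
have [N1 NM NV NJ] := N_normal; split=> [/seteqP[_ /(_ y)]|Nxy].
  by case=> [|z Nz <-]; [exists 1; rewrite ?mulg1 | rewrite mulKg].
apply/seteqP; split=> _ [z Nz <-].
  exists (y^-1 * x * z); last by rewrite !mulgA mulgV mul1g.
  by apply: NM => //; have := NV _ Nxy; rewrite invgM invgK.
by exists (x^-1 * y * z); [apply: NM | rewrite !mulgA mulgV mul1g].
Qed.

Let label_ex : exists label : F -> 'I_m, (forall x y, label x = label y <-> N (x^-1 * y)) /\
  (forall i, exists x, label x = i).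
Proof.
have /card_set_bijP[f [fI f_inj f_surj]] := N_index.
have fm x : (f (coset x) < m)%N by apply: (fI (coset x)); exists x.
exists (fun x => Ordinal (fm x)); split=> [x y|i].
  have inA z : coset z \in [set coset x | x in [set: F]] by apply/mem_set; exists z.
  rewrite -cosetP; split=> [[e]|e]; first exact: f_inj (inA x) (inA y) e.
  by apply: val_inj; rewrite /= e.
have [_ [x _ <-] fx] := f_surj i (ltn_ord i).
by exists x; apply: val_inj.
Qed.

Lemma open_quotient : exists (P : finGroupType) (f : F -> P),
  [/\ l.-group [set: P]%SET, finite_hom f & forall x, f x = 1 <-> N x].
Proof.
have [N1 NM NV NJ] := N_normal.
have [kap [kapP kap_surj]] := label_ex.
have [sig sigK] : exists s : 'I_m -> F, cancel s kap.
  by exists (fun i => projT1 (cid (kap_surj i))) => i; case: cid.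
have key w x : kap (sig (kap w) * x) = kap (w * x).
  apply/kapP; have /kapP NN : kap (sig (kap w)) = kap w by rewrite sigK.
  by have := NJ _ x NN; rewrite conjgE invgM !mulgA.
have act_inj x : injective (fun i => kap (sig i * x)).
  move=> i j /kapP Nij; rewrite -(sigK i) -(sigK j); apply/kapP.
  have := NJ _ x^-1 Nij; rewrite conjgE invgK invgM !mulgA mulgK mulgV mul1g.
  by [].
pose rho x := perm (act_inj x).
have rhoM x y : rho (x * y) = rho x * rho y.
  by apply/permP=> i; rewrite permM !permE key mulgA.
have rho1 x : rho x (kap 1) = kap x by rewrite permE key mul1g.
have rhoP x y : rho x = rho y <-> kap x = kap y.
  split=> [e|/kapP Nxy]; first by rewrite -(rho1 x) -(rho1 y) e.
  by apply/permP=> i; rewrite !permE; apply/kapP; rewrite invgM mulgA mulgKV.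
have rhoE x : rho x = rho (sig (kap x)) by apply/rhoP; rewrite sigK.
pose G := [set rho (sig i) | i : 'I_m]%SET.
have rhoG x : rho x \in G by rewrite rhoE; apply: imset_f.
have grG : group_set G.
  apply/group_setP; split=> [|_ _ /imsetP[i _ ->] /imsetP[j _ ->]].
    suff <- : rho 1 = 1 by apply: rhoG.
    by apply: (mulgI (rho 1)); rewrite -rhoM !mulg1.
  by rewrite -rhoM rhoG.
have cardG : #|G| = m.
  rewrite card_imset ?card_ord // => i j /rhoP.
  by rewrite !sigK.
exists (subg_of (Group grG)), (fun x => subg (Group grG) (rho x)); split.
- rewrite /pgroup cardsT card_sub /=.
  have -> : #|[pred x in Group grG]| = #|G| by [].
  by rewrite cardG pnatX pnat_id.
- split=> [|x y]; last by rewrite rhoM subgM ?rhoG.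
  apply: continuous_locally_constant => x.
  have : nbhs x ((fun y => x^-1 * y) @^-1` N).
    apply: open_nbhs_nbhs; split; last by rewrite /= mulVg.
    by apply: open_comp => // y _; apply: lmulg_continuous.
  apply: filterS => y /kapP/rhoP xy; congr (subg (Group grG)).
  by rewrite xy.
move=> x; split.
  move=> /(congr1 val) /=; rewrite subgK ?rhoG // => rx.
  have /rhoP/kapP : rho 1 = rho x.
    by rewrite rx; apply: (mulgI (rho 1)); rewrite -rhoM !mulg1.
  by rewrite invg1 mul1g.
move=> Nx; apply: val_inj; rewrite /= subgK ?rhoG //.
have -> : rho x = rho 1 by apply/esym/rhoP/kapP; rewrite invg1 mul1g.
by apply: (mulgI (rho 1)); rewrite -rhoM !mulg1.
Qed.

End OpenQuotient.
End FiniteHom.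

(** Points are separated by open normal subgroups, that is, by finite quotients. *)
Lemma pro_group_residual (l : nat) (F : topGroupType) (u v : F) :
    prime l -> pro_group l F -> u <> v ->
  exists (P : finGroupType) (f : F -> P),
    [/\ l.-group [set: P]%SET, finite_hom f & f u <> f v].
Proof.
move=> pl [_ hF basis] uv.
have uv1 : 1 != u^-1 * v.
  by apply/eqP=> e; apply: uv; rewrite -[v](mulKVg u) -e mulg1.
have /= := hF; rewrite open_hausdorff => /(_ _ _ uv1)[[A B] /= [A1 Buv] [oA oB AB]].
have [|N [oN nN NA [k Nk]]] := basis A.
  by apply: open_nbhs_nbhs; split=> //; exact: set_mem A1.
have [P [f [lP fP fN]]] := open_quotient pl oN nN Nk.
exists P, f; split=> // fuv.
have /fN Nuv : f (u^-1 * v) = 1.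
  by rewrite (finite_homM fP) (finite_homV fP) fuv mulVg.
have : (A `&` B) (u^-1 * v) by split; [apply: NA | exact: set_mem Buv].
by rewrite (eqP AB).
Qed.

Section Compactness.
Variables (l : nat) (F : topGroupType) (l_prime : prime l) (pF : pro_group l F).

Lemma finite_hom_tuple_open (J : finType) (P : finGroupType) (f : F -> P)
    (S : set (J -> P)) : finite_hom f ->
  open ([set w | S (f \o w)] : set (prod_topology (fun _ : J => F))).
Proof.
move=> fP; pose X : topologicalType := prod_topology (fun _ : J => F).
rewrite openE => w /= Sw; rewrite /interior.
have near_w j : nbhs (w : X) [set v : X | f (v j) = f (w j)].
  have nb : nbhs (w j) (f @^-1` [set f (w j)]).
    by apply: open_nbhs_nbhs; split=> //; apply: finite_hom_open.
  exact: (@proj_continuous J (fun=> F) j w _ nb).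
have := @filter_forall X J (fun j => [set v : X | f (v j) = f (w j)])
  (nbhs (w : X)) (nbhs_filter _) near_w.
apply: (@filterS X) => v vw /=; suff -> : f \o v = f \o w by [].
by apply/funext => j; apply: vw.
Qed.

Lemma finite_hom_tuple_closed (J : finType) (P : finGroupType) (f : F -> P)
    (S : set (J -> P)) : finite_hom f ->
  closed ([set w | S (f \o w)] : set (prod_topology (fun _ : J => F))).
Proof.
move=> fP; rewrite -[X in closed X]classical_sets.setCK closedC.
exact: (finite_hom_tuple_open (fun p => ~ S p) fP).
Qed.

Lemma pgroup_prod (P Q : finGroupType) :
  l.-group [set: P]%SET -> l.-group [set: Q]%SET -> l.-group [set: P * Q]%SET.
Proof. by rewrite /pgroup !cardsT card_prod pnatM => -> ->. Qed.

(** The solution sets are closed and by compatibility they generate a proper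
filter, which has a cluster point since F is compact. *)
Lemma profinite_solve (J : finType)
    (C : forall P : finGroupType, (F -> P) -> set (J -> F)) :
    (forall (P : finGroupType) (f : F -> P), l.-group [set: P]%SET -> finite_hom f ->
       closed (C P f : set (prod_topology (fun _ : J => F)))) ->
    (forall (P : finGroupType) (f : F -> P), l.-group [set: P]%SET ->
       finite_hom f -> C P f !=set0) ->
    (forall (P Q : finGroupType) (f : F -> P) (g : F -> Q),
       C (P * Q)%type (fun x => (f x, g x)) `<=` C P f `&` C Q g) ->
  exists w, forall (P : finGroupType) (f : F -> P), l.-group [set: P]%SET ->
    finite_hom f -> C P f w.
Proof.
move=> Ccl C0 CI; pose f0 (_ : F) : subg_of (1%G : {group {perm bool}}) := 1.
have lP0 : l.-group [set: subg_of (1%G : {group {perm bool}})]%SET.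
  by rewrite /pgroup cardsT card_sub; apply: pgroup1.
have f0P : finite_hom f0.
  split=> [|u v]; last by rewrite mulg1.
  by apply: continuous_locally_constant => u; apply: filterS filterT.
have [cF _ _] := pF.
pose X : topologicalType := prod_topology (fun _ : J => F).
pose G : set_system X := fun D => exists (P : finGroupType) (f : F -> P),
  [/\ l.-group [set: P]%SET, finite_hom f & C P f `<=` D].
have GG : ProperFilter G.
  apply: Build_ProperFilter => [[P [f [lP fP fD]]]|].
    by have [w /fD] := C0 P f lP fP.
  split; first by exists _, f0; split.
    move=> A B [P [f [lP fP fA]]] [Q [g [lQ gQ gB]]].
    exists _, (fun x => (f x, g x)); split; first exact: pgroup_prod.
      exact: finite_hom_pair.
    by move=> w /CI[/fA Aw /gB Bw]; split.
  by move=> A B AB [P [f [lP fP fA]]]; exists P, f; split=> // w /fA/AB.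
have := @tychonoff J (fun=> F) (fun=> [set: F]) (fun=> cF).
move=> /(_ G GG)[|w [_ clw]].
  by exists _, f0; split.
exists w => P f lP fP; have := clw; rewrite clusterE => /(_ (C P f)).
rewrite -(closure_id _).1; last exact: Ccl.
by apply; exists P, f; split.
Qed.

End Compactness.

Section FreeProGroup.
Variables (l : nat) (I : finType) (F : topGroupType) (x : I -> F).
Hypotheses (l_prime : prime l) (hF : free_pro_group l x).

Let pF : pro_group l F. Proof. by case: hF. Qed.

Lemma free_pro_ext (P : finGroupType) (p : I -> P) : l.-group [set: P]%SET ->
  exists2 f : F -> P, finite_hom f & forall i, f (x i) = p i.
Proof.
move=> lP; have [f [[fc fM fx] _]] := hF.2 (discrete_group P) p (discrete_pro_group lP).
by exists f.
Qed.

Lemma free_pro_uniq (P : finGroupType) (f g : F -> P) : l.-group [set: P]%SET ->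
  finite_hom f -> finite_hom g -> (forall i, f (x i) = g (x i)) -> f = g.
Proof.
move=> lP fP gP fg.
have [h [_ huniq]] := hF.2 (discrete_group P) (f \o x) (discrete_pro_group lP).
have hf : h = f by apply: huniq; case: fP.
have hg : h = g by apply: huniq; case: gP => gc gM; split=> // i; rewrite /= fg.
by rewrite -hf hg.
Qed.

(** By uniqueness f agrees with a homomorphism to the subgroup generated by the
images of the basis. *)
Lemma free_pro_gen (P : finGroupType) (f : F -> P) u : l.-group [set: P]%SET ->
  finite_hom f -> f u \in (<<[set f (x i) | i : I]>>)%SET.
Proof.
move=> lP fP; set G := [group of <<[set f (x i) | i : I]%SET>>].
have fxG i : f (x i) \in G by rewrite mem_gen // imset_f.
have lG : l.-group [set: subg_of G]%SET.
  rewrite /pgroup cardsT card_sub.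
  by apply: (pgroupS (subsetT _) lP).
have [g gP gx] := free_pro_ext (fun i => subg G (f (x i))) lG.
have Ef : f = (fun v => sgval (g v)).
  apply: (free_pro_uniq lP fP) => [|i]; first by apply: (finite_hom_comp gP).
  by rewrite gx subgK.
have -> : f u = sgval (g u) by rewrite [in LHS]Ef.
exact: (subgP (g u)).
Qed.

(** A tuple that generates every finite quotient is the image of the basis
under an automorphism: composition with the endomorphism it defines is an
injective, hence bijective, operation on the finite set of homomorphisms to a
given finite group. *)
Lemma free_pro_automorphism (w : I -> F) :
    (forall (P : finGroupType) (f : F -> P), l.-group [set: P]%SET ->
       finite_hom f -> forall i, f (x i) \in (<<[set f (w j) | j : I]>>)%SET) ->
  exists psi psi' : F -> F,
    [/\ continuous psi /\ {morph psi : u v / u * v},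
        continuous psi' /\ {morph psi' : u v / u * v},
        cancel psi psi', cancel psi' psi & forall i, psi (x i) = w i].
Proof.
move=> wgen.
have [psi [[psic psiM psix] _]] := hF.2 F w pF.
have comp_hom (P : finGroupType) (f : F -> P) (ph : F -> F) :
    finite_hom f -> continuous ph -> {morph ph : u v / u * v} -> finite_hom (f \o ph).
  move=> [fc fM] phc phM; split=> [u|u v /=]; last by rewrite phM fM.
  by apply: (@continuous_comp _ _ (discrete_topology P)); [apply: phc | apply: fc].
have psi_inj : injective psi.
  move=> u v Euv; apply: contrapT => /(pro_group_residual l_prime pF)[P [f [lP fP]]].
  apply.
  (* Precomposition with the endomorphism, on homomorphisms given by their values on the basis. *)
  pose pull (p : {ffun I -> P}) : {ffun I -> P} :=
    [ffun i => xget f [set g | finite_hom g /\ forall i, g (x i) = p i] (w i)].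
  have extP (p : I -> P) : let g := xget f [set g | finite_hom g /\ forall i, g (x i) = p i] in
      finite_hom g /\ forall i, g (x i) = p i.
    case: xgetP => // ng; have [g gP gx] := free_pro_ext p lP.
    by have /ng := conj gP gx.
  have pull_inj : injective pull.
    move=> p q /ffunP Epq; apply/ffunP=> i.
    have := extP p; have := extP q.
    have := Epq; rewrite /pull.
    set g := xget _ _; set h := xget _ _ => Egh [hP hx] [gP gx].
    have := wgen _ _ (pgroup_prod lP lP) (finite_hom_pair gP hP) i.
    rewrite gx hx.
    suff : (<<[set (g (w j), h (w j)) | j : I]>> \subset
        [set z : P * P | z.1 == z.2])%SET.
      by move=> /subsetP sub /sub; rewrite inE => /eqP.
    have grD : group_set [set z : P * P | z.1 == z.2]%SET.
      apply/group_setP; split=> [|[a b] [c d]]; rewrite !inE //.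
      by move=> /= /eqP-> /eqP->.
    rewrite -[[set z | _]%SET]/(gval (Group grD)) gen_subG.
    apply/subsetP=> _ /imsetP[j _ ->]; rewrite inE /=.
    by have := Egh j; rewrite !ffunE => ->.
  have [p Ep] : exists p, pull p = [ffun i => f (x i)].
    have [pull' _ pullK] := injF_bij pull_inj.
    by exists (pull' [ffun i => f (x i)]).
  have [gP gx] := extP p.
  set g := xget _ _ in gP gx.
  have -> : f = g \o psi; last by rewrite /= Euv.
  apply: (free_pro_uniq lP fP) => [|i]; first exact: comp_hom.
  by have /ffunP/(_ i) := Ep; rewrite !ffunE /= psix.
have [v psiv] : exists v : I -> F, forall i, psi (v i) = x i.
  pose C (P : finGroupType) (f : F -> P) : set (I -> F) :=
    [set v | forall i, f (psi (v i)) = f (x i)].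
  have [P f lP fP|P f lP fP|P Q f g v Cv|v vP] := @profinite_solve l F pF I C.
  - have := @finite_hom_tuple_closed F I P (f \o psi) [set p | forall i, p i = f (x i)].
    by apply; apply: comp_hom.
  - have v_ i : exists v, f (psi v) = f (x i).
      have fpsi := comp_hom _ _ _ fP psic psiM.
      have grD : group_set [set y : P | `[< exists v, f (psi v) = y >]]%SET.
        apply/group_setP; split=> [|a b]; rewrite !inE.
          by apply/asboolP; exists 1; apply: (finite_hom1 fpsi).
        move=> /asboolP[c <-] /asboolP[d <-]; apply/asboolP; exists (c * d).
        exact: (finite_homM fpsi).
      have := wgen P f lP fP i.
      suff /subsetP sub : (<<[set f (w j) | j : I]>> \subset Group grD)%SET.
        by move=> /sub; rewrite inE => /asboolP.
      rewrite gen_subG; apply/subsetP=> _ /imsetP[j _ ->]; rewrite inE.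
      by apply/asboolP; exists (x j); rewrite psix.
    by exists (fun i => projT1 (cid (v_ i))) => i; case: cid.
  - by split=> i; have [] := Cv i.
  exists v => i; apply: contrapT => /(pro_group_residual l_prime pF)[P [f [lP fP]]].
  by apply; apply: vP.
have [psi' [[psi'c psi'M psi'x] _]] := hF.2 F v pF.
have psiK : cancel psi' psi.
  have [h [_ huniq]] := hF.2 F x pF; move=> u.
  have E1 : h = psi \o psi'.
    apply: huniq; split=> [t|s t|i] /=; last by rewrite psi'x psiv.
      by apply: continuous_comp; [apply: psi'c | apply: psic].
    by rewrite psi'M psiM.
  have E2 : h = id by apply: huniq; split=> // t; apply: cvg_id.
  by have := congr1 (fun k => k u) E1; rewrite E2 /= => <-.
exists psi, psi'; split=> // u.
by apply: psi_inj; rewrite psiK.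
Qed.

End FreeProGroup.

(** * Automorphisms of F that fix the surface relation *)

Lemma gen_imset_map (P Q : finGroupType) (h : P -> Q) (J : finType) (p : J -> P) z :
  {morph h : u v / u * v} -> z \in (<<[set p j | j : J]>>)%SET ->
  h z \in (<<[set h (p j) | j : J]>>)%SET.
Proof.
move=> hM; pose G := [group of <<[set h (p j) | j : J]%SET>>].
have h1 : h 1 = 1 by apply: (mulgI (h 1)); rewrite -hM !mulg1.
have grP : group_set [set u | h u \in G]%SET.
  apply/group_setP; split=> [|u v]; rewrite !inE ?h1 ?group1 //.
  by move=> uG vG; rewrite hM groupM.
suff /subsetP sub : (<<[set p j | j : J]>> \subset Group grP)%SET.
  by move=> /sub; rewrite inE.
rewrite gen_subG; apply/subsetP=> _ /imsetP[j _ ->]; rewrite inE.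
by rewrite mem_gen // imset_f.
Qed.

Section Moves.
Variables (l : nat) (F : topGroupType) (n : nat) (a b : 'I_n -> F).
Hypotheses (l_prime : prime l) (hF : free_pro_group l (generators a b)).
Variables (H : finGroupType) (lH : l.-group [set: H]%SET).

Local Notation gens := (generators a b).
Local Notation tuple := {ffun 'I_n -> H * H}.

Definition tuple_value (w : tuple) (j : 'I_n + 'I_n) : H :=
  match j with inl i => (w i).1 | inr i => (w i).2 end.

Definition tuple_hom (w : tuple) : F -> H :=
  sval (cid2 (free_pro_ext hF (tuple_value w) lH)).

Lemma tuple_homP (w : tuple) : finite_hom (tuple_hom w).
Proof. by rewrite /tuple_hom; case: cid2. Qed.

Lemma tuple_homE (w : tuple) j : tuple_hom w (gens j) = tuple_value w j.
Proof. by rewrite /tuple_hom; case: cid2. Qed.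

Lemma tuple_hom_uniq (w : tuple) (f : F -> H) : finite_hom f ->
  (forall j, f (gens j) = tuple_value w j) -> f = tuple_hom w.
Proof.
move=> fP fw; apply: (free_pro_uniq hF lH fP (tuple_homP w)) => j.
by rewrite fw tuple_homE.
Qed.

Definition automorphism_pair (psi psi' : F -> F) : Prop :=
  [/\ continuous psi /\ {morph psi : u v / u * v},
      continuous psi' /\ {morph psi' : u v / u * v},
      cancel psi psi' & cancel psi' psi].

Definition surface_move (w w' : tuple) : Prop :=
  exists psi psi' : F -> F, [/\ automorphism_pair psi psi',
    psi (surface_relation a b) = surface_relation a b &
    tuple_hom w \o psi = tuple_hom w'].

Lemma surface_move_sym w w' : surface_move w w' -> surface_move w' w.
Proof.
move=> [psi [psi' [[c c' k k'] r E]]]; exists psi', psi; split=> //.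
  by rewrite -[in LHS]r k.
by rewrite -E; apply/funext => u /=; rewrite k'.
Qed.

Lemma surface_move_trans w1 w2 w3 :
  surface_move w1 w2 -> surface_move w2 w3 -> surface_move w1 w3.
Proof.
move=> [p [p' [[[pc pM] [pc' pM'] pk pk'] pr E]]].
move=> [q [q' [[[qc qM] [qc' qM'] qk qk'] qr E']]].
exists (p \o q), (q' \o p'); split.
- split; [split|split|exact: can_comp|exact: can_comp].
  + by move=> u; apply: continuous_comp; [apply: qc | apply: pc].
  + by move=> u v /=; rewrite qM pM.
  + by move=> u; apply: continuous_comp; [apply: pc' | apply: qc'].
  + by move=> u v /=; rewrite pM' qM'.
- by rewrite /= qr pr.
- by rewrite -E' -E.
Qed.

(** A generating tuple v of F with the surface word of the basis defines an
automorphism that fixes the surface relation. *)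
Lemma surface_move_of_tuple (w w' : tuple) (v : 'I_n + 'I_n -> F) :
    (forall (P : finGroupType) (f : F -> P), l.-group [set: P]%SET ->
       finite_hom f ->
       forall j, f (gens j) \in (<<[set f (v k) | k : ('I_n + 'I_n)%type]>>)%SET) ->
    surface (v \o inl) (v \o inr) = surface a b ->
    (forall j, tuple_hom w (v j) = tuple_value w' j) ->
  surface_move w w'.
Proof.
move=> vgen vr vw.
have [psi [psi' [[c M] [c' M'] k k' psiv]]] := free_pro_automorphism l_prime hF vgen.
exists psi, psi'; split=> //.
  have psi1 : psi 1 = 1 by apply: (mulgI (psi 1)); rewrite -M !mulg1.
  have psiV u : psi u^-1 = (psi u)^-1.
    by apply: (mulgI (psi u)); rewrite -M !mulgV psi1.
  rewrite [RHS](_ : _ = surface a b) // -vr /surface_relation (big_morph psi M psi1).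
  apply: eq_bigr => i _; rewrite !commgEl !conjgE !M !psiV.
  by have /= -> := psiv (inl i); have /= -> := psiv (inr i).
apply: tuple_hom_uniq => [|j]; last by rewrite /= psiv.
have [fc fM] := tuple_homP w; split=> [u|u v0 /=]; last by rewrite M fM.
by apply: (@continuous_comp _ _ (discrete_topology H)); [apply: c | apply: fc].
Qed.

(** The identity [b^a, a^-1] = [a, b] exchanges the two sides of a handle. *)
Lemma surface_move_swap (w : tuple) :
  surface_move w [ffun i => ((w i).2 ^ (w i).1, (w i).1^-1)].
Proof.
pose v (j : 'I_n + 'I_n) : F := match j with inl i => b i ^ a i | inr i => (a i)^-1 end.
apply: (@surface_move_of_tuple w _ v) => [P f lP fP j||j].
- pose G := [group of <<[set f (v k) | k : ('I_n + 'I_n)%type]%SET>>].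
  suff: f (generators a b j) \in G by [].
  have vG k : f (v k) \in G by rewrite mem_gen // imset_f.
  have aG i : f (a i) \in G.
    by rewrite -groupV -(finite_homV fP); apply: (vG (inr i)).
  case: j => i //=; have := vG (inl i); rewrite /= conjgE !(finite_homM fP) (finite_homV fP).
  by rewrite groupMl ?groupV // groupMr.
- apply: eq_bigr => i _ /=.
  by rewrite /commg /conjg !invgM !invgK !mulgA mulgK mulgK.
have fw := tuple_homP w; have fE := tuple_homE w.
case: j => i /=; rewrite ffunE /=; last by rewrite (finite_homV fw) (fE (inl i)).
by rewrite !conjgE !(finite_homM fw) (finite_homV fw) (fE (inl i)) (fE (inr i)).
Qed.

End Moves.

Lemma surface_map (P Q : finGroupType) (h : P -> Q) n (c d : 'I_n -> P) :
  {morph h : u v / u * v} -> h (surface c d) = surface (h \o c) (h \o d).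
Proof.
move=> hM; have h1 : h 1 = 1 by apply: (mulgI (h 1)); rewrite -hM !mulg1.
have hV u : h u^-1 = (h u)^-1 by apply: (mulgI (h u)); rewrite -hM !mulgV.
rewrite /surface (big_morph h hM h1); apply: eq_bigr => i _ /=.
by rewrite !commgEl !conjgE !hM !hV.
Qed.

Section Handlebody.
Variables (l : nat) (F : topGroupType) (n : nat) (a b : 'I_n -> F).
Hypotheses (l_prime : prime l) (hF : free_pro_group l (generators a b)).
Variables (H : finGroupType) (lH : l.-group [set: H]%SET).

Local Notation gens := (generators a b).
Local Notation tuple := {ffun 'I_n -> H * H}.
Local Notation move := (surface_move hF lH).
Local Notation thom := (tuple_hom hF lH).

(** The problem of [surface_move_handlebody] in a finite quotient P of F: it is
[handlebody_lift] for the image Q of F in H * P and the projection Q -> H. *)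
Lemma finite_handlebody (w : tuple) (P : finGroupType) (f : F -> P) :
    generates (fun i => (w i).2) -> null_tuple w ->
    l.-group [set: P]%SET -> finite_hom f ->
  exists v : 'I_n + 'I_n -> F,
    [/\ forall j, thom [ffun i => (1, (w i).2)] (v j) = tuple_value w j,
        surface (fun i => f (v (inl i))) (fun i => f (v (inr i))) =
          surface (f \o a) (f \o b) &
        forall j, f (gens j) \in (<<[set f (v k) | k : ('I_n + 'I_n)%type]>>)%SET].
Proof.
move=> wgen wnull lP fP.
set w0 := [ffun i => _]; pose g u := (thom w0 u, f u).
have gP : finite_hom g := finite_hom_pair (tuple_homP hF lH w0) fP.
pose ga i := g (a i); pose gb i := g (b i).
pose Q := [group of tuple_gen ga gb].
have fstM : {in Q &, {morph (fst : H * P -> H) : u v / u * v}} by [].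
pose pi : {morphism Q >-> H} := Morphism fstM.
have gaE i : (ga i).1 = 1 by have := tuple_homE hF lH w0 (inl i); rewrite /= ffunE.
have gbE i : (gb i).1 = (w i).2 by have := tuple_homE hF lH w0 (inr i); rewrite /= ffunE.
have gaQ i : ga i \in Q by case: (mem_tuple_gen ga gb i).
have gbQ i : gb i \in Q by case: (mem_tuple_gen ga gb i).
pose T := [group of <<[set gb i | i : 'I_n]%SET>>].
have gbT i : gb i \in T by rewrite mem_gen // imset_f.
have sTQ : (T \subset Q)%SET by rewrite gen_subG; apply/subsetP=> _ /imsetP[i _ ->].
pose piT := restrm_morphism sTQ pi.
have piTT : (piT @* T)%g = [set: H]%SET.
  apply/eqP; rewrite eqEsubset subsetT /=.
  have /eqP <- := wgen; rewrite gen_subG; apply/subsetP=> _ /imsetP[i _ ->].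
  by apply/morphimP; exists (gb i) => //; rewrite /= /restrm gbE.
have x_ i : exists x, (x \in T) && (x.1 == (w i).1).
  have: (w i).1 \in (piT @* T)%g by rewrite piTT inE.
  by case/morphimP=> z _ zT ->; exists z; rewrite zT /=.
pose x i := xchoose (x_ i).
have xT i : x i \in T by case/andP: (xchooseP (x_ i)).
have xE i : (x i).1 = (w i).1 by case/andP: (xchooseP (x_ i)) => _ /eqP.
have lQ : l.-group Q by apply: pgroupS (subsetT _) (pgroup_prod lH lP).
have Eker : ('ker piT = 'ker_T pi)%g := ker_restrm sTQ pi.
have sxb : surface x gb \in [~: 'ker_T pi, T]%g.
  rewrite -Eker; apply: (@schur_universal H n (fun i => (w i).1) (fun i => (w i).2)
    _ T piT x gb) => //.
  exact/eqP.
have piTQ : (pi @* T = pi @* Q)%g.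
  apply/eqP; rewrite eqEsubset morphimS //=.
  apply/subsetP=> h _; have: h \in (piT @* T)%g by rewrite piTT inE.
  by case/morphimP=> z _ zT ->; apply: mem_morphim => //; apply: (subsetP sTQ).
have [a' [b' [Q' fa fb sab]]] :=
  @handlebody_lift _ _ Q pi l n ga gb x lQ erefl gaE piTQ xT sxb.
have Qg u : u \in Q -> exists v, g v == u.
  have grQ : group_set [set u : H * P | `[< exists v, g v = u >]]%SET.
    apply/group_setP; split=> [|c d]; rewrite !inE.
      by apply/asboolP; exists 1; apply: (finite_hom1 gP).
    move=> /asboolP[c' <-] /asboolP[d' <-]; apply/asboolP; exists (c' * d').
    exact: (finite_homM gP).
  suff /subsetP sub : (Q \subset Group grQ)%SET.
    by move=> /sub; rewrite inE => /asboolP[v <-]; exists v.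
  rewrite gen_subG subUset; apply/andP; split; apply/subsetP=> _ /imsetP[i _ ->];
    by rewrite inE; apply/asboolP; eexists.
have abQ' i : a' i \in Q /\ b' i \in Q by rewrite Q'; apply: mem_tuple_gen.
have va_ i : exists v, g v == a' i by apply: Qg; case: (abQ' i).
have vb_ i : exists v, g v == b' i by apply: Qg; case: (abQ' i).
have [v [va vb]] : exists v : 'I_n + 'I_n -> F,
    (forall i, g (v (inl i)) = a' i) /\ (forall i, g (v (inr i)) = b' i).
  exists (fun j => match j with inl i => xchoose (va_ i) | inr i => xchoose (vb_ i) end).
  by split=> i; apply/eqP; [exact: (xchooseP (va_ i)) | exact: (xchooseP (vb_ i))].
exists v; split=> [[i|i]||j].
- have /= -> := congr1 fst (va i); have /= -> := fa i; exact: xE.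
- have /= -> := congr1 fst (vb i); have /= -> := fb i; exact: gbE.
- have := congr1 snd sab; rewrite !(surface_map (h := snd)) // => Es; rewrite -[RHS]Es.
  by apply: eq_bigr => i _ /=; rewrite -va -vb.
- have gQ : g (gens j) \in Q by case: j => i; [apply: gaQ | apply: gbQ].
  have gG : g (gens j) \in (<<[set g (v k) | k : ('I_n + 'I_n)%type]>>)%SET.
    move: gQ; rewrite Q' /tuple_gen; apply: subsetP; rewrite genS //.
    rewrite subUset; apply/andP; split; apply/subsetP=> _ /imsetP[i _ ->].
      by rewrite -va; apply: imset_f.
    by rewrite -vb; apply: imset_f.
  exact: (@gen_imset_map _ _ (snd : H * P -> P) _ _ _ _ gG).
Qed.

(** The wanted automorphism is given by a tuple of F that solves the problem of
[finite_handlebody] in all finite quotients at once, which exists by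
[profinite_solve]. *)
Lemma surface_move_handlebody (w : tuple) :
  generates (fun i => (w i).2) -> null_tuple w ->
  move [ffun i => (1, (w i).2)] w.
Proof.
move=> wgen wnull; set w0 := [ffun i => _].
have f0P := tuple_homP hF lH w0; have [pF _] := hF.
pose C (P : finGroupType) (f : F -> P) : set ('I_n + 'I_n -> F) :=
  [set v | [/\ forall j, thom w0 (v j) = tuple_value w j,
    surface (fun i => f (v (inl i))) (fun i => f (v (inr i))) = surface (f \o a) (f \o b) &
    forall j, f (gens j) \in (<<[set f (v k) | k : ('I_n + 'I_n)%type]>>)%SET]].
have [P f lP fP|P f lP fP|P Q f g v|v vP] := @profinite_solve l F pF _ C.
- pose S : set (('I_n + 'I_n)%type -> H * P) := [set p | [/\ forall j, (p j).1 = tuple_value w j,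
    surface (fun i => (p (inl i)).2) (fun i => (p (inr i)).2) = surface (f \o a) (f \o b) &
    forall j, f (gens j) \in (<<[set (p k).2 | k : ('I_n + 'I_n)%type]>>)%SET]].
  exact: (finite_hom_tuple_closed (S := S) (finite_hom_pair f0P fP)).
- exact: finite_handlebody.
- move=> [vw sv gv]; split; split=> // [|j].
  + by have := congr1 fst sv; rewrite !(surface_map (h := fst)).
  + exact: (@gen_imset_map _ _ (fst : P * Q -> P) _ _ _ _ (gv j)).
  + by have := congr1 snd sv; rewrite !(surface_map (h := snd)).
  + exact: (@gen_imset_map _ _ (snd : P * Q -> Q) _ _ _ _ (gv j)).
apply: (@surface_move_of_tuple l F n a b l_prime hF H lH w0 w v) => [P f lP fP j||j].
- by have [_ _] := vP P f lP fP; apply.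
- apply: contrapT => /(pro_group_residual l_prime pF)[P [f [lP fP]]]; apply.
  rewrite !(finite_hom_surface fP).
  by have [_ -> _] := vP P f lP fP.
- by have [-> _ _] := vP H (thom w0) lH f0P.
Qed.

End Handlebody.

Lemma schur_cover_commute1 (H : finGroupType) (e : schur_cover H) :
  commute e (0%R, 1).
Proof.
have /(subsetP (schur_proj_central H))/centerP[_ zC] :
    ((0%R, 1) : schur_cover H) \in 'ker (schur_proj H) by rewrite schur_proj_ker.
by apply: commute_sym; apply: zC; rewrite inE.
Qed.

Section Connected.
Variables (l : nat) (F : topGroupType) (n : nat) (a b : 'I_n -> F).
Hypotheses (l_prime : prime l) (hF : free_pro_group l (generators a b)).
Variables (H : finGroupType) (lH : l.-group [set: H]%SET).

Local Notation move := (surface_move hF lH).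

Definition handlebody_tuple (y : 'I_n -> H) : {ffun 'I_n -> H * H} :=
  [ffun i => (1, y i)].

Lemma eq_handlebody_tuple y z : y =1 z -> handlebody_tuple y = handlebody_tuple z.
Proof. by move=> yz; apply/ffunP => i; rewrite !ffunE yz. Qed.

Lemma eq_generates (y z : 'I_n -> H) : y =1 z -> generates y = generates z.
Proof. by move=> yz; rewrite /generates (eq_imset _ yz). Qed.

Lemma generatesV (y : 'I_n -> H) : generates y -> generates (fun i => (y i)^-1).
Proof.
move=> /eqP gy; rewrite /generates -subTset -gy gen_subG.
apply/subsetP=> _ /imsetP[i _ ->]; rewrite -groupV mem_gen //.
by apply/imsetP; exists i.
Qed.

(** For a null tuple (x, y) with both x and y generating, exchanging the two sides
of the handles turns the handlebody tuple of y into that of x^-1. *)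
Lemma move_handlebody_swap (x y : 'I_n -> H) :
    generates x -> generates y -> null_tuple (fun i => (x i, y i)) ->
  move (handlebody_tuple y) (handlebody_tuple (fun i => (x i)^-1)).
Proof.
move=> gx gy nxy.
pose w : {ffun 'I_n -> H * H} := [ffun i => (x i, y i)].
have mw : move (handlebody_tuple y) w.
  have -> : handlebody_tuple y = [ffun i => (1, (w i).2)].
    by apply/ffunP => i; rewrite !ffunE.
  apply: (surface_move_handlebody l_prime).
    by rewrite (@eq_generates _ y) // => i; rewrite ffunE.
  by move: nxy; rewrite /null_tuple; under [in X in _ -> X]eq_bigr do rewrite ffunE.
have mw2 := surface_move_swap l_prime hF lH w.
apply: surface_move_trans mw (surface_move_trans mw2 _).
set w2 := [ffun i => _]; apply: surface_move_sym.
have -> : handlebody_tuple (fun i => (x i)^-1) = [ffun i => (1, (w2 i).2)].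
  by apply/ffunP => i; rewrite !ffunE.
apply: (surface_move_handlebody l_prime).
  by rewrite (@eq_generates _ (fun i => (x i)^-1)) ?generatesV // => i; rewrite !ffunE.
move: nxy; rewrite /null_tuple => /eqP nxy; apply/eqP; rewrite -[RHS]nxy.
apply: eq_bigr => i _; rewrite !ffunE /=.
pose sx : schur_cover H := (0%R, x i); pose sy : schur_cover H := (0%R, y i).
have := schur_comm (sy ^ sx) sx^-1; rewrite /= => <-.
by rewrite /handle_comm /commg /conjg !invgM !invgK !mulgA mulgK mulgK.
Qed.

(** In each case z_i^-1 and y_i have commuting lifts to the cover, so that the
tuple of the pairs (z_i^-1, y_i) is null. *)
Lemma move_change (y z : 'I_n -> H) : generates y -> generates z ->
    (forall i, [\/ z i = y i, y i = 1 | z i = 1]) ->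
  move (handlebody_tuple y) (handlebody_tuple z).
Proof.
move=> gy gz yz.
rewrite (@eq_handlebody_tuple z (fun i => ((z i)^-1)^-1)); last by move=> i; rewrite invgK.
apply: move_handlebody_swap => //; first exact: generatesV.
rewrite /null_tuple big1 // => i _; rewrite /handle_comm /=.
have c1 := @schur_cover_commute1 H.
have [->|->|->] := yz i.
- have /= := schur_comm ((0%R, y i) : schur_cover H)^-1 (0%R, y i).
  rewrite /handle_comm /= => <-; apply/eqP/commgP.
  by apply: commute_sym; apply: commuteV.
- by apply/eqP/commgP; apply: c1.
- by rewrite invg1; apply/eqP/commgP; apply: commute_sym; apply: c1.
Qed.

Lemma generates_sub (y t : 'I_n -> H) (D : {set 'I_n}) :
  generates y -> (forall i, exists2 j, j \in D & t j = y i) -> generates t.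
Proof.
move=> /eqP gy yt; rewrite /generates -subTset -gy gen_subG.
apply/subsetP=> _ /imsetP[i _ ->]; have [j _ <-] := yt i.
by rewrite mem_gen // imset_f.
Qed.

(** Each of y and z needs at most |H| indices to generate H; both are moved to one
generating tuple that is supported on the remaining ones. *)
Lemma move_generating (y z : 'I_n -> H) : (3 * #|H| <= n)%N ->
  generates y -> generates z -> move (handlebody_tuple y) (handlebody_tuple z).
Proof.
move=> n3; have H_gt0 : (0 < #|H|)%N by apply/card_gt0P; exists 1.
have i0 : 'I_n by exists 0%N; apply: leq_trans n3; rewrite muln_gt0.
have core (t : 'I_n -> H) : exists2 D : {set 'I_n}, (#|D| <= #|H|)%N &
    forall i, exists2 j, j \in D & t j = t i.
  pose pk h := odflt i0 [pick j | t j == h].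
  exists [set pk h | h : H]%SET; first exact: leq_imset_card.
  move=> i; exists (pk (t i)); first exact: imset_f.
  rewrite /pk; case: pickP => [j /eqP //|/(_ i)]; by rewrite eqxx.
move=> gy gz; have [D D_le yD] := core y; have [D' D'_le zD'] := core z.
pose C := (~: (D :|: D'))%SET.
have C_ge : (#|H| <= #|C|)%N.
  have := cardsC (D :|: D'); rewrite card_ord -/C => EC.
  have leU : (#|(D :|: D')%SET| <= #|D| + #|D'|)%N := leq_card_setU D D'.
  move: leU EC n3 D_le D'_le.
  move: #|(D :|: D')%SET| #|C| #|D| #|D'| #|H|; lia.
pose t i := if i \in C then nth 1 (enum H) (index i (enum C)) else 1.
have tC h : exists2 i, i \in C & t i = h.
  have hlt : (index h (enum H) < size (enum C))%N.
    rewrite -cardE; apply: leq_trans C_ge; rewrite cardE index_mem.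
    by rewrite mem_enum.
  have iC : nth i0 (enum C) (index h (enum H)) \in C by rewrite -mem_enum mem_nth.
  exists (nth i0 (enum C) (index h (enum H))) => //.
  by rewrite /t iC index_uniq ?enum_uniq // nth_index // mem_enum.
have gt : generates t.
  rewrite /generates -subTset; apply/subsetP=> h _; have [i _ <-] := tC h.
  by rewrite mem_gen // imset_f.
have to_t (u : 'I_n -> H) (B : {set 'I_n}) : generates u ->
    (forall i, i \in B -> i \notin C) ->
    (forall i, exists2 j, j \in B & u j = u i) ->
    move (handlebody_tuple u) (handlebody_tuple t).
  move=> gu CB uB.
  (* Discard the values of u outside B, fill in those of t, and only then discard
     the values on B. *)
  pose u1 i := if i \in B then u i else 1.
  pose u2 i := if i \in B then u i else t i.
  have gu1 : generates u1.
    apply: (generates_sub gu (D := B)) => i; have [j jB <-] := uB i.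
    by exists j; rewrite // /u1 jB.
  have gu2 : generates u2.
    apply: (generates_sub gu (D := B)) => i; have [j jB <-] := uB i.
    by exists j; rewrite // /u2 jB.
  apply: surface_move_trans (move_change gu gu1 _) _.
    by move=> i; rewrite /u1; case: ifP => _; [apply: Or31 | apply: Or33].
  apply: surface_move_trans (move_change gu1 gu2 _) (move_change gu2 gt _).
    by move=> i; rewrite /u1 /u2; case: ifP => _; [apply: Or31 | apply: Or32].
  move=> i; rewrite /u2; case: ifP => iB; last by apply: Or31.
  by apply: Or33; rewrite /t (negPf (CB i iB)).
apply: surface_move_trans (to_t y D gy _ yD) _.
  by move=> i iD; rewrite !inE iD.
apply: surface_move_sym; apply: (to_t z D' gz _ zD').
by move=> i iD; rewrite !inE iD orbT.
Qed.

End Connected.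

(** * The automorphisms of the Schur covering and their orbits *)

Section Descent.
Variables (G : topGroupType) (S : set G) (P : finGroupType).

Lemma finite_hom_closure (f : G -> P) : finite_hom f ->
  (forall s, S s -> f s = 1) -> forall u, closed_normal_closure S u -> f u = 1.
Proof.
move=> fP fS u /(_ [set v | f v = 1]); apply; split.
- exact: (@finite_hom_closed _ _ _ fP [set 1]).
- split=> /= [|x y fx fy|x fx|x g fx].
  + exact: finite_hom1.
  + by rewrite (finite_homM fP) fx fy mulg1.
  + by rewrite (finite_homV fP) fx invg1.
  + by rewrite conjgE !(finite_homM fP) (finite_homV fP) fx mul1g mulVg.
- exact: fS.
Qed.

Lemma finite_hom_tquot (g : tquotient S -> P) :
  finite_hom g -> finite_hom (g \o tquot S).
Proof.
move=> [gc gM]; split=> [x|x y /=]; last by rewrite tquotM gM.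
by apply: (@continuous_comp _ _ (discrete_topology P)); [exact: tquot_continuous | apply: gc].
Qed.

Lemma tquot_ext T (f g : tquotient S -> T) : f \o tquot S = g \o tquot S -> f = g.
Proof.
move=> fg; apply/funext => p; rewrite -(tquotK p).
exact: (congr1 (fun h => h _) fg).
Qed.

Definition descend (f : G -> P) (p : tquotient S) : P := f (generic_quotient.repr p).

Lemma descendE (f : G -> P) u : finite_hom f -> (forall s, S s -> f s = 1) ->
  descend f (tquot S u) = f u.
Proof.
move=> fP fS; have /tquotP : tquot S u = tquot S (generic_quotient.repr (tquot S u)).
  by rewrite tquotK.
move=> /(finite_hom_closure fP fS); rewrite (finite_homM fP) (finite_homV fP).
by rewrite /descend => E; apply: (mulgI (f u)^-1); rewrite E mulVg.
Qed.

Lemma descend_hom (f : G -> P) : finite_hom f -> (forall s, S s -> f s = 1) ->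
  finite_hom (descend f).
Proof.
move=> fP fS; have fE u := descendE u fP fS.
split=> [|p q]; last first.
  by rewrite -(tquotK p) -(tquotK q) -tquotM !fE (finite_homM fP).
apply: continuous_locally_constant => p; rewrite -(tquotK p) fE.
set u := generic_quotient.repr p.
have oU : open (tquot S @` (f @^-1` [set f u])).
  by apply: tquot_open; apply: finite_hom_open.
have : nbhs (tquot S u) (tquot S @` (f @^-1` [set f u])).
  by apply: open_nbhs_nbhs; split=> //; exists u.
by apply: filterS => _ [v fv <-] /=; rewrite fE.
Qed.

End Descent.

Section AutomorphismDescent.
Variables (F : topGroupType) (n : nat) (a b : 'I_n -> F).
Local Notation r := (surface_relation a b).
Local Notation Rel := (relations a b).
Local Notation commR := [set [~ s, f] | s in Rel & f in [set: F]].
Local Notation G := (schur_covering a b).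
Local Notation q := (tquot commR : F -> G).

Lemma relations_central u v : Rel u -> q u * q v = q v * q u.
Proof.
move=> Ru; have : q [~ u, v] = 1.
  by apply/tquot_eq1; apply: sub_closed_normal_closure; exists u => //; exists v.
rewrite commgEl conjgE !tquotM !tquotV => /(canRL (mulKVg _)).
rewrite mulg1 => /(canRL (mulKVg _)) -> //.
Qed.

Section Endomorphism.
Variables (psi : F -> F).
Hypotheses (psic : continuous psi) (psiM : {morph psi : u v / u * v}) (psir : psi r = r).

Let psi1 : psi 1 = 1. Proof. by apply: (mulgI (psi 1)); rewrite -psiM !mulg1. Qed.
Let psiV u : psi u^-1 = (psi u)^-1.
Proof. by apply: (mulgI (psi u)); rewrite -psiM !mulgV psi1. Qed.
Let psiJ u v : psi (u ^ v) = psi u ^ psi v.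
Proof. by rewrite !conjgE !psiM psiV. Qed.

Lemma preimage_closed_normal (N : set F) : closed N -> normal_subgroup N ->
  closed (psi @^-1` N) /\ normal_subgroup (psi @^-1` N).
Proof.
move=> Ncl [N1 NM NV NJ]; split.
  by apply: preimage_closed => // u _; apply: psic.
split=> /= [|u v|u|u g].
- by rewrite psi1.
- by rewrite psiM; apply: NM.
- by rewrite psiV; apply: NV.
- by rewrite psiJ; apply: NJ.
Qed.

Lemma endo_relations u : Rel u -> Rel (psi u).
Proof.
have [cl nm] := preimage_closed_normal (@closed_normal_closure_closed _ _)
  (closed_normal_closure_normal [set r]).
move=> /(_ (psi @^-1` Rel)); apply; split=> // _ -> /=; rewrite psir.
by apply: sub_closed_normal_closure.
Qed.

Lemma endo_descends u v : q u = q v -> q (psi u) = q (psi v).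
Proof.
have [cl nm] := preimage_closed_normal (@closed_normal_closure_closed _ _)
  (closed_normal_closure_normal commR).
move=> /tquotP /(_ (psi @^-1` closed_normal_closure commR)) Nuv; apply/tquotP.
have /= := Nuv; rewrite psiM psiV; apply; split=> // _ [s Rs [f _ <-]] /=.
apply: sub_closed_normal_closure; exists (psi s); first exact: endo_relations.
by exists (psi f) => //; rewrite !commgEl psiM psiV psiJ.
Qed.

Definition endo_quot (g : G) : G := q (psi (generic_quotient.repr g)).

Lemma endo_quotE u : endo_quot (q u) = q (psi u).
Proof. by apply: endo_descends; rewrite tquotK. Qed.

Lemma endo_quotM : {morph endo_quot : g h / g * h}.
Proof.
move=> g h; rewrite -(tquotK g) -(tquotK h).
by rewrite -tquotM !endo_quotE psiM tquotM.
Qed.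

Lemma endo_quot_continuous : continuous endo_quot.
Proof.
apply/(quotient_continuous endo_quot) => u.
apply: (@cvg_trans _ ((q \o psi) @ u)).
  by apply: near_eq_cvg; apply: nearW => v; rewrite /= -endo_quotE.
suff : (q \o psi) @ u --> endo_quot (q u) by [].
rewrite endo_quotE.
by apply: continuous_comp; [exact: psic | exact: tquot_continuous].
Qed.

(** The relations u with q (psi u) = q u form a closed normal subgroup, by
centrality of relations in the covering, and r is one of them. *)
Lemma endo_quot_ker g : schur_ker a b g -> endo_quot g = g.
Proof.
rewrite schur_kerE => -[u Ru <-]; rewrite endo_quotE.
pose M := [set u | Rel u /\ q (psi u) = q u].
suff : M u by case.
have [Rcl [R1 RM RV RJ]] := conj (@closed_normal_closure_closed _ [set r])
  (closed_normal_closure_normal [set r]).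
apply: Ru; split.
- have -> : M = Rel `&` ((fun u => u^-1 * psi u) @^-1` closed_normal_closure commR).
    apply/seteqP; split=> v [Rv Ev]; split=> //; first by apply/tquotP.
    by apply/esym/tquotP.
  apply: closedI => //; apply: preimage_closed; last exact: closed_normal_closure_closed.
  move=> v _; apply: (@continuous_comp _ _ _ (fun v => (v^-1, psi v)) (fun z => z.1 * z.2)).
    by apply: cvg_pair; [exact: invg_continuous | exact: psic].
  exact: mulg_continuous.
- split=> /= [|v w [Rv Ev] [Rw Ew]|v [Rv Ev]|v g0 [Rv Ev]].
  + by split; [exact: R1 | rewrite psi1].
  + by split; [exact: RM | rewrite psiM !tquotM Ev Ew].
  + by split; [exact: RV | rewrite psiV !tquotV Ev].
  + split; first exact: RJ.
    rewrite psiJ !conjgE !tquotM !tquotV Ev.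
    by rewrite !(relations_central _ Rv) !mulKg.
- move=> _ ->; split; first exact: sub_closed_normal_closure.
  by rewrite psir.
Qed.

End Endomorphism.

(** Automorphisms of F that fix r lie in the group over which phi is averaged. *)
Lemma automorphism_descends (psi psi' : F -> F) : automorphism_pair psi psi' ->
  psi r = r -> exists phi : ker_aut (schur_ker a b), forall u, phi (q u) = q (psi u).
Proof.
move=> [[c M] [c' M'] k k'] rr.
have rr' : psi' r = r by rewrite -{1}rr k.
have isK : is_ker_aut (schur_ker a b) (endo_quot psi).
  split; [exact: endo_quotM | exact: endo_quot_continuous | |exact: endo_quot_ker].
  exists (endo_quot psi'); split; first exact: endo_quot_continuous.
    by move=> g; rewrite -(tquotK g) !endo_quotE // k.
  by move=> g; rewrite -(tquotK g) !endo_quotE // k'.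
exists (exist _ (endo_quot psi) (mem_set isK)) => u.
exact: endo_quotE.
Qed.

End AutomorphismDescent.

Section Action.
Variables (F : topGroupType) (n : nat) (a b : 'I_n -> F).
Local Notation r := (surface_relation a b).
Local Notation Rel := (relations a b).
Local Notation commR := [set [~ s, f] | s in Rel & f in [set: F]].
Local Notation G := (schur_covering a b).
Local Notation q := (tquot commR : F -> G).
Local Notation A := (ker_aut (schur_ker a b)).

Lemma ker_autP (phi : A) : is_ker_aut (schur_ker a b) phi.
Proof. exact: (set_mem (valP phi)). Qed.

Lemma ker_autM (phi : A) : {morph phi : g h / g * h}.
Proof. by case: (ker_autP phi). Qed.

Lemma ker_aut_cont (phi : A) : continuous (phi : G -> G).
Proof. by case: (ker_autP phi). Qed.

Lemma ker_aut_relation (phi : A) : phi (q r) = q r.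
Proof.
have [_ _ _] := ker_autP phi; apply; rewrite schur_kerE; exists r => //.
exact: sub_closed_normal_closure.
Qed.

Lemma ker_aut_mulE (phi psi : A) g : (phi * psi : A) g = phi (psi g).
Proof. by []. Qed.

Lemma ker_autK (phi : A) g : phi ((phi^-1 : A) g) = g.
Proof. by rewrite -ker_aut_mulE mulgV. Qed.

Section Homs.
Variables (P : finGroupType) (f : F -> P).
Hypotheses (fP : finite_hom f) (fr : f r = 1).

Lemma relation_kills s : commR s -> f s = 1.
Proof.
move=> [u Ru [v _ <-]]; rewrite (finite_homR fP).
have -> : f u = 1 by apply: (finite_hom_closure fP _ Ru) => _ ->.
by rewrite comm1g.
Qed.

Definition cover_hom : G -> P := descend f.

Lemma cover_homE u : cover_hom (q u) = f u.
Proof. exact: (descendE _ fP relation_kills). Qed.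

Lemma cover_hom_finite : finite_hom cover_hom.
Proof. exact: (descend_hom fP relation_kills). Qed.

Definition act_hom (phi : A) : F -> P := cover_hom \o phi \o q.

Lemma cover_hom_ker_aut (phi : A) : finite_hom (cover_hom \o phi).
Proof.
have [gc gM] := cover_hom_finite; split=> [g|g h /=]; last by rewrite ker_autM gM.
by apply: (@continuous_comp _ _ (discrete_topology P)); [apply: ker_aut_cont | apply: gc].
Qed.

Lemma act_hom_finite phi : finite_hom (act_hom phi).
Proof. exact: (finite_hom_tquot (cover_hom_ker_aut phi)). Qed.

Lemma act_hom_relation phi : act_hom phi r = 1.
Proof. by rewrite /act_hom /= ker_aut_relation cover_homE. Qed.

End Homs.

Variables (l : nat) (l_prime : prime l) (hF : free_pro_group l (generators a b)).
Variables (H : finGroupType) (lH : l.-group [set: H]%SET).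
Local Notation tuple := {ffun 'I_n -> H * H}.
Local Notation thom := (tuple_hom hF lH).

Definition closed_tuple (w : tuple) : Prop := thom w r = 1.

Definition act (w : tuple) (phi : A) : tuple :=
  [ffun i => (act_hom (thom w) phi (a i), act_hom (thom w) phi (b i))].

Lemma thom_act w phi : closed_tuple w -> thom (act w phi) = act_hom (thom w) phi.
Proof.
move=> wr; apply/esym/tuple_hom_uniq => [|[i|i]]; last 2 first.
- by rewrite /= ffunE.
- by rewrite /= ffunE.
exact: act_hom_finite (tuple_homP hF lH w) wr phi.
Qed.

Lemma closed_act w phi : closed_tuple w -> closed_tuple (act w phi).
Proof.
move=> wr; rewrite /closed_tuple thom_act //.
exact: act_hom_relation (tuple_homP hF lH w) wr phi.
Qed.

Lemma cover_hom_act w phi : closed_tuple w ->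
  cover_hom (thom (act w phi)) = cover_hom (thom w) \o phi.
Proof.
move=> wr; apply: tquot_ext; apply/funext => u.
rewrite /= (cover_homE (tuple_homP hF lH _) (closed_act phi wr)).
by rewrite thom_act.
Qed.

Lemma actM w phi psi : closed_tuple w -> act w (phi * psi) = act (act w phi) psi.
Proof.
move=> wr; apply/ffunP => i; rewrite !ffunE.
by rewrite /act_hom (cover_hom_act phi wr).
Qed.

Lemma act1 w : closed_tuple w -> act w 1 = w.
Proof.
move=> wr; apply/ffunP => i; rewrite ffunE /act_hom /=.
rewrite !(cover_homE (tuple_homP hF lH w) wr).
have := tuple_homE hF lH w (inl i); have := tuple_homE hF lH w (inr i) => /= -> ->.
by case: (w i).
Qed.

Lemma surface_move_act (w w' : tuple) : closed_tuple w ->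
  surface_move hF lH w w' -> exists phi : A, act w phi = w'.
Proof.
move=> wr [psi [psi' [auto psir E]]].
have [phi phiE] := automorphism_descends auto psir; exists phi.
apply/ffunP => i; rewrite ffunE /act_hom /= !phiE.
rewrite !(cover_homE (tuple_homP hF lH w) wr).
have := congr1 (fun h => h (a i)) E; have := congr1 (fun h => h (b i)) E => /= -> ->.
have := tuple_homE hF lH w' (inl i); have := tuple_homE hF lH w' (inr i) => /= -> ->.
by case: (w' i).
Qed.

(** The lift of a null tuple to the Schur cover of H extends to the covering,
where every automorphism in question fixes the surface relation; hence the
automorphisms preserve null tuples. *)
Lemma null_tuple_lift (w : tuple) : null_tuple w -> exists f : F -> schur_cover H,
  [/\ finite_hom f, f r = 1 & (@snd _ _ : schur_cover H -> H) \o f = thom w].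
Proof.
move=> /eqP nw.
have [f fP fE] := free_pro_ext hF
  (fun j => (0%R, tuple_value w j) : schur_cover H) (schur_cover_pgroup lH).
exists f; split=> //.
  rewrite -[LHS]/(f (surface a b)) (finite_hom_surface fP) -[RHS]nw.
  by apply: eq_bigr => i _; rewrite /= (fE (inl i)) (fE (inr i)).
apply: tuple_hom_uniq; first exact: (finite_hom_comp fP).
by move=> j; rewrite /= fE.
Qed.

Lemma null_tuple_closed (w : tuple) : null_tuple w -> closed_tuple w.
Proof. by case/null_tuple_lift=> f [_ fr E]; rewrite /closed_tuple -E /= fr. Qed.

Lemma null_tuple_act (w : tuple) phi : null_tuple w -> null_tuple (act w phi).
Proof.
move=> nw; have wr := null_tuple_closed nw.
have [f [fP fr E]] := null_tuple_lift nw.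
have fphi u : (act_hom f phi u).2 = act_hom (thom w) phi u.
  rewrite /act_hom /=; have [v <-] : exists v, q v = phi (q u).
    by exists (generic_quotient.repr (phi (q u))); rewrite tquotK.
  by rewrite (cover_homE fP fr) (cover_homE (tuple_homP hF lH w) wr) -E.
have := act_hom_relation fP fr phi.
rewrite -[r]/(surface a b) (finite_hom_surface (act_hom_finite fP fr phi)).
move=> E1; apply/eqP; rewrite -[RHS]E1; apply: eq_bigr => i _.
by rewrite ffunE schur_comm /= !fphi.
Qed.

End Action.

Section OrbitMeasure.
Variables (F : topGroupType) (n : nat) (a b : 'I_n -> F).
Local Notation r := (surface_relation a b).
Local Notation commR := [set [~ s, f] | s in relations a b & f in [set: F]].
Local Notation G := (schur_covering a b).
Local Notation q := (tquot commR : F -> G).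
Local Notation A := (ker_aut (schur_ker a b)).

(** The compact-open topology is finer than pointwise convergence. *)
Lemma evaluation_open (g : G) (B : set G) : open B ->
  open ([set phi | B ((phi : A) g)] : set A).
Proof.
move=> oB; pose W : set {compact-open, G -> G} := [set h | h @` [set g] `<=` B].
have oW : open W by apply: compact_open_open => //; exact: compact_set1.
have -> : [set phi : A | B (phi g)] = set_val @^-1` W.
  apply/seteqP; split=> phi /=; last by apply; exists g.
  by move=> Bg _ [_ -> <-].
by apply: open_comp => // phi _; exact: initial_continuous.
Qed.

Variables (l : nat) (l_prime : prime l) (hF : free_pro_group l (generators a b)).
Variables (H : finGroupType) (lH : l.-group [set: H]%SET).
Local Notation tuple := {ffun 'I_n -> H * H}.
Local Notation thom := (tuple_hom hF lH).
Local Notation act := (act hF lH).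
Local Notation closed_tuple := (closed_tuple hF lH).

Definition transporter (w w' : tuple) : set A := [set phi | act w phi = w'].

(** [act w phi] depends on the values of phi at the 2n generators only, through
a continuous map to a finite set. *)
Lemma transporter_open w w' : closed_tuple w -> open (transporter w w').
Proof.
move=> wr; have fP := cover_hom_finite (tuple_homP hF lH w) wr.
rewrite openE => phi /= <-; rewrite /interior.
have near1 (u : F) : nbhs phi [set psi : A | act_hom (thom w) psi u = act_hom (thom w) phi u].
  apply: open_nbhs_nbhs; split=> //.
  apply: (@evaluation_open (q u) (cover_hom (thom w) @^-1` [set act_hom (thom w) phi u])).
  exact: finite_hom_open.
have near_i (i : 'I_n) : nbhs phi [set psi : A |
    act_hom (thom w) psi (a i) = act_hom (thom w) phi (a i) /\
    act_hom (thom w) psi (b i) = act_hom (thom w) phi (b i)].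
  by apply: (@filterI A (nbhs phi) (nbhs_filter phi)); apply: near1.
have near_all := @filter_forall A 'I_n _ (nbhs phi) (nbhs_filter phi) near_i.
apply: (@filterS A (nbhs phi) (nbhs_filter phi)) near_all => psi E /=.
apply/ffunP => i; rewrite !ffunE.
by have [-> ->] := E i.
Qed.

Variables (R : realType) (mu : probability (borel A) R) (haar : haar_probability mu).

Lemma transporter_measurable w w' : closed_tuple w ->
  measurable (transporter w w' : set (borel A)).
Proof. by move=> wr; apply: sub_gen_smallest; apply: transporter_open. Qed.

Lemma integral_sum_indic (S : finType) (Q : pred S) (T : S -> set (borel A)) :
    (forall s, Q s -> measurable (T s)) ->
  (\int[mu]_phi (\sum_(s | Q s) (\1_(T s) phi)%:E) = \sum_(s | Q s) mu (T s))%E.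
Proof.
move=> mT; pose T' s := if Q s then T s else (classical_sets.set0 : set (borel A)).
have mT' s : measurable (T' s) by rewrite /T'; case: ifP => // /mT.
transitivity (\int[mu]_phi (\sum_(s <- index_enum S) (\1_(T' s) phi)%:E))%E.
  apply: eq_integral => phi _; rewrite big_mkcond; apply: eq_bigr => s _.
  by rewrite /T'; case: ifP => // _; rewrite indic0.
rewrite ge0_integral_sum //.
- rewrite [RHS]big_mkcond; apply: eq_bigr => s _.
  by rewrite integral_indic // classical_sets.setIT /T'; case: ifP => // _; rewrite measure0.
- by move=> s; apply/measurable_realfun.measurable_EFinP;
  exact: measurable_realfun.measurable_indic.
Qed.

Definition orbit (w : tuple) : {set tuple} := [set w' | `[< exists phi, act w phi = w' >]]%SET.

Lemma orbitP w w' : reflect (exists phi, act w phi = w') (w' \in orbit w).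
Proof. by rewrite inE; apply: asboolP. Qed.

(** Left invariance makes mu (transporter w w') independent of w in the orbit,
and the transporters to a fixed w' partition the group. *)
Lemma transporter_measure (w0 w w' : tuple) : closed_tuple w0 ->
    w \in orbit w0 -> w' \in orbit w0 ->
  mu (transporter w w') = (#|orbit w0|%:R^-1)%:E.
Proof.
move=> cw0 /orbitP[g gw] /orbitP[g' gw'].
have invar v : v \in orbit w0 -> mu (transporter v w') = mu (transporter w0 w').
  move=> /orbitP[h <-]; rewrite -(haar h (transporter_measurable w' cw0)).
  congr (mu _); apply/seteqP; split=> phi /=; rewrite /transporter /= actM //.
have closed_orbit v : v \in orbit w0 -> closed_tuple v.
  by case/orbitP=> h <-; apply: closed_act.
have total : (\sum_(v | v \in orbit w0) mu (transporter v w') = 1)%E.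
  rewrite -integral_sum_indic; last first.
    by move=> v /closed_orbit; apply: transporter_measurable.
  rewrite -(@probability_setT _ _ _ mu) -[RHS]mul1e -integral_cst //.
  apply: eq_integral => phi _.
  have w'c : closed_tuple w' by rewrite -gw'; apply: closed_act.
  have vO : act w' phi^-1 \in orbit w0.
    by apply/orbitP; exists (g' * phi^-1); rewrite actM // gw'.
  rewrite (bigD1 (act w' phi^-1)) //= big1 ?adde0 => [|v /andP[vO' neq]].
    by rewrite indicE mem_set //= /transporter /= -actM // mulVg act1.
  rewrite indicE memNset // => E; case/eqP: neq.
  by rewrite -E -actM ?mulgV ?act1 //; apply: closed_orbit.
have O_gt0 : (0 < #|orbit w0|)%N by apply/card_gt0P; exists w; apply/orbitP; exists g.
rewrite (invar w); last by apply/orbitP; exists g.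
move: total; rewrite (eq_bigr (fun=> mu (transporter w0 w'))) => [|v /invar //].
have mtw : measurable (transporter w0 w' : set (borel A)) by apply: transporter_measurable.
rewrite -(fineK (fin_num_measure mu _ mtw)).
rewrite sumEFin sumr_const => -[E]; congr (_%:E).
by apply: (mulIf (_ : #|orbit w0|%:R != 0 :> R)%R); rewrite ?mulVf ?pnatr_eq0 -?lt0n // mulr_natr.
Qed.

End OrbitMeasure.

(** * Counting surjections *)

Lemma generating_surjective (I : finType) (H : finGroupType) (F : topGroupType)
    (f : F -> H) (y : I -> H) : finite_hom f ->
  <<[set y i | i : I]>>%SET = [set: H]%SET -> (forall i, exists u, f u = y i) ->
  range f = classical_sets.setT.
Proof.
move=> fP gy fy.
have grD : group_set [set h : H | `[< exists u, f u = h >]]%SET.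
  apply/group_setP; split=> [|c d]; rewrite !inE.
    by apply/asboolP; exists 1; apply: (finite_hom1 fP).
  move=> /asboolP[c' <-] /asboolP[d' <-]; apply/asboolP; exists (c' * d').
  exact: (finite_homM fP).
apply/seteqP; split=> // h _.
have : h \in Group grD.
  suff /subsetP : ([set: H]%SET \subset Group grD)%SET by apply; rewrite inE.
  rewrite -gy gen_subG; apply/subsetP=> _ /imsetP[i _ ->].
  by rewrite inE; apply/asboolP.
by rewrite inE => /asboolP[u <-]; exists u.
Qed.

Section Counting.
Variables (F : topGroupType) (n : nat) (a b : 'I_n -> F).
Local Notation r := (surface_relation a b).
Local Notation commR := [set [~ s, f] | s in relations a b & f in [set: F]].
Local Notation G := (schur_covering a b).
Local Notation q := (tquot commR : F -> G).
Local Notation A := (ker_aut (schur_ker a b)).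
Variables (l : nat) (hF : free_pro_group l (generators a b)).
Variables (H : finGroupType) (lH : l.-group [set: H]%SET).
Local Notation tuple := {ffun 'I_n -> H * H}.
Local Notation thom := (tuple_hom hF lH).
Local Notation act := (act hF lH).
Local Notation closed_tuple := (closed_tuple hF lH).

Definition generating_tuples : {set {ffun 'I_n -> H}} :=
  [set y : {ffun 'I_n -> H} | generates y]%SET.

(** The surjections of the handlebody group onto H: the tuples that are trivial on
a_1, ..., a_n and generating on b_1, ..., b_n. *)
Definition handlebody_tuples : {set tuple} :=
  [set handlebody_tuple y | y : {ffun 'I_n -> H} in generating_tuples]%SET.

Lemma card_handlebody_tuples : #|handlebody_tuples| = #|generating_tuples|.
Proof.
apply: card_imset => y z /ffunP E; apply/ffunP => i.
by have := E i; rewrite !ffunE => -[].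
Qed.

Lemma handlebody_tuplesP (w : tuple) :
  reflect ((forall i, (w i).1 = 1) /\ generates (fun i => (w i).2)) (w \in handlebody_tuples).
Proof.
apply: (iffP imsetP) => [[y]|[w1 w2]].
  rewrite inE => gy ->; split=> [i|]; first by rewrite ffunE.
  by rewrite (@eq_generates _ _ _ y) // => i; rewrite ffunE.
exists [ffun i => (w i).2].
  by rewrite inE (@eq_generates _ _ _ (fun i => (w i).2)) // => i; rewrite ffunE.
by apply/ffunP => i; rewrite !ffunE -(w1 i); case: (w i).
Qed.

Lemma handlebody_null (w : tuple) : w \in handlebody_tuples -> null_tuple w.
Proof.
move=> /handlebody_tuplesP[w1 _]; rewrite /null_tuple big1 // => i _.
rewrite /handle_comm w1; apply/eqP/commgP; apply: commute_sym.
exact: schur_cover_commute1.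
Qed.

Lemma handlebody_closed (w : tuple) : w \in handlebody_tuples -> closed_tuple w.
Proof. by move=> /handlebody_null; apply: null_tuple_closed. Qed.

Lemma thom_a (w : tuple) i : thom w (a i) = (w i).1.
Proof. exact: (tuple_homE hF lH w (inl i)). Qed.

Lemma thom_b (w : tuple) i : thom w (b i) = (w i).2.
Proof. exact: (tuple_homE hF lH w (inr i)). Qed.

Lemma surjective_generates (w : tuple) : (forall i, (w i).1 = 1) ->
  range (thom w) = classical_sets.setT -> generates (fun i => (w i).2).
Proof.
move=> w1 sw; rewrite /generates -subTset; apply/subsetP=> h _.
have [u _ <-] : range (thom w) h by rewrite sw.
have := free_pro_gen hF u lH (tuple_homP hF lH w).
apply: subsetP; rewrite gen_subG; apply/subsetP=> _ /imsetP[[i|i] _ ->].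
  by rewrite [X in X \in _]thom_a w1 group1.
by rewrite [X in X \in _]thom_b mem_gen //; apply/imsetP; exists i.
Qed.

Lemma handlebody_surjective (w : tuple) : w \in handlebody_tuples ->
  range (thom w) = classical_sets.setT.
Proof.
move=> /handlebody_tuplesP[_ /eqP gw].
apply: (generating_surjective (tuple_homP hF lH w) gw) => i.
by exists (b i); rewrite thom_b.
Qed.

Variable phi : A.
Local Notation S := (range (schur_gen a b) `|` range (phi \o schur_gen a b)).

(** A homomorphism from the glued group is one from the covering that kills the
a_i and the phi (a_i); it has the same image as its composite with phi. *)
Lemma counting_Sur (R : realType) :
  counting (Sur (Zgroup phi) H) =
  (#|[set w in handlebody_tuples | act w phi \in handlebody_tuples]%SET|%:R%R : R)%:E.
Proof.
pose f (w : tuple) : Zgroup phi -> H := descend (S := S) (cover_hom (thom w)).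
have thomP w := tuple_homP hF lH w.
have kills w : w \in handlebody_tuples -> act w phi \in handlebody_tuples ->
    forall s, S s -> cover_hom (thom w) s = 1.
  move=> wS; have cw := handlebody_closed wS.
  case/handlebody_tuplesP: (wS) => w1 _ /handlebody_tuplesP[w1' _].
  move=> _ [[i _ <-]|[i _ <-]]; first by rewrite (cover_homE (thomP w) cw) thom_a.
  by have := w1' i; rewrite ffunE.
have fE w u : w \in handlebody_tuples -> act w phi \in handlebody_tuples ->
    f w (tquot S (q u)) = thom w u.
  move=> wS wS'; have cw := handlebody_closed wS.
  rewrite /f (descendE _ (cover_hom_finite (thomP w) cw) (kills w wS wS')).
  exact: cover_homE.
rewrite -(@counting_image R _ _ _ f) => [|w v]; last first.
  rewrite !inE => /andP[wS wS'] /andP[vS vS'] E.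
  have Ew u : thom w u = thom v u by rewrite -!fE // E.
  apply/ffunP => i; have := Ew (a i); have := Ew (b i); rewrite !thom_a !thom_b.
  by case: (w i) (v i) => ? ? [? ?] /= -> ->.
congr counting; apply/seteqP; split=> [g [gM gc gs]|_ [w + <-]]; last first.
  rewrite /= inE => /andP[wS wS']; have cw := handlebody_closed wS.
  have [fc fM] := descend_hom (cover_hom_finite (thomP w) cw) (kills w wS wS').
  split=> //; apply/seteqP; split=> // h _.
  have [u _ <-] : range (thom w) h by rewrite handlebody_surjective.
  by exists (tquot S (q u)) => //; apply: fE.
have gP : finite_hom g by split.
have gqP := finite_hom_tquot gP; have gqqP := finite_hom_tquot gqP.
pose w : tuple := [ffun i => (g (tquot S (q (a i))), g (tquot S (q (b i))))].
have Ew : thom w = g \o tquot S \o q.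
  apply/esym/tuple_hom_uniq => [|[i|i]] //=; by rewrite ffunE.
have g1 s : S s -> g (tquot S s) = 1.
  move=> Ss; have -> : tquot S s = 1 by apply/tquot_eq1; apply: sub_closed_normal_closure.
  exact: (finite_hom1 gP).
have w1 i : (w i).1 = 1 by rewrite ffunE; apply: g1; left; exists i.
have wS : w \in handlebody_tuples.
  apply/handlebody_tuplesP; split=> //; apply: surjective_generates => //.
  apply/seteqP; split=> // h _; have [z _ <-] : range g h by rewrite gs.
  rewrite Ew; exists (generic_quotient.repr (generic_quotient.repr z)) => //=.
  by rewrite !tquotK.
have cw := handlebody_closed wS.
have Ec : cover_hom (thom w) = g \o tquot S.
  by apply: tquot_ext; apply/funext => u; rewrite /= (cover_homE (thomP w) cw) Ew.
have wS' : act w phi \in handlebody_tuples.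
  apply/handlebody_tuplesP; split.
    move=> i; rewrite ffunE /act_hom /= Ec; apply: g1; right; exists i => //.
  apply: surjective_generates.
    move=> i; rewrite ffunE /act_hom /= Ec; apply: g1; right; exists i => //.
  rewrite (thom_act phi cw) /act_hom Ec.
  apply/seteqP; split=> // h _; have [z _ <-] : range g h by rewrite gs.
  exists (generic_quotient.repr ((phi^-1 : A) (generic_quotient.repr z))) => //=.
  by rewrite tquotK ker_autK tquotK.
exists w; first by rewrite /= inE wS wS'.
apply: tquot_ext; apply: tquot_ext; apply/funext => u /=.
by rewrite fE // Ew.
Qed.

End Counting.

Section Expectation.
Variables (F : topGroupType) (n : nat) (a b : 'I_n -> F).
Local Notation A := (ker_aut (schur_ker a b)).
Variables (l : nat) (l_prime : prime l) (hF : free_pro_group l (generators a b)).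
Variables (H : finGroupType) (lH : l.-group [set: H]%SET).
Local Notation tuple := {ffun 'I_n -> H * H}.
Local Notation act := (act hF lH).
Local Notation orbit := (orbit hF lH).
Local Notation handlebody_tuples := (handlebody_tuples n H).
Variables (t : 'I_n -> H).
Hypotheses (gt : generates t) (n_large : (3 * #|H| <= n)%N).

Lemma handlebody_tuple_mem : handlebody_tuple t \in handlebody_tuples.
Proof.
apply/handlebody_tuplesP; split=> [i|]; first by rewrite ffunE.
by rewrite (@eq_generates _ _ _ t) // => i; rewrite ffunE.
Qed.

Let tc := handlebody_closed hF lH handlebody_tuple_mem.

Lemma handlebody_orbit w : w \in handlebody_tuples -> w \in orbit (handlebody_tuple t).
Proof.
move=> /imsetP[y]; rewrite inE => gy ->; apply/orbitP.
apply: (surface_move_act tc).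
exact: (move_generating l_prime).
Qed.

Lemma orbit_bounds :
  (#|[set w : tuple | generates (fun i => (w i).2) && null_tuple w]%SET|
     <= #|orbit (handlebody_tuple t)|
     <= #|[set w : tuple | null_tuple w]%SET|)%N.
Proof.
apply/andP; split; apply: subset_leq_card; apply/subsetP=> w.
  rewrite inE => /andP[gw nw]; apply/orbitP; apply: (surface_move_act tc).
  apply: surface_move_trans (surface_move_handlebody l_prime hF lH gw nw).
  have -> : [ffun i => (1, (w i).2)] = handlebody_tuple (fun i => (w i).2) by [].
  exact: (move_generating l_prime).
move=> /orbitP[phi <-]; rewrite inE.
exact: null_tuple_act (handlebody_null handlebody_tuple_mem).
Qed.

Variables (R : realType) (mu : probability (borel A) R) (haar : haar_probability mu).

(** The expectation is the sum over pairs of handlebody tuples of the probability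
that phi carries the first to the second. *)
Lemma expected_surjections :
  (\int[mu]_phi counting (Sur (Zgroup phi) H) =
   (#|generating_tuples n H|%:R ^+ 2 / #|orbit (handlebody_tuple t)|%:R)%:E)%E.
Proof.
pose Q (p : tuple * tuple) := (p.1 \in handlebody_tuples) && (p.2 \in handlebody_tuples).
pose T (p : tuple * tuple) : set (borel A) := transporter hF lH p.1 p.2.
have mem_sum (phi : A) : counting (Sur (Zgroup phi) H) =
    (\sum_(p | Q p) (\1_(T p) phi)%:E)%E :> \bar R.
  rewrite (counting_Sur hF lH) sumEFin; congr (_%:E).
  rewrite -(pair_big (mem handlebody_tuples) (mem handlebody_tuples)
    (fun w w' => \1_(T (w, w')) phi : R)%R) /=.
  rewrite -sum1_card natr_sum big_mkcond [RHS]big_mkcond /=; apply: eq_bigr => w _.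
  rewrite !inE; case: (w \in handlebody_tuples) => //=.
  case: ifP => [wS|/negbT wS].
    rewrite (bigD1 (act w phi)) //= big1 ?addr0 => [|v /andP[_ /eqP neq]].
      by rewrite indicE mem_set.
    by rewrite indicE memNset // => E; apply: neq; apply: esym.
  rewrite big1 // => v vS; rewrite indicE memNset // => E.
  by case/negP: wS; rewrite (E : act w phi = v).
under eq_integral => phi _ do rewrite mem_sum.
rewrite integral_sum_indic => [|p /andP[pS _]]; last first.
  by apply: transporter_measurable; apply: handlebody_closed.
rewrite (eq_bigr (fun=> (#|orbit (handlebody_tuple t)|%:R^-1)%:E)) => [|p /andP[p1 p2]].
  rewrite sumEFin sumr_const; congr (_%:E).
  rewrite -[LHS]mulr_natl; congr (_ * _)%R.
  rewrite -(card_handlebody_tuples n H) expr2 -natrM -cardsX; congr (_%:R)%R.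
  by apply: eq_card => -[u v]; rewrite !inE.
by apply: (transporter_measure haar tc); apply: handlebody_orbit.
Qed.

End Expectation.

Lemma enum_generates (H : finGroupType) n : (#|H| <= n)%N ->
  generates (fun i : 'I_n => nth 1 (enum H) i).
Proof.
move=> Hn; rewrite /generates -subTset; apply/subsetP=> h _.
have hlt : (index h (enum H) < n)%N.
  by apply: leq_trans Hn; rewrite cardE index_mem mem_enum.
apply: mem_gen; apply/imsetP; exists (Ordinal hlt) => //=.
by rewrite nth_index // mem_enum.
Qed.

(** * The limit *)

Local Close Scope group_scope.
Local Open Scope ereal_scope.

Theorem propositionA1 (R : realType) (l : nat) (hl : prime l)
    (F : nat -> topGroupType) (a b : forall n : nat, 'I_n -> F n)
    (hF : forall n : nat, free_pro_group l (generators (a n) (b n)))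
    (mu : forall n : nat, probability (borel (ker_aut (schur_ker (a n) (b n)))) R)
    (hmu : forall n : nat, haar_probability (mu n))
    (H : finGroupType) (hH : (l.-group [set: H]%SET)%g) :
  \int[mu n]_phi counting (Sur (Zgroup phi) H) @[n --> \oo] -->
    (#|[~: [set: H]%SET, [set: H]%SET]%g|%:R)%:E * counting (H2 H).
Proof.
rewrite counting_H2 -EFinM -natrM -card_schur_der.
pose t n (i : 'I_n) : H := nth 1%g (enum H) i.
pose O n := #|orbit (hF n) hH (handlebody_tuple (@t n))|.
have n_ge n : (3 * #|H| <= n)%N -> generates (@t n).
  by move=> n3; apply: enum_generates; apply: leq_trans n3; rewrite leq_pmull.
have expectation n (n3 : (3 * #|H| <= n)%N) :=
  expected_surjections hl (hF n) hH (n_ge n n3) n3 (hmu n).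
have lim := @orbit_limit R H O (3 * #|H|)%N
  (fun n n3 => orbit_bounds hl (hF n) hH (n_ge n n3) n3).
have large : \forall n \near \oo, (3 * #|H| <= n)%N by exists (3 * #|H|)%N.
apply: cvg_EFin.
  by apply: filterS large => n n3; rewrite expectation.
apply: cvg_trans lim; apply: near_eq_cvg.
by apply: filterS large => n n3; rewrite /= expectation.
Qed.
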